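(* Let $W$ be a complex reflection group and $K$ a proper field for $W$. The simple $\mathrm{Br}^K(W)$-modules are (up to isomorphism) exactly the modules $(B\,|\,V)$ where $(B,V)$ is an admissible pair and $V$ is a simple $K\mathrm{Stab}(B)$-module; these modules are, in that case, absolutely irreducible. Moreover, for two admissible pairs $(B,V)$, $(B',V')$ (with $V$, $V'$ not necessarily simple), the $\mathrm{Br}^K(W)$-modules $(B\,|\,V)$ and $(B'\,|\,V')$ are isomorphic if and only if $(B,V)$ and $(B',V')$ are conjugate.
   Context: All modules are finite dimensional over $K$. Complex reflection groups. A reflection of a finite dimensional complex vector space $V_W$ is an $r\in GL(V_W)$ such that $H_r:=\ker(r-1)$ has codimension $1$; $H_r$ is its reflecting hyperplane. A complex reflection group $W\subseteq GL(V_W)$ is a finite group generated by reflections. $\mathcal R$ is the set of reflections in $W$ and $\mathcal H$ the set of their reflecting hyperplanes. $W$ acts on $\mathcal H$ by $wH=w(H)$ and on $\mathcal R$ by conjugation; $\sim$ denotes conjugacy. $\mathcal R_{a\to b}$ is the set of $s\in\mathcal R$ with $sa=b$. Distinct $H_1,H_2\in\mathcal H$ are transverse, $H_1\pitchfork H_2$, if they are the only elements of $\mathcal H$ containing $H_1\cap H_2$; $H_1\not\pitchfork H_2$ means distinct and not transverse. A transverse collection is a (possibly empty) set of pairwise transverse elements of $\mathcal H$; $\mathcal C$ is the set of all of them, with the induced $W$-action. $H\pitchfork B$ means $H$ is transverse with every element of $B$ (always true if $B=\emptyset$). $\mathrm{Stab}(B)=\{w\in W: wB=B\}$. Brauer-Chen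 algebra. Let $\delta,\mu_s$ ($s\in\mathcal R$) be indeterminates, $\underline\mu=\{\mu_s\}$, and $\mathcal A=\mathbb Z[\underline\mu^{\pm1},\delta^{\pm1}]/(\mu_s-\mu_{s'}\mid s\sim s')$. $\mathrm{Br}(W)$ is the $\mathcal A$-algebra generated by the elements of $W$ (with the group relations) and elements $e_H$, $H\in\mathcal H$, with relations: (B1) $e_H^2=\delta e_H$; (B2) $we_Hw^{-1}=e_{wH}$; (B3) $we_H=e_H$ if $H\subseteq\ker(w-1)$; (B4) $e_{H_1}e_{H_2}=e_{H_2}e_{H_1}$ if $H_1\pitchfork H_2$; (B5) $e_{H_1}e_{H_2}=\sum_{s\in\mathcal R_{H_2\to H_1}}\mu_s s\,e_{H_2}$ if $H_1\not\pitchfork H_2$. For an $\mathcal A$-algebra $R$, $\mathrm{Br}^R(W)=R\otimes_{\mathcal A}\mathrm{Br}(W)$. For $B\in\mathcal C$, $e_B=\prod_{H\in B}e_H$ ($e_\emptyset=1$). Proper rings. A (commutative) $\mathcal A$-algebra $R$ is proper for $W$ if $R$ is a domain of characteristic $0$; $\mathrm{Frac}(R)$ has a subfield $k_R$ containing the images of $\underline\mu$ over which every subgroup of $W$ splits; $\delta$ is transcendental over $k_R$ and $\mathrm{Frac}(R)$ is a finite extension of $k_R(\delta)$. A proper field is a proper $R$ that is a field. Admissibility. For $B\in\mathcal C$ and a $K\mathrm{Stab}(B)$-module $V$, let $\hat V$ be the image of $V$ in $\mathrm{Ind}_{K\mathrm{Stab}(B)}^{KW}V$. The pair $(B,V)$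 is admissible if $\mathrm{Ann}_{KW}(e_B)\cdot\hat V=0$, where $\mathrm{Ann}_{KW}(e_B)=\{x\in KW: xe_B=0\text{ in }\mathrm{Br}^K(W)\}$. The module $(B\,|\,V)$. For an admissible pair $(B,V)$, $(B\,|\,V)$ is the $KW$-module $\mathrm{Ind}_{K\mathrm{Stab}(B)}^{KW}V=\bigoplus_{B'\in W\cdot B}V^{B'}$, where $V^{wB}:=w\hat V$, with $e_H$ acting on $v\in V^{B'}$ by: $e_Hv=\delta v$ if $H\in B'$; $e_Hv=0$ if $H\pitchfork B'$; $e_Hv=\sum_{s\in\mathcal R_{H'\to H}}\mu_s sv$ if $H\not\pitchfork H'$ with $H'\in B'$ (this is independent of the choice of such $H'$ and defines a $\mathrm{Br}^K(W)$-module). Two pairs $(B,V)$, $(B',V')$ are conjugate if there is $w\in W$ with $wB=B'$ and such that the representation of $\mathrm{Stab}(B')=w\mathrm{Stab}(B)w^{-1}$ obtained from that of $V$ by transport via conjugation by $w$ is isomorphic to $V'$.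
   Formalization: The isomorphism criterion is stated for V and V' not both zero: if V = V' = 0, then (B|V) and (B'|V') are both the zero module, hence isomorphic, even when B and B' are not conjugate. *)

(* Defs.v *)
From HB Require Import structures.
From mathcomp Require Import all_boot all_order all_algebra all_fingroup.
From mathcomp Require Import all_character.
From mathcomp Require Import finmap boolp reals complex.
From mathcomp.multinomials Require Import monalg.

Set Implicit Arguments.
Unset Strict Implicit.
Unset Printing Implicit Defensive.

Import GRing.Theory.
Local Open Scope ring_scope.

Definition is_reflection (F : fieldType) (V : vectType F) (r : 'End(V)) :=
  (\dim (lker (r - \1%VF))).+1 == \dim {:V}.

(* A finite subgroup of GL(V) is encoded as an abstract finite group with a
   faithful linear action; the action is on the left. *)
Record complexReflectionGroup (R : realType) := ComplexReflectionGroup {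
  crg_group :> finGroupType;
  crg_space : vectType R[i];
  crg_act : crg_group -> 'End(crg_space);
  crg_act1 : crg_act 1%g = \1%VF;
  crg_actM : forall x y, crg_act (x * y)%g = (crg_act x \o crg_act y)%VF;
  crg_act_inj : injective crg_act;
  crg_gen : <<[set r | is_reflection (crg_act r)]>>%g = [set: crg_group]
}.

Section ReflectionGroup.

Variables (R : realType) (W : complexReflectionGroup R).
Local Notation act := (@crg_act R W).

Definition reflections : {set W} := [set r | is_reflection (act r)].

Definition fixed_space (r : W) : {vspace crg_space W} := lker (act r - \1%VF).

Definition hyperplanes : seq {vspace crg_space W} :=
  undup [seq fixed_space r | r <- enum reflections].

Definition hyp := seq_sub hyperplanes.

Lemma crg_actK (w : W) : (act w^-1 \o act w = \1)%VF.
Proof. by rewrite -crg_actM mulVg crg_act1. Qed.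

Lemma crg_actVK (w : W) : (act w \o act w^-1 = \1)%VF.
Proof. by rewrite -crg_actM mulgV crg_act1. Qed.

Lemma fixed_space_conj (w r : W) :
  (act w @: fixed_space r)%VS = fixed_space (w * r * w^-1)%g.
Proof.
have K1 v : act w^-1 (act w v) = v by rewrite -comp_lfunE crg_actK id_lfunE.
have K2 v : act w (act w^-1 v) = v by rewrite -comp_lfunE crg_actVK id_lfunE.
have memF s v : (v \in fixed_space s) = (act s v == v).
  by rewrite memv_ker add_lfunE opp_lfunE id_lfunE subr_eq0.
have E v : act (w * r * w^-1)%g v = act w (act r (act w^-1 v)).
  by rewrite !crg_actM !comp_lfunE.
apply/vspaceP=> v; rewrite memF E; apply/memv_imgP/eqP.
  by case=> u; rewrite memF => /eqP Hu ->; rewrite K1 Hu.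
move=> Hv; exists (act w^-1 v); last by rewrite K2.
by rewrite memF -{2}Hv K1.
Qed.

Lemma fixed_space_reflJ (w r : W) :
  r \in reflections -> (w * r * w^-1)%g \in reflections.
Proof.
rewrite !inE /is_reflection -!/(fixed_space _) -fixed_space_conj.
rewrite limg_dim_eq //; apply/eqP; rewrite -subv0 /=.
apply/subvP=> v; rewrite memv_cap => /andP[_]; rewrite memv_ker => /eqP wv0.
by rewrite memv0 -[v]id_lfunE -(crg_actK w) comp_lfunE wv0 linear0.
Qed.

Lemma hyp_act_subproof (w : W) (H : hyp) :
  (act w @: ssval H)%VS \in hyperplanes.
Proof.
have := ssvalP H; rewrite !mem_undup => /mapP[r rR ->].
rewrite fixed_space_conj; apply/mapP; exists (w * r * w^-1)%g => //.
by rewrite mem_enum fixed_space_reflJ // -mem_enum.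
Qed.

Definition hyp_act (w : W) (H : hyp) : hyp := SeqSub (hyp_act_subproof w H).

Definition hset_act (w : W) (B : {set hyp}) : {set hyp} :=
  [set hyp_act w H | H in B].

Lemma hyp_act1 (H : hyp) : hyp_act 1%g H = H.
Proof. by apply: val_inj; rewrite /= crg_act1 lim1g. Qed.

Lemma hyp_actM (x y : W) (H : hyp) :
  hyp_act (x * y)%g H = hyp_act x (hyp_act y H).
Proof. by apply: val_inj; rewrite /= crg_actM limg_comp. Qed.

Lemma hset_act1 (B : {set hyp}) : hset_act 1%g B = B.
Proof.
by rewrite /hset_act (eq_imset _ (_ : hyp_act 1%g =1 id)) ?imset_id //;
  exact: hyp_act1.
Qed.

Lemma hset_actM (x y : W) (B : {set hyp}) :
  hset_act (x * y)%g B = hset_act x (hset_act y B).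
Proof.
by rewrite /hset_act -imset_comp; apply: eq_imset => H; rewrite hyp_actM.
Qed.

Definition refl_between (H1 H2 : hyp) : {set W} :=
  [set s in reflections | hyp_act s H1 == H2].

Definition transverse (H1 H2 : hyp) : bool :=
  (H1 != H2) &&
  [forall H : hyp, (ssval H1 :&: ssval H2 <= ssval H)%VS
                   ==> (H == H1) || (H == H2)].

Definition nontransverse (H1 H2 : hyp) : bool :=
  (H1 != H2) && ~~ transverse H1 H2.

Definition transverse_to (H : hyp) (B : {set hyp}) : bool :=
  [forall H' in B, transverse H H'].

Definition transverse_collection (B : {set hyp}) : bool :=
  [forall H1 in B, forall H2 in B, (H1 != H2) ==> transverse H1 H2].

Definition Stab_set (B : {set hyp}) : {set W} := [set w | hset_act w B == B].

Lemma Stab_group_set (B : {set hyp}) : group_set (Stab_set B).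
Proof.
apply/group_setP; split=> [|x y]; rewrite !inE ?hset_act1 //.
by move=> /eqP xB /eqP yB; rewrite hset_actM yB xB.
Qed.

Definition Stab (B : {set hyp}) : {group W} := Group (Stab_group_set B).

End ReflectionGroup.

(* A structure of algebra over Z[mu^{+-1}, delta^{+-1}] / (mu_s - mu_s' | s ~ s')
   on A: by the universal property of this ring, it is the choice of the
   images of delta and of the mu_s.  The values of [mu] outside the set of
   reflections are irrelevant. *)
Record brauerParams (R : realType) (W : complexReflectionGroup R)
    (A : comUnitRingType) := BrauerParams {
  mu : W -> A;
  delta : A;
  mu_unit : forall s, s \in reflections W -> mu s \is a GRing.unit;
  delta_unit : delta \is a GRing.unit;
  mu_conj : forall s w : W, s \in reflections W -> mu (s ^ w)%g = mu s
}.

Lemma malg_scaleAr (M : monomType) (A : comNzRingType) (a : A)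
    (u v : {malg A[M]}) : a *: (u * v) = u * (a *: v).
Proof.
apply/malgP=> k; rewrite mcoeffZ mcoeffMl.
rewrite (mcoeffMlw k (fsubset_refl _) (msuppZ_le a v)) mulr_sumr.
apply: eq_bigr => k1 _; rewrite mulr_sumr; apply: eq_bigr => k2 _.
by rewrite mcoeffZ mulrnAr mulrCA.
Qed.

Section BrauerChen.

Variables (R : realType) (W : complexReflectionGroup R) (A : comUnitRingType).
Variable P : brauerParams W A.

Local Notation gen := (W + hyp W)%type.

Definition br_free := {malg A[{fmonom gen}]}.

Definition free_w (w : W) : br_free := << fmu (inl w : gen) >>.
Definition free_e (H : hyp W) : br_free := << fmu (inr H : gen) >>.

Inductive br_relation : br_free -> br_free -> Prop :=
| Rel_1 : br_relation (free_w 1%g) 1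
| Rel_M w1 w2 : br_relation (free_w w1 * free_w w2) (free_w (w1 * w2)%g)
| Rel_B1 H : br_relation (free_e H * free_e H) (delta P *: free_e H)
| Rel_B2 w H :
    br_relation (free_w w * free_e H * free_w w^-1%g) (free_e (hyp_act w H))
| Rel_B3 w H : (ssval H <= fixed_space w)%VS ->
    br_relation (free_w w * free_e H) (free_e H)
| Rel_B4 H1 H2 : transverse H1 H2 ->
    br_relation (free_e H1 * free_e H2) (free_e H2 * free_e H1)
| Rel_B5 H1 H2 : nontransverse H1 H2 ->
    br_relation (free_e H1 * free_e H2)
      ((\sum_(s in refl_between H2 H1) mu P s *: free_w s) * free_e H2).

Inductive br_ideal : br_free -> Prop :=
| Ideal_rel u v : br_relation u v -> br_ideal (u - v)
| Ideal_0 : br_ideal 0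
| Ideal_D u v : br_ideal u -> br_ideal v -> br_ideal (u + v)
| Ideal_Ml a u : br_ideal u -> br_ideal (a * u)
| Ideal_Mr a u : br_ideal u -> br_ideal (u * a).

Definition br_idealb : {pred br_free} := fun u => `[< br_ideal u >].

Lemma br_idealP u : reflect (br_ideal u) (u \in br_idealb).
Proof. exact: asboolP. Qed.

Lemma br_ideal_zmod_closed : zmod_closed br_idealb.
Proof.
split; first by apply/br_idealP/Ideal_0.
move=> u v /br_idealP Iu /br_idealP Iv; apply/br_idealP.
by apply: Ideal_D => //; rewrite -mulN1r; apply: Ideal_Ml.
Qed.

HB.instance Definition _ :=
  GRing.isZmodClosed.Build br_free br_idealb br_ideal_zmod_closed.

(* The library only multiplies in quotients of commutative rings; the ring and
   algebra structures for the two-sided ideal [br_ideal] are added below. *)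
Definition Br := Quotient.quot br_idealb.

HB.instance Definition _ := GRing.Zmodule.on Br.

Local Notation pi := (\pi_Br%qT : br_free -> Br).

Lemma br_pi_eq u v : (pi u = pi v) <-> br_ideal (u - v).
Proof.
split=> [/eqP|Iuv]; first by rewrite -Quotient.idealrBE => /br_idealP.
by apply/eqP; rewrite -Quotient.idealrBE; apply/br_idealP.
Qed.

Lemma br_piK (x : Br) : pi (generic_quotient.repr x) = x.
Proof. exact: reprK. Qed.

Lemma br_piD : {morph pi : u v / u + v}.
Proof. by move=> u v; rewrite !piE. Qed.

Lemma br_repr_pi u : br_ideal (generic_quotient.repr (pi u) - u).
Proof. by apply/br_pi_eq; rewrite br_piK. Qed.

(* The operations are locked to keep unification from computing in Br. *)
Fact br_key : unit. Proof. by []. Qed.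

Definition br_one : Br := locked_with br_key (pi 1).
Definition br_mul : Br -> Br -> Br := locked_with br_key
  (fun x y => pi (generic_quotient.repr x * generic_quotient.repr y)).
Definition br_scale : A -> Br -> Br := locked_with br_key
  (fun a x => pi (a *: generic_quotient.repr x)).

Lemma br_oneE : br_one = pi 1.
Proof. by rewrite /br_one locked_withE. Qed.

Lemma br_pi_mul u v : br_mul (pi u) (pi v) = pi (u * v).
Proof.
rewrite /br_mul locked_withE.
apply/br_pi_eq; rewrite -(subrKA (generic_quotient.repr (pi u) * v)).
apply: Ideal_D.
  by rewrite -mulrBr; apply/Ideal_Ml/br_repr_pi.
by rewrite -mulrBl; apply/Ideal_Mr/br_repr_pi.
Qed.

Lemma br_idealZ a u : br_ideal u -> br_ideal (a *: u).
Proof. by move=> Iu; rewrite -[u]mul1r scalerAl; apply: Ideal_Ml. Qed.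

Lemma br_pi_scale a u : br_scale a (pi u) = pi (a *: u).
Proof.
rewrite /br_scale locked_withE.
by apply/br_pi_eq; rewrite -scalerBr; apply/br_idealZ/br_repr_pi.
Qed.

(* The character of the free algebra with w |-> 1 and e_H |-> 0 kills the
   ideal, so that Br is a nonzero ring. *)
Definition aug_mon (m : {fmonom gen}) : A :=
  \prod_(x <- (m : seq gen)) (if x is inl _ then 1 else 0).

Lemma aug_mon_is_mmorphism :
  mmorphism aug_mon.
Proof.
split=> [m n|].
  by rewrite /aug_mon fmM big_cat.
by rewrite /aug_mon fm1 big_nil.
Qed.

HB.instance Definition _ :=
  isMultiplicative.Build {fmonom gen} A aug_mon aug_mon_is_mmorphism.

Definition aug : br_free -> A := mmap idfun aug_mon.

HB.instance Definition _ := GRing.RMorphism.on aug.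

Lemma aug_w w : aug (free_w w) = 1.
Proof. by rewrite /aug mmapU /= /aug_mon fmU big_seq1 mulr1. Qed.

Lemma aug_e H : aug (free_e H) = 0.
Proof. by rewrite /aug mmapU /= /aug_mon fmU big_seq1 mulr0. Qed.

Lemma augZ a u : aug (a *: u) = a * aug u.
Proof. exact: mmapZ. Qed.

Lemma aug1 : aug 1 = 1. Proof. exact: rmorph1. Qed.
Lemma augD u v : aug (u + v) = aug u + aug v. Proof. exact: raddfD. Qed.
Lemma augB u v : aug (u - v) = aug u - aug v. Proof. exact: raddfB. Qed.
Lemma augM u v : aug (u * v) = aug u * aug v. Proof. exact: rmorphM. Qed.

Lemma aug0l u v : aug u = 0 -> aug (u * v) = 0.
Proof. by move=> u0; rewrite augM u0 mul0r. Qed.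

Lemma aug0r u v : aug v = 0 -> aug (u * v) = 0.
Proof. by move=> v0; rewrite augM v0 mulr0. Qed.

Lemma aug_relation u v : br_relation u v -> aug u = aug v.
Proof.
case=> [|w1 w2|H|w H|w H _|H1 H2 _|H1 H2 _].
- by rewrite aug_w aug1.
- by rewrite augM !aug_w mulr1.
- by rewrite augZ aug_e mulr0 (aug0r _ (aug_e H)).
- by rewrite aug_e; apply/aug0l/aug0r/aug_e.
- by rewrite aug_e; apply/aug0r/aug_e.
- exact: etrans (aug0r _ (aug_e H2)) (esym (aug0r _ (aug_e H1))).
- exact: etrans (aug0r _ (aug_e H2)) (esym (aug0r _ (aug_e H2))).
Qed.

Lemma aug_ideal u : br_ideal u -> aug u = 0.
Proof.
elim=> [{}u v r | | {}u v _ Iu _ Iv | a {}u _ Iu | a {}u _ Iu].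
- by rewrite augB (aug_relation r) subrr.
- exact: raddf0.
- by rewrite augD Iu Iv addr0.
- by rewrite augM Iu mulr0.
- by rewrite augM Iu mul0r.
Qed.

Fact br_mulA : associative br_mul.
Proof.
by move=> x y z; rewrite -[x]br_piK -[y]br_piK -[z]br_piK !br_pi_mul mulrA.
Qed.

Fact br_mul1 : left_id br_one br_mul.
Proof. by move=> x; rewrite -[x]br_piK br_oneE br_pi_mul mul1r. Qed.

Fact br_mulr1 : right_id br_one br_mul.
Proof. by move=> x; rewrite -[x]br_piK br_oneE br_pi_mul mulr1. Qed.

Fact br_mulDl : left_distributive br_mul +%R.
Proof.
move=> x y z; rewrite -[x]br_piK -[y]br_piK -[z]br_piK.
by rewrite -br_piD !br_pi_mul mulrDl br_piD.
Qed.

Fact br_mulDr : right_distributive br_mul +%R.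
Proof.
move=> x y z; rewrite -[x]br_piK -[y]br_piK -[z]br_piK.
by rewrite -br_piD !br_pi_mul mulrDr br_piD.
Qed.

Fact br_one_neq0 : br_one != 0.
Proof.
have pi0 : pi 0 = 0 by apply: (addIr (pi 0)); rewrite -br_piD !add0r.
apply/eqP; rewrite br_oneE -pi0 => /br_pi_eq /aug_ideal.
by rewrite subr0 aug1 => /eqP; rewrite oner_eq0.
Qed.

HB.instance Definition _ := GRing.Zmodule_isNzRing.Build Br
  br_mulA br_mul1 br_mulr1 br_mulDl br_mulDr br_one_neq0.

Lemma br_mulE (x y : Br) : x * y = br_mul x y. Proof. by []. Qed.

Fact br_scaleA a b x : br_scale a (br_scale b x) = br_scale (a * b) x.
Proof. by rewrite -[x]br_piK !br_pi_scale scalerA. Qed.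

Fact br_scale1 : left_id 1 br_scale.
Proof. by move=> x; rewrite -[x]br_piK br_pi_scale scale1r. Qed.

Fact br_scaleDr : right_distributive br_scale +%R.
Proof.
move=> a x y; rewrite -[x]br_piK -[y]br_piK -br_piD !br_pi_scale.
by rewrite scalerDr br_piD.
Qed.

Fact br_scaleDl x : {morph br_scale^~ x : a b / a + b}.
Proof.
by move=> a b; rewrite -[x]br_piK !br_pi_scale scalerDl br_piD.
Qed.

HB.instance Definition _ := GRing.Zmodule_isLmodule.Build A Br
  br_scaleA br_scale1 br_scaleDr br_scaleDl.

Lemma br_scaleE a (x : Br) : a *: x = br_scale a x. Proof. by []. Qed.

Fact br_scaleAl (a : A) (x y : Br) : a *: (x * y) = (a *: x) * y.
Proof.
rewrite -[x]br_piK -[y]br_piK !br_mulE !br_scaleE.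
by rewrite !(br_pi_mul, br_pi_scale) scalerAl.
Qed.

HB.instance Definition _ := GRing.Lmodule_isLalgebra.Build A Br br_scaleAl.

Fact br_scaleAr (a : A) (x y : Br) : a *: (x * y) = x * (a *: y).
Proof.
rewrite -[x]br_piK -[y]br_piK !br_mulE !br_scaleE.
by rewrite !(br_pi_mul, br_pi_scale) malg_scaleAr.
Qed.

HB.instance Definition _ := GRing.Lalgebra_isAlgebra.Build A Br br_scaleAr.

Definition br_w : W -> Br := locked_with br_key (fun w => pi (free_w w)).
Definition br_e : hyp W -> Br := locked_with br_key (fun H => pi (free_e H)).

Lemma br_wE w : br_w w = pi (free_w w).
Proof. by rewrite /br_w locked_withE. Qed.

Lemma br_eE H : br_e H = pi (free_e H).
Proof. by rewrite /br_e locked_withE. Qed.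

Lemma br_pi1 : pi 1 = 1.
Proof. exact: esym br_oneE. Qed.

Lemma br_piM u v : pi (u * v) = pi u * pi v.
Proof. exact: esym (br_pi_mul u v). Qed.

Lemma br_piZ a u : pi (a *: u) = a *: pi u.
Proof. exact: esym (br_pi_scale a u). Qed.

End BrauerChen.
(* Modules are given by matrices acting on the left on column vectors, so
   submodules are stable subspaces of F^m.  The library's [mx_irreducible],
   used below for group representations, quantifies over row spaces instead;
   for a given family of matrices the two conditions are equivalent. *)
Definition simple_action (F : fieldType) (m : nat) (I : Type)
    (f : I -> 'M[F]_m) : Prop :=
  (0 < m)%N /\
  forall U : {vspace 'cV[F]_m},
    (forall x v, v \in U -> f x *m v \in U) -> U = 0%VS \/ U = fullv.

Section Induction.

Variables (F : fieldType) (gT : finGroupType) (S : {group gT}) (d : nat).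
Variable rV : mx_representation F S d.

Definition n_lcosets : nat := #|lcosets S [set: gT]|.

Definition lcoset_repr (i : 'I_n_lcosets) : gT := fingroup.repr (enum_val i).

Definition ind_dim : nat := (\sum_(i < n_lcosets) d)%N.

(* F[gT] (x)_{F[S]} V is the direct sum of the t_i (x) V for t_i in a
   transversal of the left cosets of S; g sends t_j (x) v to
   t_i (x) (t_i^-1 g t_j) v where g t_j \in t_i S. *)
Definition ind_mx (g : gT) : 'M[F]_ind_dim :=
  \mxblock_(i < n_lcosets, j < n_lcosets)
    (let x := ((lcoset_repr i)^-1 * g * lcoset_repr j)%g in
     if x \in S then rV x else 0 : 'M[F]_d).

(* Matrix of the canonical map v |-> 1 (x) v. *)
Definition ind_unit : 'M[F]_(ind_dim, d) :=
  \mxcol_(i < n_lcosets)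
    (let x := ((lcoset_repr i)^-1)%g in if x \in S then rV x else 0 : 'M[F]_d).

Lemma lcoset_repr_index (y : gT) :
  exists i0, forall i, (((lcoset_repr i)^-1 * y)%g \in S) = (i == i0).
Proof.
have yL : (y *: S)%g \in lcosets S [set: gT].
  by apply/lcosetsP; exists y; rewrite ?inE.
exists (enum_rank_in yL (y *: S)%g) => i.
rewrite -mem_lcoset -(inj_eq enum_val_inj) (enum_rankK_in yL yL).
have /lcosetsP[x _ Ex] := enum_valP i.
have Ei : (lcoset_repr i *: S)%g = enum_val i.
  rewrite /lcoset_repr Ex; apply: lcoset_eqP.
  by apply: (mem_repr x); apply: lcoset_refl.
by rewrite -Ei; apply/idP/eqP => [/lcoset_eqP <- // | ->]; apply: lcoset_refl.
Qed.

Lemma ind_mx_repr : mx_repr [set: gT] ind_mx.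
Proof.
split=> [|x y _ _].
  rewrite -(@mxdiagZ F _ (fun=> d)) /mxdiag /ind_mx; apply: eq_mxblock => i j.
  have [k0 Ek] := lcoset_repr_index (lcoset_repr j).
  have /esym := Ek j; rewrite mulVg group1 => /eqP jk0.
  rewrite mulg1 Ek -jk0; case: eqVneq => // ->.
  by rewrite conform_mx_id mulVg repr_mx1.
rewrite /ind_mx mul_mxblock; apply: eq_mxblock => i k.
have [j0 Ej] := lcoset_repr_index (y * lcoset_repr k)%g.
rewrite (bigD1 j0) //= big1 => [|j ne_jj0]; last first.
  by rewrite -[(_^-1 * y * _)%g]mulgA Ej (negPf ne_jj0) mulmx0.
rewrite addr0 -[((lcoset_repr j0)^-1 * y * _)%g]mulgA Ej eqxx.
have Sj0 : ((lcoset_repr j0)^-1 * (y * lcoset_repr k))%g \in S by rewrite Ej.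
have -> : ((lcoset_repr i)^-1 * (x * y) * lcoset_repr k =
  ((lcoset_repr i)^-1 * x * lcoset_repr j0) *
  ((lcoset_repr j0)^-1 * (y * lcoset_repr k)))%g.
  by rewrite !mulgA mulgK.
rewrite groupMr //; case: ifP => [Si|_]; last by rewrite mul0mx.
by rewrite repr_mxM.
Qed.

Definition ind_repr : mx_representation F [set: gT] ind_dim :=
  MxRepresentation ind_mx_repr.

End Induction.

Section BrauerModules.

Variables (R : realType) (W : complexReflectionGroup R) (K : fieldType).
Variable P : brauerParams W K.

(* c belongs to the subfield k(x) of K generated by x and the image of k. *)
Definition in_adjoin (k : fieldType) (iota : {rmorphism k -> K}) (x c : K) :=
  exists p q : {poly k},
    (map_poly iota q).[x] != 0 /\
    c = (map_poly iota p).[x] / (map_poly iota q).[x].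

Definition finite_over_adjoin (k : fieldType) (iota : {rmorphism k -> K})
    (x : K) :=
  exists n (b : 'I_n -> K), forall y : K, exists c : 'I_n -> K,
    (forall i, in_adjoin iota x (c i)) /\ y = \sum_i c i * b i.

(* As K is a field, Frac(K) = K. *)
Definition proper_field : Prop :=
  [pchar K] =i pred0 /\
  exists (k : fieldType) (iota : {rmorphism k -> K}),
    [/\ forall s, s \in reflections W -> exists a : k, iota a = mu P s,
        forall H : {group W}, group_splitting_field k H,
        ~ algebraicOver iota (delta P) &
        finite_over_adjoin iota (delta P)].

Record brModule (m : nat) := BrModule {
  br_act :> Br P -> 'M[K]_m;
  br_act_linear : linear br_act;
  br_act1 : br_act 1 = 1%:M;
  br_actM : forall x y, br_act (x * y) = br_act x *m br_act y
}.

Definition br_simple (m : nat) (M : brModule m) : Prop := simple_action M.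

Definition br_absolutely_irreducible (m : nat) (M : brModule m) : Prop :=
  forall (L : fieldType) (f : {rmorphism K -> L}),
    simple_action (fun x : Br P => map_mx f (M x)).

Definition br_iso (m n : nat) (M : brModule m) (N : brModule n) : Prop :=
  exists T : 'M[K]_(n, m),
    [/\ row_free T, row_full T & forall x, T *m M x = N x *m T].

(* The factors commute by (B4) when B is a transverse collection. *)
Definition br_eB (B : {set hyp W}) : Br P := \prod_(H in B) br_e P H.

(* Elements of KW are the families of their coefficients. *)
Definition br_of_KW (x : {ffun W -> K}) : Br P := \sum_w x w *: br_w P w.

Definition in_Ann_eB (B : {set hyp W}) (x : {ffun W -> K}) : Prop :=
  br_of_KW x * br_eB B = 0.

Section Pair.

Variables (B : {set hyp W}) (d : nat) (rV : mx_representation K (Stab B) d).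

(* The subspace V^ of Ind V is the set of the [ind_unit rV *m u], and V^{wB}
   is its translate by w. *)
Definition admissible : Prop :=
  transverse_collection B /\
  forall x : {ffun W -> K}, in_Ann_eB B x ->
  forall u : 'cV[K]_d,
    (\sum_w x w *: ind_repr rV w) *m (ind_unit rV *m u) = 0.

(* M is the Br-module (B | V), on the space of Ind V. *)
Definition is_BV (M : brModule (ind_dim (Stab B) d)) : Prop :=
  (forall w : W, M (br_w P w) = ind_repr rV w) /\
  forall (H : hyp W) (w : W) (u : 'cV[K]_d),
    let B' := hset_act w B in
    let v := ind_repr rV w *m (ind_unit rV *m u) in
    [/\ H \in B' -> M (br_e P H) *m v = delta P *: v,
        transverse_to H B' -> M (br_e P H) *m v = 0 &
        forall H' : hyp W, H' \in B' -> nontransverse H H' ->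
          M (br_e P H) *m v =
          \sum_(s in refl_between H' H) mu P s *: (ind_repr rV s *m v)].

(* For B' = wB, g in Stab(B') = w Stab(B) w^-1 acts on V as w^-1 g w, which is
   the library's [g ^ w]. *)
Lemma transport_subproof (w : W) (B' : {set hyp W}) (wB : hset_act w B = B') :
  mx_repr (Stab B') (fun g : W => rV (g ^ w)%g).
Proof.
have J (g : W) : g \in Stab B' -> (g ^ w)%g \in Stab B.
  rewrite !inE -wB => /eqP gB'; apply/eqP.
  rewrite conjgE !hset_actM gB' -hset_actM.
  by rewrite mulVg hset_act1.
split=> [|x y Bx By]; first by rewrite conj1g repr_mx1.
by rewrite conjMg repr_mxM ?J.
Qed.

Definition transport (w : W) (B' : {set hyp W}) (wB : hset_act w B = B') :
    mx_representation K (Stab B') d :=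
  MxRepresentation (transport_subproof wB).

End Pair.

Definition conjugate_pairs (B : {set hyp W}) (d : nat)
    (rV : mx_representation K (Stab B) d) (B' : {set hyp W}) (d' : nat)
    (rV' : mx_representation K (Stab B') d') : Prop :=
  exists (w : W) (wB : hset_act w B = B'), mx_rsim (transport rV wB) rV'.

End BrauerModules.

(* Main.v *)
(* For v in V^{B'} the vector e_H v is delta v if H lies in B', and otherwise a
   combination of translates of v with coefficients in the subfield k generated
   by the mu_s.  As delta is transcendental over k, the matrix over k that a
   dependency between vectors x_{B'} would produce cannot have delta as an
   eigenvalue; so in any module obeying these rules the pieces are independent.
   Hence a nonzero submodule of (B | V) meets some V^{B'} and, V being absolutely
   irreducible, is everything, over any extension of K.  Conversely, if S is
   simple and B is maximal with e_B S <> 0, then e_B S is a Stab(B)-module whose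
   translates form a direct sum, and S = (B | e_B S).  The piece V^B is recovered
   from (B | V) up to conjugation, as e_C M lies in the sum of the V^{B'} with
   C included in B'.

   The delicate point is that (B | V) is a module, and there the relation (B4):
   e_a e_c v = e_c e_a v for v in V^B and a, c transverse and not in B.
   Admissibility yields operators f_H that satisfy every linear relation between
   the elements w e_B and e_H w e_B of Br(W), so that f_a e_c v = f_c e_a v; and
   f_H = e_H on V^C unless H is transverse to C, where e_H is 0.  The defect
   (f_a - e_a) e_c v is nonzero only if a and c are non-transverse to the same
   elements of B, at most two.  If there is just one, e_a e_c v = 0 = e_c e_a v.
   If there are two, a single C contributes to the defect, the same for (a, c)
   and for (a, m), where m is the other element of C not in B.  So the pairs with
   a given nonzero defect carry a fixed-point free involution, and a parity count
   shows that the defects of (a, c) and (c, a) have the same component in the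
   only piece containing e_a e_c v and e_c e_a v. *)
Require Import Defs.
From HB Require Import structures.
From mathcomp Require Import all_boot all_order all_algebra all_fingroup.
From mathcomp Require Import all_character.
From mathcomp Require Import boolp reals complex.
From mathcomp.multinomials Require Import monalg.

Set Implicit Arguments.
Unset Strict Implicit.
Unset Printing Implicit Defensive.

Import GRing.Theory.
Local Open Scope ring_scope.

(** * Geometry of transverse hyperplanes *)

Section Geometry.

Variables (R : realType) (W : complexReflectionGroup R).
Local Notation act := (@crg_act R W).
Implicit Types (w s t r : W) (H K : hyp W) (B : {set hyp W}).
Implicit Types (v x y : crg_space W).

(** Why (B4) resists: admissibility speaks only of relations inside KW e_B. For H transverse to C,
    the product e_H e_C is a new element of Br, yet it has to act by 0 on V^C, and the hypothesis
    does not directly say that a combination of such products falling back into KW e_B acts by 0.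
    Hence the f_H: sending w e_B to the operator w on V^B is consistent by admissibility, and any
    linear extension of this to the elements e_H w e_B is accepted; its value is forced whenever H
    is not transverse to wB. The involution rests on one identity: for H in C outside B, the
    component in V^C of e_H v is that of the sum of the mu_s s v over all reflections s, divided by
    the number of elements of B outside C. It therefore does not depend on H. The bound two and the
    uniqueness of C are geometric. They come from the fact that a finite group contains no
    transvection, so that a root of K lies in every hyperplane transverse to K. *)

Lemma act_mulE w s x : act (w * s)%g x = act w (act s x).
Proof. by rewrite crg_actM comp_lfunE. Qed.

Lemma act_oneE x : act 1%g x = x.
Proof. by rewrite crg_act1 id_lfunE. Qed.

Lemma act_invK w : cancel (act w) (act w^-1%g).
Proof. by move=> x; rewrite -act_mulE mulVg act_oneE. Qed.

Lemma act_invVK w : cancel (act w^-1%g) (act w).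
Proof. by move=> x; rewrite -act_mulE mulgV act_oneE. Qed.

Lemma mem_fixed s x : (x \in fixed_space s) = (act s x == x).
Proof. by rewrite memv_ker add_lfunE opp_lfunE id_lfunE subr_eq0. Qed.

Lemma mem_hyp_act w H x : (x \in ssval (hyp_act w H)) = (act w^-1%g x \in ssval H).
Proof.
apply/memv_imgP/idP => [[y yH ->]|xH]; first by rewrite act_invK.
by exists (act w^-1%g x) => //; rewrite act_invVK.
Qed.

Lemma hyp_actK w : cancel (hyp_act w) (hyp_act w^-1%g : hyp W -> hyp W).
Proof. by move=> H; rewrite -hyp_actM mulVg hyp_act1. Qed.

Lemma hyp_actVK w : cancel (hyp_act w^-1%g) (hyp_act w : hyp W -> hyp W).
Proof. by move=> H; rewrite -hyp_actM mulgV hyp_act1. Qed.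

Lemma hyp_act_inj w : injective (@hyp_act R W w).
Proof. exact: can_inj (hyp_actK w). Qed.

Lemma hyp_reflection H : exists2 r, r \in reflections W & ssval H = fixed_space r.
Proof.
have := ssvalP H; rewrite !mem_undup => /mapP[r rR ->].
by exists r; rewrite // -mem_enum.
Qed.

Lemma reflection_hyp r : r \in reflections W ->
  exists H : hyp W, ssval H = fixed_space r.
Proof.
move=> rR; have Hr : fixed_space r \in hyperplanes W.
  by rewrite mem_undup; apply/mapP; exists r; rewrite // mem_enum.
by exists (SeqSub Hr).
Qed.

Lemma hyp_dim H : (\dim (ssval H)).+1 = \dim {:crg_space W}.
Proof. by have [r] := hyp_reflection H; rewrite inE => /eqP <- ->. Qed.

Lemma hyp_sub_eq H K : (ssval H <= ssval K)%VS -> H = K.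
Proof.
move=> sHK; apply: val_inj; apply/eqP => /=.
have := hyp_dim K; rewrite -(hyp_dim H) => -[E].
by rewrite eqEdim sHK /= E.
Qed.

(* A transvection over a field of characteristic 0 has infinite order. *)
Lemma unipotent_eq1 w v : act w v = v ->
  (forall x, act w x - x \in <[v]>%VS) -> w = 1%g.
Proof.
move=> wv wx; apply: (@crg_act_inj R W); apply/lfunP => x; rewrite act_oneE.
have fix_v y : y \in <[v]>%VS -> act w y = y.
  by case/vlineP => k ->; rewrite linearZ /= wv.
have iterE n : act (w ^+ n)%g x = x + (act w x - x) *+ n.
  elim: n => [|n IHn]; first by rewrite expg0 act_oneE mulr0n addr0.
  rewrite expgS act_mulE IHn linearD raddfMn /= (fix_v (act w x - x)) //.
  by rewrite mulrS addrA (addrC x) subrK.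
have /eqP := iterE #[w]%g; rewrite expg_order act_oneE eq_sym addrC -subr_eq0 addrK.
rewrite -scaler_nat scaler_eq0 Num.Theory.pnatr_eq0 -leqn0 leqNgt order_gt0 /=.
by rewrite subr_eq0 => /eqP.
Qed.

(** The image of r - 1 is a line. It cannot lie in the fixed hyperplane, or r would be a
    transvection of finite order, hence 1. *)
Lemma reflection_root r : r \in reflections W ->
  exists2 v, v \notin fixed_space r & forall x, act r x - x \in <[v]>%VS.
Proof.
move=> rR; have := rR; rewrite inE => /eqP dimr.
pose f : 'End(crg_space W) := act r - \1%VF.
have fE x : f x = act r x - x by rewrite add_lfunE opp_lfunE id_lfunE.
have dimf : \dim (limg f) = 1%N.
  have := limg_ker_dim f fullv; rewrite capfv -dimr -addn1.
  by move/eqP; rewrite eqn_add2l => /eqP.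
have nz : vpick (limg f) != 0 by rewrite vpick0 -dimv_eq0 dimf.
have Ev : limg f = <[vpick (limg f)]>%VS.
  apply/eqP; rewrite eq_sym eqEdim dim_vline nz dimf andbT.
  by apply/subvP => x /vlineP[k ->]; rewrite memvZ // memv_pick.
have fv x : act r x - x \in <[vpick (limg f)]>%VS.
  by rewrite -Ev -fE memv_img // memvf.
exists (vpick (limg f)) => //; rewrite mem_fixed; apply/negP => /eqP rv.
have r1 := unipotent_eq1 rv fv.
have := dimf; suff -> : limg f = 0%VS by rewrite dimv0.
apply/eqP; rewrite -subv0; apply/subvP => x /memv_imgP[y _ ->].
by rewrite fE r1 act_oneE subrr mem0v.
Qed.

Definition is_root v K := exists r,
  [/\ r \in reflections W, ssval K = fixed_space r, v \notin ssval K &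
      forall x, act r x - x \in <[v]>%VS].

Lemma hyp_root K : exists v, is_root v K.
Proof.
have [r rR Er] := hyp_reflection K; have [v vr rv] := reflection_root rR.
by exists v, r; rewrite Er.
Qed.

Lemma is_root_act w v K : is_root v K -> is_root (act w v) (hyp_act w K).
Proof.
case=> r [rR Er vK rv]; exists (w * r * w^-1)%g; split.
- exact: fixed_space_reflJ.
- by rewrite -fixed_space_conj -Er.
- by rewrite mem_hyp_act act_invK.
move=> x; rewrite !act_mulE -{2}[x](act_invVK w) -linearB /=.
by have /vlineP[k ->] := rv (act w^-1%g x); rewrite linearZ /= memvZ // memv_line.
Qed.

Lemma line_outside v H y : v \notin ssval H -> y \in <[v]>%VS ->
  y \in ssval H -> y = 0.
Proof.
move=> vH /vlineP[k ->]; have [->|k0] := eqVneq k 0; first by rewrite scale0r.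
by move/(memvZ k^-1); rewrite scalerA mulVf // scale1r (negPf vH).
Qed.

Lemma reflection_stable s v H : (forall x, act s x - x \in <[v]>%VS) ->
  v \in ssval H -> hyp_act s H = H.
Proof.
move=> sv vH; apply/esym/hyp_sub_eq/subvP => x xH; rewrite mem_hyp_act.
rewrite -[act _ x](subrK x) rpredD //.
have /vlineP[k Ek] := sv (act s^-1%g x).
by rewrite -opprB -{1}[x](act_invVK s) Ek rpredN memvZ.
Qed.

(** If r is the reflection of the root v, then r and s r s^-1 agree on v and move all vectors along
    v. So r^-1 s r s^-1 is unipotent of finite order, hence 1, and s preserves the fixed space of
    r. *)
Lemma hyp_act_fixed_root s v H : is_root v H -> act s v = v -> hyp_act s H = H.
Proof.
move=> rootv sv; have rootsv := is_root_act s rootv; rewrite sv in rootsv.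
case: rootv => r [rR Er vH rv].
have rVin x : act r^-1%g x - x \in <[v]>%VS.
  have /vlineP[k Ek] := rv (act r^-1%g x).
  rewrite act_invVK in Ek; rewrite -opprB Ek rpredN memvZ ?memv_line //.
have /vlineP[z Ez] := rv v.
have rvv : act r v = (1 + z) *: v by rewrite scalerDl scale1r addrC -Ez subrK.
pose q := (s * r * s^-1)%g.
have sVv : act s^-1%g v = v by rewrite -{1}sv act_invK.
have qv : act q v = act r v by rewrite /q !act_mulE sVv rvv linearZ /= sv.
have qin x : act q x - x \in <[v]>%VS.
  rewrite /q !act_mulE -{2}[x](act_invVK s) -linearB /=.
  have /vlineP[k ->] := rv (act s^-1%g x).
  by rewrite linearZ /= sv memvZ // memv_line.
have E : (r^-1 * q)%g = 1%g.
  apply: (@unipotent_eq1 _ v); first by rewrite act_mulE qv act_invK.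
  move=> x; rewrite act_mulE -[act q x](subrK x) linearD /= -addrA rpredD //.
  by have /vlineP[k ->] := qin x; rewrite linearZ /= memvZ //= -[act _ v](subrK v)
    rpredD ?memv_line.
apply: val_inj => /=; rewrite Er fixed_space_conj -/q.
by rewrite -[q](mulKVg r) E mulg1.
Qed.

Lemma transverse_sym H K : transverse H K = transverse K H.
Proof.
have imp L M : transverse L M -> transverse M L.
  case/andP=> LM /forallP tLM; rewrite /transverse eq_sym LM.
  by apply/forallP => X; rewrite capvC orbC.
by apply/idP/idP; apply: imp.
Qed.

Lemma nontransverse_sym H K : nontransverse H K = nontransverse K H.
Proof. by rewrite /nontransverse eq_sym transverse_sym. Qed.

Lemma transverse_neq H K : transverse H K -> H != K.
Proof. by case/andP. Qed.

Lemma transverseP H K L : transverse H K ->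
  (ssval H :&: ssval K <= ssval L)%VS -> L = H \/ L = K.
Proof.
case/andP=> _ /forallP/(_ L)/implyP tHK /tHK.
by case/orP => /eqP ->; [left|right].
Qed.

Lemma transverse_act w H K : transverse (hyp_act w H) (hyp_act w K) = transverse H K.
Proof.
have imp (u : W) L M : transverse L M -> transverse (hyp_act u L) (hyp_act u M).
  move=> tLM; rewrite /transverse (inj_eq (@hyp_act_inj u)) transverse_neq //.
  apply/forallP => X; apply/implyP => sX.
  have [|<-|<-] := @transverseP L M (hyp_act u^-1%g X) tLM;
    rewrite ?hyp_actVK ?eqxx ?orbT //.
  apply/subvP => x; rewrite memv_cap mem_hyp_act invgK => /andP[xL xM].
  by apply: (subvP sX); rewrite memv_cap !mem_hyp_act !act_invK xL.
apply/idP/idP => [tHK|]; last exact: imp.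
by rewrite -[H](hyp_actK w) -[K](hyp_actK w) imp.
Qed.

Lemma nontransverse_act w H K :
  nontransverse (hyp_act w H) (hyp_act w K) = nontransverse H K.
Proof. by rewrite /nontransverse transverse_act (inj_eq (@hyp_act_inj w)). Qed.

Lemma mem_hset_act w B H : (hyp_act w H \in hset_act w B) = (H \in B).
Proof. by rewrite /hset_act mem_imset //; apply: hyp_act_inj. Qed.

Lemma mem_hset_actV w B H : (H \in hset_act w B) = (hyp_act w^-1%g H \in B).
Proof. by rewrite -{1}[H](hyp_actVK w) mem_hset_act. Qed.

Lemma hset_actK w : cancel (hset_act w) (hset_act w^-1%g : {set hyp W} -> {set hyp W}).
Proof. by move=> B; rewrite -hset_actM mulVg hset_act1. Qed.

Lemma card_hset_act w B : #|hset_act w B| = #|B|.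
Proof. by rewrite card_imset //; apply: hyp_act_inj. Qed.

Lemma transverse_to_act w H B :
  transverse_to (hyp_act w H) (hset_act w B) = transverse_to H B.
Proof.
apply/forall_inP/forall_inP => tHB K KB.
  by rewrite -(transverse_act w) tHB // mem_hset_act.
by rewrite mem_hset_actV in KB; rewrite -[K](hyp_actVK w) transverse_act tHB.
Qed.

Lemma transverse_collection_act w B :
  transverse_collection (hset_act w B) = transverse_collection B.
Proof.
have imp (u : W) C : transverse_collection C -> transverse_collection (hset_act u C).
  move/forall_inP=> tC; apply/forall_inP => H HC; apply/forall_inP => K KC.
  rewrite !mem_hset_actV in HC KC.
  rewrite -[H](hyp_actVK u) -[K](hyp_actVK u) transverse_act.
  by rewrite (inj_eq (@hyp_act_inj u)) (forall_inP (tC _ HC)).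
apply/idP/idP => [tB|]; last exact: imp.
by rewrite -[B]hset_act1 -(mulVg w) hset_actM imp.
Qed.

Lemma transverse_collectionP B H K : transverse_collection B ->
  H \in B -> K \in B -> H != K -> transverse H K.
Proof. by move/forall_inP=> tB HB KB; apply/implyP; apply: (forall_inP (tB _ HB)). Qed.

(** The reflection r with root v fixes K pointwise, so r H contains the intersection of K and H, and
    transversality leaves r H = H. Were v outside H, then for x in H the vector r x - x would lie in
    H and on the line of v, so r would fix H pointwise and H would be K. *)
Lemma transverse_root v H K : is_root v K -> transverse K H -> v \in ssval H.
Proof.
case=> r [rR Er vK rv] tKH; apply/negPn/negP => vH.
have KH := transverse_neq tKH.
have rK : hyp_act r K = K.
  apply/esym/hyp_sub_eq/subvP => x; rewrite mem_hyp_act Er !mem_fixed => /eqP xr.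
  by rewrite -{1 2}xr act_invK xr.
have [E|E] : hyp_act r H = K \/ hyp_act r H = H.
  apply: (transverseP tKH); apply/subvP => x; rewrite memv_cap mem_hyp_act.
  case/andP; rewrite Er mem_fixed => /eqP xr xH.
  by rewrite -{1}xr act_invK.
  by move: KH; rewrite -(inj_eq (@hyp_act_inj r)) E rK eqxx.
case/eqP: KH; apply/esym/hyp_sub_eq/subvP => x xH; rewrite Er mem_fixed -subr_eq0.
apply/eqP/(line_outside vH (rv x)); rewrite rpredB //.
by rewrite -[H in ssval H]E mem_hyp_act act_invK.
Qed.

Lemma moved_hyp_root s K : s \in reflections W -> hyp_act s K != K ->
  exists v, [/\ v \notin ssval K, v \notin ssval (hyp_act s K) &
    forall x, act s x - x \in <[v]>%VS].
Proof.
move=> sR sK; have [v vs sv] := reflection_root sR; exists v; split=> //.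
  by apply: contra sK => vK; apply/eqP/(reflection_stable sv).
apply: contra sK => vK; rewrite -(inj_eq (@hyp_act_inj s)).
by rewrite (reflection_stable sv vK).
Qed.

(** The root of s is outside K, since s moves K. For x in both K and s K, the vector x - s^-1 x lies
    in K and on the root line, hence is 0. *)
Lemma cap_moved_fixed s K : s \in reflections W -> hyp_act s K != K ->
  (ssval K :&: ssval (hyp_act s K) <= fixed_space s)%VS.
Proof.
move=> sR sK; have [v [vK _ sv]] := moved_hyp_root sR sK.
apply/subvP => x; rewrite memv_cap mem_hyp_act mem_fixed => /andP[xK sVx].
have Ex : x - act s^-1%g x = 0.
  apply: (line_outside vK); first by rewrite -{1}[x](act_invVK s).
  exact: rpredB.
by move/eqP: Ex; rewrite subr_eq0 => /eqP Ex; rewrite {1}Ex act_invVK.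
Qed.

Lemma reflection_nontransverse s K : s \in reflections W ->
  hyp_act s K != K -> nontransverse (hyp_act s K) K.
Proof.
move=> sR sK; rewrite /nontransverse sK transverse_sym /=.
apply/negP => tK; have [L EL] := reflection_hyp sR.
have sL : hyp_act s L = L.
  apply/esym/hyp_sub_eq/subvP => x; rewrite mem_hyp_act EL !mem_fixed => /eqP xs.
  by rewrite -{1 2}xs act_invK xs.
have := cap_moved_fixed sR sK; rewrite -EL => /(transverseP tK)[] E.
  by move: sK; rewrite -E sL eqxx.
by move: sK; rewrite -(inj_eq (@hyp_act_inj s)) -E sL eqxx.
Qed.

(** A root of L lies in K and in s K, and s is the identity on their intersection; an element that
    fixes a root fixes the hyperplane. *)
Lemma reflection_fixes s K L : s \in reflections W -> hyp_act s K != K ->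
  transverse L K -> transverse L (hyp_act s K) -> hyp_act s L = L.
Proof.
move=> sR sK tK tsK; have [v rootv] := hyp_root L.
apply: (hyp_act_fixed_root rootv); apply/eqP; rewrite -mem_fixed.
apply: (subvP (cap_moved_fixed sR sK)).
by rewrite memv_cap !(transverse_root rootv).
Qed.

Lemma transverse_toP H B : reflect (forall K, K \in B -> transverse H K) (transverse_to H B).
Proof. exact: forall_inP. Qed.

(* Comparing two instances of these decidable predicates by conversion does not
   terminate in practice. *)
Local Opaque transverse transverse_to transverse_collection.

Definition nonT B H : {set hyp W} := [set K in B | nontransverse K H].

Lemma nonT0 B H : H \notin B -> (nonT B H == set0) = transverse_to H B.
Proof.
move=> HB; apply/eqP/transverse_toP => [N0 K KB|tHB].
  apply/negPn/negP => tHK.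
  have : K \in nonT B H.
    rewrite inE KB nontransverse_sym /nontransverse tHK andbT.
    by apply: contraNneq HB => ->.
  by rewrite N0 inE.
apply/setP => K; rewrite !inE; apply/negP => /andP[KB].
by case/andP => _; rewrite transverse_sym tHB.
Qed.

Lemma nonT_notin B H : transverse_collection B -> nonT B H != set0 -> H \notin B.
Proof.
move=> tB /set0Pn[K]; rewrite inE => /andP[KB /andP[KH ntKH]].
by apply: contra ntKH => HB; apply: (transverse_collectionP tB).
Qed.

Definition moves B B' H :=
  [/\ H \in B', H \notin B, nonT B H = B :\: B' &
    forall K, K \in B :\: B' -> exists s,
      [/\ s \in reflections W, hyp_act s K = H & hset_act s B = B']].

Lemma moves_neq B B' H K : moves B B' H -> K \in B :\: B' -> H != K.
Proof.
by case=> HB' _ _ _; rewrite inE => /andP[KB' _]; apply: contraNneq KB' => <-.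
Qed.

Lemma moves_fixes B B' H K L s : transverse_collection B -> moves B B' H ->
  s \in reflections W -> K \in B :\: B' -> hyp_act s K = H ->
  L \in B :&: B' -> hyp_act s L = L.
Proof.
move=> tB mB sR KN sK LI; have HK := moves_neq mB KN.
case: mB => HB' HB EN _.
have [KB KB'] : K \in B /\ K \notin B' by move: KN; rewrite inE => /andP[].
have [LB LB'] : L \in B /\ L \in B' by move: LI; rewrite inE => /andP[].
apply: (reflection_fixes sR (K := K)); rewrite ?sK //.
  by apply: (transverse_collectionP tB) => //; apply: contraNneq KB' => <-.
apply/negPn/negP => ntLH; have : L \in nonT B H.
  by rewrite inE LB /nontransverse ntLH andbT; apply: contraNneq HB => <-.
by rewrite EN inE LB'.
Qed.

(** * Hyperplanes transverse to H and B' but not to all of B *)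

Section Trouble.

Variables (B B' : {set hyp W}) (H A : hyp W).
Hypotheses (tB : transverse_collection B) (mB : moves B B' H).
Hypotheses (tAH : transverse A H) (tAB' : transverse_to A B').
Hypothesis (NA : nonT B A != set0).

Let AB : A \notin B. Proof. exact: nonT_notin. Qed.

Lemma trouble_moves s : hset_act s B = B' -> hyp_act s A != A.
Proof.
move=> sB; apply: contra NA => /eqP sA; rewrite nonT0 //.
by rewrite -(transverse_to_act s) sA sB.
Qed.

(** An element of B kept in B' is transverse to A by assumption. If a removed K were transverse to
    A, a reflection s with s K = H would fix A, which is transverse to both K and H; this
    contradicts [trouble_moves]. *)
Lemma trouble_nonT : nonT B A = B :\: B'.
Proof.
have [HB' HB EN ms] := mB.
apply/setP => K; apply/idP/idP => [|KN].
  rewrite inE => /andP[KB ntKA]; rewrite inE KB andbT.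
  apply/negP => KB'; case/andP: ntKA => _; rewrite transverse_sym.
  by rewrite (transverse_toP _ _ tAB').
have [KB KB'] : K \in B /\ K \notin B' by move: KN; rewrite inE => /andP[].
have [s [sR sK sB]] := ms K KN.
rewrite inE KB /nontransverse /=; apply/andP; split.
  by apply: contraNneq (AB) => <-.
apply/negP => tKA; case/eqP: (trouble_moves sB).
apply: (reflection_fixes sR (K := K)); rewrite ?sK.
- exact: moves_neq mB KN.
- by rewrite transverse_sym.
exact: tAH.
Qed.

(** Since t moves A, its root is outside t^-1 A, which contains both y and t^-1 y. Their difference
    is on the root line, so y = t^-1 y, and t^-1 H = K. *)
Lemma trouble_fixed t K y : t \in reflections W -> hyp_act t K = H ->
  hset_act t B = B' -> y \in ssval H -> y \in ssval A ->
  y \in ssval (hyp_act t^-1%g A) -> y \in ssval K.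
Proof.
move=> tR tK tB' yH yA ytA; have [v vt tv] := reflection_root tR.
have vA : v \notin ssval (hyp_act t^-1%g A).
  apply: contra (trouble_moves tB') => vA; have := reflection_stable tv vA.
  by rewrite hyp_actVK => {1}->; rewrite hyp_actVK.
have E : y - act t^-1%g y = 0.
  apply: (line_outside vA); first by rewrite -{1}[y](act_invVK t).
  by rewrite rpredB // mem_hyp_act invgK act_invVK.
move/eqP: E; rewrite subr_eq0 => /eqP ->.
by rewrite -mem_hyp_act tK.
Qed.

(* With three hyperplanes K1, K2, K3 of B moved onto H by s, t, u, a vector of
   the plane spanned by the roots of K2, K3 fixed by s must lie in K2 and K3. *)
Lemma trouble_card : (#|B :\: B'| <= 2)%N.
Proof.
rewrite leqNgt; apply/negP => /card_gt2P[K1 [K2 [K3 [[N1 N2 N3] [n12 n23 n31]]]]].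
have [HB' HB EN ms] := mB.
have inB K : K \in B :\: B' -> K \in B by rewrite inE => /andP[].
have [s [sR sK sB]] := ms K1 N1.
have [v2 rv2] := hyp_root K2; have [v3 rv3] := hyp_root K3.
have root_in K L v : K \in B -> L \in B -> K != L -> is_root v K -> v \in ssval L.
  by move=> KB LB KL rv; apply: (transverse_root rv); apply: (transverse_collectionP tB).
have tAt t K v : hset_act t B = B' -> K \in B -> is_root v K ->
    v \in ssval (hyp_act t^-1%g A).
  move=> tB' KB rv; apply: (transverse_root rv); rewrite transverse_sym.
  suff /transverse_toP : transverse_to (hyp_act t^-1%g A) B by apply.
  by rewrite -(transverse_to_act t) hyp_actVK tB'.
have notin K v : is_root v K -> v \notin ssval K by case=> r [].
have n21 : K2 != K1 by rewrite eq_sym; exact: n12.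
have n32 : K3 != K2 by rewrite eq_sym; exact: n23.
have [B1 B2 B3] := And3 (inB _ N1) (inB _ N2) (inB _ N3).
have key (a2 a3 : R[i]) : act s (a2 *: v2 + a3 *: v3) = a2 *: v2 + a3 *: v3 ->
    a2 = 0 /\ a3 = 0.
  set y := a2 *: v2 + a3 *: v3 => sy.
  have yH : y \in ssval H.
    rewrite -sK mem_hyp_act -{1}sy act_invK rpredD // memvZ //.
      exact: root_in B2 B1 n21 rv2.
    exact: root_in B3 B1 n31 rv3.
  have yA : y \in ssval A.
    rewrite -sy linearD !linearZ /=.
    have sv K v : K \in B -> is_root v K -> act s v \in ssval A.
      move=> KB rv; apply: (transverse_root (is_root_act s rv)).
      by rewrite transverse_sym (transverse_toP _ _ tAB') // -sB mem_hset_act.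
    by rewrite rpredD // memvZ // (sv _ _ B2 rv2, sv _ _ B3 rv3).
  have yt t : hset_act t B = B' -> y \in ssval (hyp_act t^-1%g A).
    by move=> tB'; rewrite rpredD // memvZ // (tAt _ _ _ tB' B2 rv2, tAt _ _ _ tB' B3 rv3).
  have inK K : K \in B :\: B' -> y \in ssval K.
    move=> KN; have [t [tR tK tB']] := ms K KN.
    exact: (trouble_fixed tR tK tB' yH yA (yt _ tB')).
  have zero K v (x : R[i]) : is_root v K -> x *: v \in ssval K -> x = 0.
    move=> rv xv; apply/eqP/negPn/negP => x0; case/negP: (notin _ _ rv).
    by rewrite -[v]scale1r -(mulVf x0) -scalerA memvZ.
  split.
    apply: (zero _ _ _ rv2); rewrite -[_ *: v2](addrK (a3 *: v3)) rpredB //; first exact: inK.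
    by rewrite memvZ // (root_in _ _ _ B3 B2 n32 rv3).
  apply: (zero _ _ _ rv3); rewrite -[_ *: v3](addKr (a2 *: v2)) rpredD //; last exact: inK.
  by rewrite rpredN memvZ // (root_in _ _ _ B2 B3 n23 rv2).
have [v vs sv] := reflection_root sR.
have /vlineP[c2 E2] := sv v2; have /vlineP[c3 E3] := sv v3.
(* As s moves v2 by c2 v and v3 by c3 v, it fixes c3 v2 - c2 v3, and [key] gives c2 = c3 = 0. Then s
   fixes v2 itself, and [key] with coefficients 1 and 0 yields 1 = 0. *)
have [] := key c3 (- c2).
  rewrite linearD !linearZ /= -[act s v2](subrK v2) -[act s v3](subrK v3) E2 E3.
  by rewrite !scalerDr !scalerA mulNr (mulrC c3) addrACA scaleNr subrr add0r.
move=> c30 /eqP; rewrite oppr_eq0 => /eqP c20.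
have [|/eqP] := key 1 0; last by rewrite oner_eq0.
rewrite scale0r addr0 scale1r; apply/eqP.
by rewrite -subr_eq0 E2 c20 scale0r.
Qed.

End Trouble.

Lemma dim_cap_hyp (U : {vspace crg_space W}) H :
  (\dim U <= (\dim (U :&: ssval H)).+1)%N.
Proof.
have := dimv_sum_cap U (ssval H).
have : (\dim (U + ssval H) <= (\dim (ssval H)).+1)%N.
  by rewrite hyp_dim dimvS ?subvf.
move: (\dim (U + _)) (\dim (U :&: _)) (\dim (ssval H)) (\dim U) => a b c d ac E.
by rewrite -(leq_add2r c) -E addSnnS addnC leq_add2l.
Qed.

Lemma dim_cap_hyp_lt (U : {vspace crg_space W}) H : ~~ (U <= ssval H)%VS ->
  (\dim (U :&: ssval H) < \dim U)%N.
Proof.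
move=> nUH; rewrite ltn_neqAle dimvS ?capvSl // andbT.
apply: contra nUH => /eqP E; apply/capv_idPl/eqP.
by rewrite eqEdim capvSl E leqnn.
Qed.

(** Reflections s and s2 that carry K1 to H, and B to B1 and B2, agree on B except perhaps at K2. If
    they differ there, the intersection of K1, K2, H, of codimension at most 3, equals that of H, s
    K2, s2 K2, which contains it and has codimension at least 3. A root of A lies in the latter, and
    s fixes the former pointwise; so s would fix A, against [trouble_moves]. *)
Lemma trouble_unique B B1 B2 H A :
  transverse_collection B -> transverse_collection B1 -> transverse_collection B2 ->
  moves B B1 H -> moves B B2 H -> B :\: B1 = B :\: B2 -> #|B :\: B1| = 2%N ->
  transverse A H -> transverse_to A B1 -> transverse_to A B2 ->
  nonT B A != set0 -> B1 = B2.
Proof.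
move=> tB tB1 tB2 m1 m2 EN /eqP/cards2P[K1 [K2 [n12 N12]]] tAH tA1 tA2 NA.
have N1 : K1 \in B :\: B1 by rewrite N12 !inE eqxx.
have N2 : K2 \in B :\: B1 by rewrite N12 !inE eqxx orbT.
have [H1 HB _ ms1] := m1; have [H2 _ _ ms2] := m2.
have [s [sR sK sB]] := ms1 _ N1.
have [s2 [sR2 sK2 sB2]] : exists s,
    [/\ s \in reflections W, hyp_act s K1 = H & hset_act s B = B2].
  by apply: ms2; rewrite -EN.
have inB K : K \in B :\: B1 -> K \in B by rewrite inE => /andP[].
have agree L : L \in B -> L != K2 -> hyp_act s L = hyp_act s2 L.
  move=> LB LK2; case LI: (L \in B :&: B1).
    rewrite (moves_fixes tB m1 sR N1) //.
    rewrite EN in N1; rewrite (moves_fixes tB m2 sR2 N1) //.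
    move: LI; rewrite !inE LB /=; apply: contraTT => LB2.
    have : L \in B :\: B2 by rewrite inE LB2.
    by rewrite -EN inE => /andP[].
  have : L \in B :\: B1 by move: LI; rewrite !inE LB /= => ->.
  by rewrite N12 !inE (negPf LK2) orbF => /eqP ->; rewrite sK sK2.
have [EM|nM] := eqVneq (hyp_act s K2) (hyp_act s2 K2).
  rewrite -sB -sB2 /hset_act; apply: eq_in_imset => L LB.
  by have [->|] := eqVneq L K2; [|apply: agree].
have HK1 : H != K1 := moves_neq m1 N1.
have sK1 : hyp_act s K1 != K1 by rewrite sK.
have sK12 : hyp_act s2 K1 != K1 by rewrite sK2.
have M1B : hyp_act s K2 \in B1 by rewrite -sB mem_hset_act inB.
have M2B : hyp_act s2 K2 \in B2 by rewrite -sB2 mem_hset_act inB.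
have HM1 : H != hyp_act s K2 by rewrite -sK (inj_eq (@hyp_act_inj s)).
have HM2 : H != hyp_act s2 K2 by rewrite -sK2 (inj_eq (@hyp_act_inj s2)).
have tHM1 := transverse_collectionP tB1 H1 M1B HM1.
pose X0 := (ssval K1 :&: ssval K2 :&: ssval H)%VS.
pose X1 := (ssval H :&: ssval (hyp_act s K2) :&: ssval (hyp_act s2 K2))%VS.
have X0s x t : t \in reflections W -> hyp_act t K1 = H -> x \in X0 -> act t x = x.
  rewrite !memv_cap => tR tK /andP[/andP[xK1 xK2] xH].
  apply/eqP; rewrite -mem_fixed; apply: (subvP (cap_moved_fixed tR (K := K1) _)).
    by rewrite tK.
  by rewrite memv_cap xK1 tK.
have X01 : X0 = X1.
  apply/eqP; rewrite eqEdim; apply/andP; split.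
    apply/subvP => x xX0; have := xX0; rewrite !memv_cap !mem_hyp_act.
    case/andP=> /andP[_ xK2] ->.
    by rewrite -{1}(X0s x s) // -{2}(X0s x s2) // !act_invK xK2.
  have d1 := dim_cap_hyp (ssval K1) K2.
  have d2 : (\dim (ssval K1 :&: ssval K2) <= (\dim X0).+1)%N by apply: dim_cap_hyp.
  have d3 : (\dim (ssval H :&: ssval (hyp_act s K2)) < \dim (ssval H))%N.
    by apply: dim_cap_hyp_lt; apply: contra HM1 => /hyp_sub_eq ->.
  have d4 : (\dim X1 < \dim (ssval H :&: ssval (hyp_act s K2)))%N.
    apply: dim_cap_hyp_lt; apply/negP => /(transverseP tHM1)[] E.
      by rewrite E eqxx in HM2.
    by rewrite E eqxx in nM.
  have [E] : (\dim (ssval H)).+1 = (\dim (ssval K1)).+1 by rewrite !hyp_dim.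
  have d12 : (\dim (ssval K1) <= (\dim X0).+2)%N by apply: leq_trans d1 _.
  rewrite -2!ltnS; apply: leq_trans d12; rewrite -E.
  exact: leq_ltn_trans d3.
have [v rv] := hyp_root A.
have vX : v \in X0.
  rewrite X01 !memv_cap (transverse_root rv tAH).
  rewrite (transverse_root rv (transverse_toP _ _ tA1 _ M1B)).
  exact: transverse_root rv (transverse_toP _ _ tA2 _ M2B).
case/eqP: (trouble_moves tB tA1 NA sB).
exact: (hyp_act_fixed_root rv (X0s v s sR sK vX)).
Qed.

End Geometry.

(** * The Brauer-Chen algebra and its modules *)

Section BrauerRelations.

Variables (R : realType) (W : complexReflectionGroup R) (A : comUnitRingType).
Variable P : brauerParams W A.
Local Notation bw := (br_w P).
Local Notation be := (br_e P).
Local Notation pi := (\pi_(Br P)%qT : br_free W A -> Br P).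

Lemma br_rel_eq u v : br_relation P u v -> pi u = pi v.
Proof. by move=> ruv; apply/br_pi_eq/Ideal_rel. Qed.

Lemma br_w1 : bw 1%g = 1.
Proof. by rewrite br_wE -br_pi1; apply/br_rel_eq/Rel_1. Qed.

Lemma br_wM u v : bw (u * v)%g = bw u * bw v.
Proof. by rewrite !br_wE -br_piM; apply/esym/br_rel_eq/Rel_M. Qed.

Lemma br_wK u : bw u^-1%g * bw u = 1.
Proof. by rewrite -br_wM mulVg br_w1. Qed.

Lemma br_eM H : be H * be H = delta P *: be H.
Proof. by rewrite br_eE -br_piM -br_piZ; apply/br_rel_eq/Rel_B1. Qed.

Lemma br_we w H : bw w * be H = be (hyp_act w H) * bw w.
Proof.
have <- : bw w * be H * bw w^-1%g = be (hyp_act w H).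
  by rewrite !br_wE !br_eE -!br_piM; apply/br_rel_eq/Rel_B2.
by rewrite -!mulrA br_wK mulr1.
Qed.

Lemma br_fixed w H : (ssval H <= fixed_space w)%VS -> bw w * be H = be H.
Proof. by move=> Hw; rewrite br_wE br_eE -br_piM; apply/br_rel_eq/Rel_B3. Qed.

Lemma br_eC H1 H2 : transverse H1 H2 -> be H1 * be H2 = be H2 * be H1.
Proof. by move=> tH; rewrite !br_eE -!br_piM; apply/br_rel_eq/Rel_B4. Qed.

Lemma br_pi0 : pi 0 = 0.
Proof. by apply: (addIr (pi 0)); rewrite -br_piD !add0r. Qed.

Lemma br_pi_sum (I : Type) (r : seq I) (Q : pred I) (F : I -> br_free W A) :
  pi (\sum_(i <- r | Q i) F i) = \sum_(i <- r | Q i) pi (F i).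
Proof. exact: (big_morph pi (@br_piD _ _ _ P) br_pi0). Qed.

Definition br_between K H : Br P :=
  \sum_(s in refl_between K H) mu P s *: bw s.

Lemma br_e_nontransverse H1 H2 : nontransverse H1 H2 ->
  be H1 * be H2 = br_between H2 H1 * be H2.
Proof.
move=> ntH.
have -> : br_between H2 H1 =
    pi (\sum_(s in refl_between H2 H1) mu P s *: free_w A s).
  by rewrite br_pi_sum; apply: eq_bigr => s _; rewrite br_piZ br_wE.
by rewrite !br_eE -!br_piM; apply/br_rel_eq/Rel_B5.
Qed.

Lemma br_ind (Q : Br P -> Prop) :
  Q 1 -> (forall x y, Q x -> Q y -> Q (x + y)) ->
  (forall a x, Q x -> Q (a *: x)) ->
  (forall w x, Q x -> Q (bw w * x)) -> (forall H x, Q x -> Q (be H * x)) ->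
  forall x, Q x.
Proof.
move=> Q1 QD QZ Qw Qe x; rewrite -[x]br_piK; move: (generic_quotient.repr x) => u.
have Q0 : Q 0 by rewrite -(scale0r 1); apply: QZ.
rewrite [u]monalgE br_pi_sum; elim/big_ind: _ => // k _.
have -> : << u@_k *g k >> = u@_k *: << k >> :> br_free W A.
  apply/malgP => j; rewrite mcoeffZ !mcoeffU.
  by case: (k == j); rewrite ?mulr1 ?mulr0 // mulr0n.
rewrite br_piZ; apply: QZ; case: k => s.
elim: s => [|a s IHs].
  have -> : << FMonom [::] >> = 1 :> br_free W A.
    by apply/malgP => j; rewrite mcoeff1 mcoeffU1 -fmoneE eq_sym.
  by rewrite br_pi1.
have -> : << FMonom (a :: s) >> = << fmu a >> * << FMonom s >> :> br_free W A.
  rewrite malgM_def fgmulUU mulr1; congr << _ >>.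
  by apply/eqP; rewrite fmP fmM fmU.
rewrite br_piM; case: a => [w|H].
  by have := Qw w _ IHs; rewrite br_wE.
by have := Qe H _ IHs; rewrite br_eE.
Qed.

End BrauerRelations.

Section BrauerRepresentation.

Variables (R : realType) (W : complexReflectionGroup R) (K : fieldType).
Variable P : brauerParams W K.

Definition mx_between N (rw : W -> 'M[K]_N) H1 H2 : 'M[K]_N :=
  \sum_(s in refl_between H1 H2) mu P s *: rw s.

Section Universal.

Variables (N : nat) (rw : W -> 'M[K]_N) (re : hyp W -> 'M[K]_N).
Hypotheses (rw1 : rw 1%g = 1%:M) (rwM : forall u v, rw (u * v)%g = rw u *m rw v).
Hypothesis reM : forall H, re H *m re H = delta P *: re H.
Hypothesis rwe : forall w H, rw w *m re H = re (hyp_act w H) *m rw w.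
Hypothesis rwf : forall w H, (ssval H <= fixed_space w)%VS -> rw w *m re H = re H.
Hypothesis reC : forall H1 H2, transverse H1 H2 -> re H1 *m re H2 = re H2 *m re H1.
Hypothesis ren : forall H1 H2, nontransverse H1 H2 ->
  re H1 *m re H2 = mx_between rw H2 H1 *m re H2.

Lemma br_module_exists :
  exists M : brModule P N,
    (forall w, M (br_w P w) = rw w) /\ (forall H, M (br_e P H) = re H).
Proof.
(* Size 0 is separate: square matrices form a nonzero ring, into which the free algebra can be
   evaluated, only in positive size. *)
case: N rw re rw1 rwM reM rwe rwf reC ren => [|N'] sw se sw1 swM seM swe swf seC sen.
  have lin0 : linear (fun _ : Br P => 0 : 'M[K]_0) by move=> a x y; apply/matrixP => -[].
  have one0 : (fun _ : Br P => 0 : 'M[K]_0) 1 = 1%:M by apply/matrixP => -[].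
  have mul0 x y : (fun _ : Br P => 0 : 'M[K]_0) (x * y) =
    (0 : 'M_0) *m (0 : 'M_0) by apply/matrixP => -[].
  by exists (BrModule lin0 one0 mul0); split=> *; apply/matrixP => -[].
pose gen (x : (W + hyp W)%type) := match x with inl w => sw w | inr H => se H end.
pose mon (m : {fmonom (W + hyp W)%type}) : 'M[K]_N'.+1 := \prod_(x <- (m : seq _)) gen x.
have monM : mmorphism mon.
  split=> [m n|]; first by rewrite /mon fmM big_cat.
  by rewrite /mon fm1 big_nil.
pose monH := isMultiplicative.Build {fmonom (W + hyp W)%type} 'M[K]_N'.+1 mon monM.
pose monm : {mmorphism {fmonom (W + hyp W)%type} -> 'M[K]_N'.+1} := HB.pack mon monH.
have [F [FD FZ FM F1 [Fw Fe]]] : exists F : br_free W K -> 'M[K]_N'.+1,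
    [/\ forall u v, F (u + v) = F u + F v, forall a u, F (a *: u) = a *: F u,
        forall u v, F (u * v) = F u *m F v, F 1 = 1%:M &
        (forall w, F (free_w K w) = sw w) /\ (forall H, F (free_e K H) = se H)].
  exists (mmap (@scalar_mx K N'.+1) monm); split.
  - exact: mmapD.
  - by move=> a u; rewrite mmapZ /= -mul_scalar_mx.
  - apply: (commr_mmap_is_multiplicative _).1 => g m m'.
    by rewrite /GRing.comm -mulmxE /= scalar_mxC.
  - exact: mmap1.
  - by split=> [w|H]; rewrite mmapU /= /mon fmU big_seq1 mul1r.
have F0 : F 0 = 0 by apply: (addIr (F 0)); rewrite -FD !add0r.
have FB u v : F (u - v) = F u - F v.
  by apply/eqP; rewrite eq_sym subr_eq -FD subrK.
have Fsum (I : Type) (r : seq I) (Q : pred I) (G : I -> br_free W K) :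
    F (\sum_(i <- r | Q i) G i) = \sum_(i <- r | Q i) F (G i).
  by apply: (big_morph F FD).
have Fbetween H1 H2 : F (\sum_(s in refl_between H1 H2) mu P s *: free_w K s) =
    mx_between sw H1 H2.
  by rewrite Fsum; apply: eq_bigr => s _; rewrite FZ Fw.
have Frel u v : br_relation P u v -> F u = F v.
  case=> [|w1 w2|H|w H|w H fH|H1 H2 tH|H1 H2 nH].
  - by rewrite Fw F1.
  - exact: etrans (FM _ _) (etrans (congr2 mulmx (Fw w1) (Fw w2))
      (etrans (esym (swM w1 w2)) (esym (Fw _)))).
  - apply: etrans (FM _ _) (etrans (congr2 mulmx (Fe H) (Fe H)) (etrans (seM H) _)).
    by rewrite FZ Fe.
  - apply: etrans (FM _ _) (etrans (congr2 mulmx (FM _ _) (Fw _)) _).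
    apply: etrans (congr2 mulmx (congr2 mulmx (Fw w) (Fe H)) (erefl _)) _.
    by rewrite Fe swe -mulmxA -swM mulgV sw1 mulmx1.
  - exact: etrans (FM _ _) (etrans (congr2 mulmx (Fw w) (Fe H))
      (etrans (swf _ _ fH) (esym (Fe H)))).
  - apply: etrans (FM _ _) (etrans (congr2 mulmx (Fe H1) (Fe H2)) _).
    apply: etrans (seC _ _ tH) (esym _).
    exact: etrans (FM _ _) (congr2 mulmx (Fe H2) (Fe H1)).
  - apply: etrans (FM _ _) (etrans (congr2 mulmx (Fe H1) (Fe H2)) _).
    apply: etrans (sen _ _ nH) (esym _).
    exact: etrans (FM _ _) (congr2 mulmx (Fbetween H2 H1) (Fe H2)).
have Fideal u : br_ideal P u -> F u = 0.
  elim=> [{}u v r| |{}u v _ Iu _ Iv|a {}u _ Iu|a {}u _ Iu].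
  - by rewrite FB (Frel _ _ r) subrr.
  - exact: F0.
  - by rewrite FD Iu Iv addr0.
  - by apply: etrans (FM _ _) _; rewrite Iu mulmx0.
  - by apply: etrans (FM _ _) _; rewrite Iu mul0mx.
pose G (x : Br P) : 'M[K]_N'.+1 := F (generic_quotient.repr x).
have Gpi u : G (\pi_(Br P)%qT u) = F u.
  by apply/eqP; rewrite -subr_eq0 -FB; apply/eqP/Fideal/br_repr_pi.
have Glin : linear G.
  move=> a x y; rewrite -[x]br_piK -[y]br_piK -br_piZ -br_piD !Gpi.
  by rewrite FD FZ.
have G1 : G 1 = 1%:M by rewrite -br_pi1 Gpi F1.
have GM x y : G (x * y) = G x *m G y.
  rewrite -[x]br_piK -[y]br_piK -br_piM !Gpi; exact: FM.
exists (BrModule Glin G1 GM); split=> [w|H] /=.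
  by rewrite br_wE Gpi Fw.
by rewrite br_eE Gpi Fe.
Qed.

End Universal.

Section ModuleTheory.

Variables (N : nat) (M : brModule P N).

Lemma br_actD x y : M (x + y) = M x + M y.
Proof. by have := br_act_linear M 1 x y; rewrite !scale1r. Qed.

Lemma br_act0 : M 0 = 0.
Proof. by apply: (addIr (M 0)); rewrite -br_actD !add0r. Qed.

Lemma br_actZ a x : M (a *: x) = a *: M x.
Proof. by have := br_act_linear M a x 0; rewrite br_act0 !addr0. Qed.

Lemma br_act_sum (I : Type) (r : seq I) (Q : pred I) (F : I -> Br P) :
  M (\sum_(i <- r | Q i) F i) = \sum_(i <- r | Q i) M (F i).
Proof. exact: (big_morph M br_actD br_act0). Qed.

Lemma br_act_w1 : M (br_w P 1%g) = 1%:M.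
Proof. by rewrite br_w1 br_act1. Qed.

Lemma br_act_wM u v : M (br_w P (u * v)%g) = M (br_w P u) *m M (br_w P v).
Proof. by rewrite br_wM br_actM. Qed.

Lemma br_act_we w H :
  M (br_w P w) *m M (br_e P H) = M (br_e P (hyp_act w H)) *m M (br_w P w).
Proof. by rewrite -!br_actM br_we. Qed.

Lemma br_act_between H1 H2 :
  M (br_between P H1 H2) = mx_between (fun w => M (br_w P w)) H1 H2.
Proof. by rewrite br_act_sum; apply: eq_bigr => s _; rewrite br_actZ. Qed.

Lemma br_module_stable (p : nat) (Q : 'M[K]_(N, p) -> Prop) :
  (forall u v, Q u -> Q v -> Q (u + v)) -> (forall a u, Q u -> Q (a *: u)) ->
  (forall w u, Q u -> Q (M (br_w P w) *m u)) ->
  (forall H u, Q u -> Q (M (br_e P H) *m u)) ->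
  forall x u, Q u -> Q (M x *m u).
Proof.
move=> QD QZ Qw Qe x u Qu; elim/br_ind: x => [|x y Qx Qy|a x Qx|w x Qx|H x Qx].
- by rewrite br_act1 mul1mx.
- by rewrite br_actD mulmxDl; apply: QD.
- by rewrite br_actZ -scalemxAl; apply: QZ.
- by rewrite br_actM -mulmxA; apply: Qw.
- by rewrite br_actM -mulmxA; apply: Qe.
Qed.

End ModuleTheory.

Lemma br_intertwine N N' (M : brModule P N) (M' : brModule P N') (T : 'M[K]_(N', N)) :
  (forall w, T *m M (br_w P w) = M' (br_w P w) *m T) ->
  (forall H, T *m M (br_e P H) = M' (br_e P H) *m T) ->
  forall x, T *m M x = M' x *m T.
Proof.
move=> Tw Te x; elim/br_ind: x => [|x y Ex Ey|a x Ex|w x Ex|H x Ex].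
- by rewrite !br_act1 mulmx1 mul1mx.
- by rewrite !br_actD mulmxDr mulmxDl Ex Ey.
- by rewrite !br_actZ -scalemxAr -scalemxAl Ex.
- by rewrite !br_actM mulmxA Tw -!mulmxA Ex.
- by rewrite !br_actM mulmxA Te -!mulmxA Ex.
Qed.

End BrauerRepresentation.

(** * The products e_B: reordering and left multiplication *)

Section CollectionProduct.

Variables (R : realType) (W : complexReflectionGroup R) (F : fieldType).
Variable P : brauerParams W F.
Local Notation bw := (br_w P).
Local Notation be := (br_e P).
Implicit Types (B : {set hyp W}) (H K : hyp W).

(** Br is not commutative, so the big product defining e_B depends a priori on the enumeration of B;
    its factors may be permuted only when they commute pairwise. *)
Let commuting (l : seq (hyp W)) :=
  forall a b, a \in l -> b \in l -> be a * be b = be b * be a.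

Lemma br_prod_rem l x : commuting l -> x \in l ->
  \prod_(H <- l) be H = be x * \prod_(H <- rem x l) be H.
Proof.
elim: l => // a l IHl cl; rewrite inE big_cons /=.
have [->|ax] := eqVneq a x; first by [].
move=> /= xl; rewrite big_cons IHl //; last first.
  by move=> b c bl cll; apply: cl; rewrite inE ?bl ?cll orbT.
by rewrite !mulrA cl // inE ?eqxx ?xl ?orbT.
Qed.

Lemma br_prod_perm l l' : commuting l -> perm_eq l l' ->
  \prod_(H <- l) be H = \prod_(H <- l') be H.
Proof.
elim: l l' => [|a l IHl] l' cl pl.
  by move: pl; rewrite perm_sym => /perm_nilP ->.
have al' : a \in l' by rewrite -(perm_mem pl) mem_head.
have cl' : commuting l' by move=> b c; rewrite -!(perm_mem pl); apply: cl.
rewrite (br_prod_rem cl' al') big_cons; congr (_ * _); apply: IHl.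
  by move=> b c bl cll; apply: cl; rewrite inE ?bl ?cll orbT.
by rewrite -(perm_cons a) (perm_trans pl) // perm_to_rem.
Qed.

Let elems B := [seq H <- index_enum (hyp W) | H \in B].

Let mem_elems B H : (H \in elems B) = (H \in B).
Proof. by rewrite mem_filter mem_index_enum andbT. Qed.

Let elems_uniq B : uniq (elems B).
Proof. by rewrite filter_uniq ?index_enum_uniq. Qed.

Let br_eBE B : br_eB P B = \prod_(H <- elems B) be H.
Proof. by rewrite big_filter. Qed.

Lemma commuting_collection B : transverse_collection B -> commuting (elems B).
Proof.
move=> tB a b; rewrite !mem_elems => aB bB.
have [->//|ab] := eqVneq a b.
by apply: br_eC; apply: transverse_collectionP tB aB bB ab.
Qed.

Lemma br_eB_enum B : transverse_collection B ->
  br_eB P B = \prod_(H <- enum B) be H.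
Proof.
move=> tB; rewrite br_eBE; apply: br_prod_perm; first exact: commuting_collection.
by apply: uniq_perm; rewrite ?enum_uniq // => L; rewrite mem_elems mem_enum.
Qed.

Lemma br_eB_rem B K : transverse_collection B -> K \in B ->
  br_eB P B = be K * br_eB P (B :\ K).
Proof.
move=> tB KB; have cB := commuting_collection tB.
rewrite !br_eBE (@br_prod_rem _ K) ?mem_elems //; congr (_ * _).
apply: br_prod_perm; first by move=> a b /mem_rem aB /mem_rem bB; apply: cB.
apply: uniq_perm; rewrite ?rem_uniq ?elems_uniq // => L.
by rewrite mem_rem_uniq ?elems_uniq // inE !mem_elems in_setD1.
Qed.

Lemma br_w_eB w B : transverse_collection B ->
  bw w * br_eB P B = br_eB P (hset_act w B) * bw w.
Proof.
move=> tB; rewrite !br_eBE.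
have -> : \prod_(H <- elems (hset_act w B)) be H =
    \prod_(H <- map (hyp_act w) (elems B)) be H.
  apply: br_prod_perm; first by apply: commuting_collection; rewrite transverse_collection_act.
  apply: uniq_perm; rewrite ?map_inj_uniq ?elems_uniq //; first exact: hyp_act_inj.
  move=> L; rewrite mem_elems mem_hset_actV -{2}[L](hyp_actVK w).
  by rewrite mem_map ?mem_elems //; apply: hyp_act_inj.
elim: (elems B) => [|a l IHl] /=; first by rewrite !big_nil mulr1 mul1r.
by rewrite !big_cons mulrA br_we -!mulrA IHl.
Qed.

Lemma br_e_eB_in B H : transverse_collection B -> H \in B ->
  be H * br_eB P B = delta P *: br_eB P B.
Proof. by move=> tB HB; rewrite (br_eB_rem tB HB) mulrA br_eM scalerAl. Qed.

Lemma br_e_eB_nontransverse B H K : transverse_collection B -> K \in B ->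
  nontransverse H K -> be H * br_eB P B = br_between P K H * br_eB P B.
Proof.
by move=> tB KB ntHK; rewrite (br_eB_rem tB KB) !mulrA (br_e_nontransverse P ntHK).
Qed.

Lemma br_fixed_eB B w K : transverse_collection B -> K \in B ->
  (ssval K <= fixed_space w)%VS -> bw w * br_eB P B = br_eB P B.
Proof.
by move=> tB KB Kw; rewrite (br_eB_rem tB KB) mulrA (br_fixed P Kw).
Qed.

Lemma transverse_to_notin B H : transverse_to H B -> H \notin B.
Proof.
by move=> /forall_inP tHB; apply/negP => /tHB /transverse_neq; rewrite eqxx.
Qed.

Lemma transverse_collectionU1 B H : transverse_collection B ->
  transverse_to H B -> transverse_collection (H |: B).
Proof.
move=> tB /forall_inP tHB; apply/forall_inP => K KB; apply/forall_inP => L LB.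
apply/implyP; move: KB LB; rewrite !inE.
case/orP=> [/eqP->|KB]; case/orP=> [/eqP->|LB]; first by rewrite eqxx.
- by move=> _; apply: tHB.
- by move=> _; rewrite transverse_sym; apply: tHB.
exact: transverse_collectionP tB KB LB.
Qed.

Lemma br_eB_U1 B H : transverse_collection B -> transverse_to H B ->
  br_eB P (H |: B) = be H * br_eB P B.
Proof.
move=> tB tHB; rewrite (@br_eB_rem (H |: B) H) ?setU11 //; last first.
  exact: transverse_collectionU1.
by rewrite setU1K // transverse_to_notin.
Qed.

Lemma hyp_cases H B : [\/ H \in B, transverse_to H B |
  H \notin B /\ exists2 K, K \in B & nontransverse H K].
Proof.
have [HB|HB] := boolP (H \in B); first by constructor 1.
have [tHB|] := boolP (transverse_to H B); first by constructor 2.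
case/forall_inPn => K KB ntHK; constructor 3; split=> //; exists K => //.
by rewrite /nontransverse ntHK andbT; apply: contraNneq HB => ->.
Qed.

End CollectionProduct.

(** * Independence of the graded pieces *)

Section Directness.

Variables (k F : fieldType) (iota : {rmorphism k -> F}) (d : F).
Hypothesis d_transc : ~ algebraicOver iota d.

(** At a coordinate j where some [y t] is nonzero, the values form an eigenvector, for the
    eigenvalue d, of a matrix over k. So d would be a root of a characteristic polynomial over k. *)
Lemma transcendental_no_eigenfamily N (T : finType) (y : T -> 'cV[F]_N) :
  (forall t, exists a : T -> k, d *: y t = \sum_u iota (a u) *: y u) ->
  forall t, y t = 0.
Proof.
move=> /choice[a Ea] t; apply/eqP/negPn/negP => yt0.
have [j yj] : exists j, y t j 0 != 0.
  apply/existsP; apply: contraNT yt0; rewrite negb_exists => /forallP y0.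
  by apply/eqP/colP => j; rewrite mxE; apply/eqP; have := y0 j; rewrite negbK.
pose A : 'M[k]_#|T| := \matrix_(i, i') a (enum_val i') (enum_val i).
pose v : 'rV[F]_#|T| := \row_i y (enum_val i) j 0.
have vA : v *m map_mx iota A = d *: v.
  apply/rowP => i; rewrite !mxE.
  have /(congr1 (fun M : 'cV[F]_N => M j 0)) := Ea (enum_val i).
  rewrite mxE summxE => ->; rewrite [RHS](reindex (@enum_val T T)) /=; last first.
    by exists enum_rank => u _; rewrite (enum_valK, enum_rankK).
  by apply: eq_bigr => i' _; rewrite !mxE mulrC.
have v0 : v != 0.
  apply: contraNneq yj => /rowP/(_ (enum_rank t)); rewrite !mxE enum_rankK.
  by move=> ->.
have : eigenvalue (map_mx iota A) d by apply/eigenvalueP; exists v.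
rewrite eigenvalue_root_char -map_char_poly => rd; apply: d_transc.
by exists (char_poly A); rewrite // monic_neq0 // char_poly_monic.
Qed.

Variables (R : realType) (W : complexReflectionGroup R) (N : nat).
Variables (rho : W -> 'M[F]_N) (e : hyp W -> 'M[F]_N).
Hypotheses (rho1 : rho 1%g = 1%:M) (rhoM : forall u v, rho (u * v)%g = rho u *m rho v).
Hypothesis rho_e : forall w H, rho w *m e H = e (hyp_act w H) *m rho w.

(** Products are written as successive matrix actions, without any element of Br, because they are
    also used after extending scalars. *)
Definition eact (l : seq (hyp W)) (y : 'cV[F]_N) := foldr (fun H z => e H *m z) y l.

Lemma eactD l : {morph eact l : y z / y + z}.
Proof. by move=> y z; elim: l => //= H l ->; rewrite mulmxDr. Qed.

Lemma eact0 l : eact l 0 = 0.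
Proof. by elim: l => //= H l ->; rewrite mulmx0. Qed.

Section Degree.

Variables (B : {set hyp W}) (x : 'cV[F]_N).
Hypothesis x_in : forall H, H \in B -> e H *m x = d *: x.
Hypothesis x_out : forall H, H \notin B ->
  exists c : W -> k, e H *m x = \sum_w iota (c w) *: (rho w *m x).

(* Vectors that are polynomials in d of degree less than n, with coefficients
   in the span of the translates of x over the field k. *)
Inductive deg_lt (n : nat) : 'cV[F]_N -> Prop :=
| DegGen i w : (i < n)%N -> deg_lt n (d ^+ i *: (rho w *m x))
| Deg0 : deg_lt n 0
| DegD y z : deg_lt n y -> deg_lt n z -> deg_lt n (y + z)
| DegZ a y : deg_lt n y -> deg_lt n (iota a *: y).

(** Moving e_H past [rho w] turns H into w^-1 H, and that generator either multiplies x by d or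
    gives a combination over k of translates of x. *)
Lemma deg_lt_e n H y : deg_lt n y -> deg_lt n.+1 (e H *m y).
Proof.
elim=> [i w lin||{}y z _ IHy _ IHz|a {}y _ IHy].
- rewrite -scalemxAr mulmxA -[H](hyp_actVK w) -rho_e -mulmxA.
  have [HB|HB] := boolP (hyp_act w^-1%g H \in B).
    by rewrite x_in // -scalemxAr scalerA -exprSr; apply: DegGen.
  have [c ->] := x_out HB; rewrite mulmx_sumr scaler_sumr.
  apply: (big_ind (deg_lt n.+1)) => [||u _]; [exact: Deg0|exact: DegD|].
  rewrite -scalemxAr scalerA mulrC -scalerA mulmxA -rhoM; apply/DegZ/DegGen/ltnW; exact: lin.
- by rewrite mulmx0; apply: Deg0.
- by rewrite mulmxDr; apply: DegD.
- by rewrite -scalemxAr; apply: DegZ.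
Qed.

Lemma eact_all l : all (mem B) l -> eact l x = d ^+ size l *: x.
Proof.
elim: l => [|H l IHl] /=; first by rewrite expr0 scale1r.
by case/andP=> HB lB; rewrite IHl // -scalemxAr x_in // scalerA -exprSr.
Qed.

(** Among the factors outside B, the one that acts first contributes no power of d; every other
    factor raises the degree by at most one. *)
Lemma eact_deg l : ~~ all (mem B) l -> deg_lt (size l) (eact l x).
Proof.
elim: l => [|H l IHl] //=; have [lB|lB] := boolP (all (mem B) l); last first.
  by move=> _; apply/deg_lt_e/IHl.
rewrite andbT => HB; rewrite eact_all //.
have [c Ec] := x_out HB; rewrite -scalemxAr Ec scaler_sumr.
apply: (big_ind (deg_lt _)) => [||u _]; [exact: Deg0|exact: DegD|].
by rewrite scalerA mulrC -scalerA; apply/DegZ/DegGen.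
Qed.

Lemma deg_lt_rho n w y : deg_lt n y -> deg_lt n (rho w *m y).
Proof.
elim=> [i u lin||{}y z _ IHy _ IHz|a {}y _ IHy].
- by rewrite -scalemxAr mulmxA -rhoM; apply: DegGen.
- by rewrite mulmx0; apply: Deg0.
- by rewrite mulmxDr; apply: DegD.
- by rewrite -scalemxAr; apply: DegZ.
Qed.

End Degree.

(* Expanding the product of the e_H, H in B, on the sum of the x_{B'} gives
   d^m x_B plus terms of lower degree in d, so that a dependency would make d
   integral over k. *)
Lemma graded_independent (O : {set {set hyp W}}) (x : {set hyp W} -> 'cV[F]_N) m :
  (forall B, B \in O -> #|B| = m) ->
  (forall B H, B \in O -> H \in B -> e H *m x B = d *: x B) ->
  (forall B H, B \in O -> H \notin B ->
    exists c : W -> k, e H *m x B = \sum_w iota (c w) *: (rho w *m x B)) ->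
  (forall B, B \in O -> eact (enum B) (\sum_(B' in O) x B') = 0) ->
  forall B, B \in O -> x B = 0.
Proof.
move=> cardO x_in x_out ex B BO.
have eE B0 : B0 \in O -> eact (enum B0) (x B0) =
    - \sum_(B' in O | B' != B0) eact (enum B0) (x B').
  move=> B0O; apply/eqP; rewrite -addr_eq0 -(big_morph _ (eactD _) (eact0 _)).
  by rewrite -eactD -bigD1 // ex.
(* For m = 0 every index is the empty set and the product is empty, so the hypothesis is already the
   conclusion; the family [y] below would be empty. *)
have [m0|m_gt0] := posnP m.
  have uO B' : B' \in O -> B' = B.
    move=> B'O; have := cardO _ BO; rewrite m0 => /eqP; rewrite cards_eq0 => /eqP ->.
    by have := cardO _ B'O; rewrite m0 => /eqP; rewrite cards_eq0 => /eqP.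
  have := eE B BO; rewrite big1 => [|B' /andP[/uO->]]; last by rewrite eqxx.
  by rewrite oppr0 -[enum B]/(enum (mem B)) (size0nil (_ : size (enum B) = 0%N)) //
    -cardE cardO.
pose y (t : 'I_m * W * {set hyp W}) : 'cV[F]_N :=
  if t.2 \in O then d ^+ t.1.1 *: (rho t.1.2 *m x t.2) else 0.
pose Sp v := exists a : _ -> k, v = \sum_t iota (a t) *: y t.
have Sp0 : Sp 0.
  by exists (fun _ => 0); rewrite big1 // => t _; rewrite rmorph0 scale0r.
have SpD u v : Sp u -> Sp v -> Sp (u + v).
  move=> [a ->] [b ->]; exists (fun t => a t + b t); rewrite -big_split /=.
  by apply: eq_bigr => t _; rewrite rmorphD scalerDl.
have SpZ c u : Sp u -> Sp (iota c *: u).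
  move=> [a ->]; exists (fun t => c * a t); rewrite scaler_sumr.
  by apply: eq_bigr => t _; rewrite rmorphM scalerA.
have Spy t : Sp (y t).
  exists (fun u => (u == t)%:R); rewrite (bigD1 t) //= eqxx rmorph1 scale1r.
  by rewrite big1 ?addr0 // => u /negPf ->; rewrite rmorph0 scale0r.
have SpN u : Sp u -> Sp (- u).
  by move=> Su; rewrite -scaleN1r -(rmorph1 iota) -rmorphN; apply: SpZ.
have Sp_deg B' u : B' \in O -> deg_lt (x B') m u -> Sp u.
  move=> B'O; elim=> {u} [i w lim||u v _ Su _ Sv|a u _ Su];
    [|exact: Sp0|exact: SpD|exact: SpZ].
  by have := Spy (Ordinal lim, w, B'); rewrite /y /= B'O.
have y0 t : y t = 0.
  apply: transcendental_no_eigenfamily t => -[[i w] B']; rewrite -/(Sp _) /y /=.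
  have [B'O|_] := boolP (B' \in O); last by rewrite scaler0.
  rewrite scalerA -exprS; have [lim|] := ltnP i.+1 m.
    by apply: (Sp_deg B') => //; apply: DegGen.
  (* In degree m, d^m x_{B'} is the product over B' applied to x_{B'}, hence minus the same product
     applied to the other pieces. For B2 <> B' of the same cardinality some factor is outside B2, so
     [eact_deg] brings the degree below m. *)
  move=> le_m_i; have -> : i.+1 = m by apply/eqP; rewrite eqn_leq le_m_i ltn_ord.
  have -> : d ^+ m *: (rho w *m x B') = rho w *m eact (enum B') (x B').
    rewrite (@eact_all B') -?cardE ?cardO ?scalemxAr //.
      by move=> H; apply: x_in.
    by apply/allP => H; rewrite mem_enum.
  rewrite eE // mulmxN; apply: SpN; rewrite mulmx_sumr.
  apply: (big_ind Sp) => // B2 /andP[B2O B2B']; apply: (Sp_deg B2) => //.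
  apply: deg_lt_rho; rewrite -(cardO _ B'O) cardE; apply: (@eact_deg B2).
  - by move=> H; apply: x_in.
  - by move=> H; apply: x_out.
  apply/negP => /allP sB'; case/eqP: B2B'; apply/esym/eqP.
  rewrite eqEcard (cardO _ B2O) (cardO _ B'O) leqnn andbT.
  by apply/subsetP => H HB'; apply: sB'; rewrite mem_enum.
by have := y0 (Ordinal m_gt0, 1%g, B); rewrite /y /= BO expr0 scale1r rho1 mul1mx.
Qed.

End Directness.

(** * Induced representations and their grading *)

Section InducedModule.

Variables (F : fieldType) (gT : finGroupType) (S : {group gT}) (d : nat).
Variable rV : mx_representation F S d.
Local Notation n := (n_lcosets S).
Local Notation t := (@lcoset_repr gT S).
Local Notation N := (ind_dim S d).

Definition repr0 (x : gT) : 'M[F]_d := if x \in S then rV x else 0.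

Lemma repr0M x y : x \in S -> repr0 (x * y)%g = rV x *m repr0 y.
Proof.
move=> Sx; rewrite /repr0 groupMl //; case: ifP => Sy; last by rewrite mulmx0.
by rewrite repr_mxM.
Qed.

(** [ind_col x] takes v to the tensor of x and v; [ind_row x] takes the tensor of y and v to the
    action of x y on v, or to 0 if x y is outside S. *)
Definition ind_col (x : gT) : 'M[F]_(N, d) := \mxcol_(i < n) repr0 ((t i)^-1 * x)%g.
Definition ind_row (x : gT) : 'M[F]_(d, N) := \mxrow_(i < n) repr0 (x * t i)%g.

Lemma ind_unitE : ind_unit rV = ind_col 1%g.
Proof. by apply: eq_mxcol => i; rewrite mulg1. Qed.

Lemma repr0_sum x y : \sum_(i < n) repr0 (x * t i)%g *m repr0 ((t i)^-1 * y)%g =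
  repr0 (x * y)%g.
Proof.
have [i0 Ei] := lcoset_repr_index S y.
rewrite (bigD1 i0) //= big1 => [|i ne_i]; last first.
  by rewrite [X in _ *m X]/repr0 Ei (negPf ne_i) mulmx0.
have Sy : ((t i0)^-1 * y)%g \in S by rewrite Ei.
rewrite addr0 {2}/repr0 Sy.
have -> : (x * y = x * t i0 * ((t i0)^-1 * y))%g by rewrite !mulgA mulgK.
rewrite /repr0 (groupMr _ Sy); case: ifP => Sx; last by rewrite mul0mx.
by rewrite (repr_mxM rV Sx Sy).
Qed.

Lemma ind_mx_col g x : ind_repr rV g *m ind_col x = ind_col (g * x)%g.
Proof.
rewrite /= /ind_mx /ind_col mul_mxblock_mxrow; apply: eq_mxcol => i.
rewrite mulgA -repr0_sum; apply: eq_bigr => j _; congr (_ *m _).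
Qed.

Lemma ind_row_col x y : ind_row x *m ind_col y = repr0 (x * y)%g.
Proof. by rewrite mul_mxrow_mxcol repr0_sum. Qed.

Lemma ind_row_mx g x : ind_row x *m ind_repr rV g = ind_row (x * g)%g.
Proof.
rewrite /= /ind_mx /ind_row mul_mxrow_mxblock; apply: eq_mxrow => j.
by rewrite -mulgA -repr0_sum; apply: eq_bigr => i _; rewrite mulgA.
Qed.

Lemma ind_unit_stab x : x \in S -> ind_col x = ind_unit rV *m rV x.
Proof.
move=> Sx; rewrite ind_unitE mxcol_mul; apply: eq_mxcol => i.
rewrite mulg1 /repr0 (groupMr _ Sx); case: ifP => Si; last by rewrite mul0mx.
by rewrite (repr_mxM rV Si Sx).
Qed.

(** The term of g is the projection onto the summand of the coset g S, and each coset is met |S|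
    times. Once |S| is invertible, maps out of the induced module can be compared on the
    [ind_col u]. *)
Lemma ind_resolution : \sum_(g : gT) ind_col g *m ind_row g^-1%g = #|S|%:R%:M.
Proof.
have E g : ind_col g *m ind_row g^-1%g =
    \mxdiag_(i < n) (if ((t i)^-1 * g)%g \in S then 1%:M else 0 : 'M[F]_d).
  rewrite mul_mxcol_mxrow /mxdiag; apply: eq_mxblock => i j; rewrite /repr0.
  have [i0 Ei] := lcoset_repr_index S g.
  have -> : (g^-1 * t j \in S)%g = ((t j)^-1 * g \in S)%g.
    by rewrite -groupV invMg invgK.
  rewrite !Ei; case: (eqVneq j i0) => [->|ji0]; last first.
    rewrite mulmx0; case: (eqVneq i j) => [ij|//].
    by rewrite -ij in ji0 *; rewrite (negPf ji0) conform_mx_id.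
  case: (eqVneq i i0) => [->|ii0]; last by rewrite mul0mx.
  rewrite conform_mx_id -repr_mxM ?Ei ?eqxx //.
    by rewrite mulgA mulgK mulVg repr_mx1.
  by rewrite -groupV invMg invgK Ei eqxx.
rewrite (eq_bigr _ (fun g _ => E g)) -mxdiag_sum -(@mxdiagZ F _ (fun=> d)).
apply: eq_mxdiag => i.
rewrite -big_mkcond sumr_const -scaler_nat scale_scalar_mx mulr1; congr (_%:R%:M).
rewrite -(card_lcoset S (t i)); apply: eq_card => g.
by rewrite mem_lcoset.
Qed.


End InducedModule.

Lemma eq_on_cV (F : fieldType) m n (X Y : 'M[F]_(m, n)) :
  (forall v : 'cV[F]_n, X *m v = Y *m v) -> X = Y.
Proof.
move=> XY; apply/matrixP => i j; have := XY (delta_mx j 0).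
by rewrite -!colE => /colP/(_ i); rewrite !mxE.
Qed.

Section Graded.

Variables (R : realType) (W : complexReflectionGroup R) (K : fieldType).
Hypothesis K0 : [pchar K] =i pred0.
Variables (B : {set hyp W}) (d : nat) (rV : mx_representation K (Stab B) d).
Local Notation N := (ind_dim (Stab B) d).
Local Notation rho := (ind_repr rV).
Local Notation col := (ind_col rV).
Local Notation row := (ind_row rV).

Lemma natK_neq0 n : (0 < n)%N -> n%:R != 0 :> K.
Proof. by move=> n0; rewrite ((pcharf0P K).1 K0) -lt0n. Qed.

Lemma rhoM u v : rho (u * v)%g = rho u *m rho v.
Proof. by rewrite repr_mxM ?inE. Qed.

Lemma rho1 : rho 1%g = 1%:M.
Proof. exact: repr_mx1. Qed.

Lemma mem_Stab w : (w \in Stab B) = (hset_act w B == B).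
Proof. by rewrite inE. Qed.

Lemma StabV u w : ((u^-1 * w)%g \in Stab B) = (hset_act w B == hset_act u B).
Proof.
rewrite mem_Stab hset_actM; apply/eqP/eqP => [E|->].
  by rewrite -{2}E -hset_actM mulgV hset_act1.
by rewrite -hset_actM mulVg hset_act1.
Qed.

Lemma ind_colM x s : s \in Stab B -> col (x * s)%g = col x *m rV s.
Proof.
by move=> Ss; rewrite -ind_mx_col ind_unit_stab // mulmxA ind_unitE ind_mx_col mulg1.
Qed.

Lemma eq_on_ind_col m (X Y : 'M[K]_(m, N)) :
  (forall u, X *m col u = Y *m col u) -> X = Y.
Proof.
move=> XY; have S0 : #|Stab B|%:R != 0 :> K by rewrite natK_neq0 ?cardG_gt0.
apply: (scalerI S0); rewrite -!mul_mx_scalar -(ind_resolution rV) !mulmx_sumr.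
by apply: eq_bigr => g _; rewrite !mulmxA XY.
Qed.

Fact gproj_key : unit. Proof. by []. Qed.
(** Projection onto V^{B'} along the other summands: when B' is in the orbit of B, the |Stab B|
    elements w with wB = B' give equal terms, whence the factor. Outside the orbit it is 0, so sums
    may run over all sets. *)
Definition gproj : {set hyp W} -> 'M[K]_N := locked_with gproj_key (fun B' =>
  #|Stab B|%:R^-1 *: \sum_(w | hset_act w B == B') col w *m row w^-1%g).

Lemma gproj_col B' u : gproj B' *m col u = (hset_act u B == B')%:R *: col u.
Proof.
rewrite /gproj locked_withE -scalemxAl mulmx_suml.
have E w : col w *m row w^-1%g *m col u =
    ((w^-1 * u)%g \in Stab B)%:R *: col u.
  rewrite -mulmxA ind_row_col /repr0; case: ifP => Sw; last by rewrite mulmx0 scale0r.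
  by rewrite -ind_colM // mulKVg scale1r.
rewrite (eq_bigr _ (fun w _ => E w)) -scaler_suml scalerA; congr (_ *: _).
have [<-|uB'] := eqVneq (hset_act u B) B'; last first.
  by rewrite big1 ?mulr0 // => w /eqP wB'; rewrite StabV wB' (negPf uB').
rewrite -natr_sum -big_mkcondr sum1_card /=.
have -> : #|(fun w : W => (hset_act w B == hset_act u B) &&
    ((w^-1 * u)%g \in Stab B))| = #|Stab B|.
  rewrite -(card_lcoset (Stab B) u); apply: eq_card => w.
  rewrite mem_lcoset -[in RHS]groupV invMg invgK StabV unfold_in.
  by rewrite StabV [X in _ && X]eq_sym andbb eq_sym.
exact: mulVf (natK_neq0 (cardG_gt0 (Stab B))).
Qed.

Lemma rho_gproj w B' : rho w *m gproj B' = gproj (hset_act w B') *m rho w.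
Proof.
apply: eq_on_ind_col => u; rewrite -!mulmxA gproj_col ind_mx_col gproj_col.
rewrite -scalemxAr ind_mx_col hset_actM.
by congr (_%:R *: _); rewrite (inj_eq (can_inj (hset_actK w))).
Qed.

Lemma gprojM B1 B2 : gproj B1 *m gproj B2 = (B1 == B2)%:R *: gproj B2.
Proof.
apply: eq_on_ind_col => u; rewrite -scalemxAl -mulmxA !gproj_col -scalemxAr gproj_col.
have [<-|_] := eqVneq (hset_act u B) B2; first by rewrite !scale1r eq_sym.
by rewrite !scale0r scaler0.
Qed.

Lemma gproj_id B1 : gproj B1 *m gproj B1 = gproj B1.
Proof. by rewrite gprojM eqxx scale1r. Qed.

Lemma gproj_sum : \sum_B' gproj B' = 1%:M.
Proof.
apply: eq_on_ind_col => u; rewrite mulmx_suml mul1mx (bigD1 (hset_act u B)) //=.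
rewrite gproj_col eqxx scale1r big1 ?addr0 // => B' neB'.
by rewrite gproj_col eq_sym (negPf neB') scale0r.
Qed.

Lemma gproj_base : gproj B = ind_unit rV *m row 1%g.
Proof.
apply: eq_on_ind_col => u; rewrite gproj_col -mulmxA ind_row_col mul1g /repr0.
rewrite -mem_Stab; case: ifP => Su; last by rewrite scale0r mulmx0.
by rewrite scale1r ind_unit_stab.
Qed.

Lemma row_unit : row 1%g *m ind_unit rV = 1%:M.
Proof. by rewrite ind_unitE ind_row_col mulg1 /repr0 group1 repr_mx1. Qed.

Lemma gproj_unit : gproj B *m ind_unit rV = ind_unit rV.
Proof. by rewrite gproj_base -mulmxA row_unit mulmx1. Qed.

Lemma rho_unit s : s \in Stab B -> rho s *m ind_unit rV = ind_unit rV *m rV s.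
Proof. by move=> Ss; rewrite -ind_unit_stab // ind_unitE ind_mx_col mulg1. Qed.

Lemma rhoVK w : rho w^-1%g *m rho w = 1%:M.
Proof. by rewrite -rhoM mulVg rho1. Qed.

Lemma rhoK w : rho w *m rho w^-1%g = 1%:M.
Proof. by rewrite -rhoM mulgV rho1. Qed.

Definition orbit_of : {set {set hyp W}} := [set hset_act w B | w in [set: W]].

Lemma orbit_ofP B' : reflect (exists w, B' = hset_act w B) (B' \in orbit_of).
Proof.
apply: (iffP imsetP) => [[w _ ->]|[w ->]]; first by exists w.
by exists w; rewrite ?inE.
Qed.

Lemma gproj_orbit B' : B' \notin orbit_of -> gproj B' = 0.
Proof.
move=> nB'; apply: eq_on_ind_col => u; rewrite gproj_col mul0mx.
by case: eqP => [E|_]; rewrite ?scale0r //; case/orbit_ofP: nB'; exists u.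
Qed.

Lemma gprojE w : gproj (hset_act w B) =
  rho w *m ind_unit rV *m row 1%g *m rho w^-1%g.
Proof. by rewrite -[rho w *m _ *m _]mulmxA -gproj_base rho_gproj -mulmxA rhoK mulmx1. Qed.

Lemma gproj_rho_unit w : gproj (hset_act w B) *m (rho w *m ind_unit rV) =
  rho w *m ind_unit rV.
Proof. by rewrite mulmxA -rho_gproj -mulmxA gproj_unit. Qed.

Lemma orbit_card B' : B' \in orbit_of -> #|B'| = #|B|.
Proof. by case/orbit_ofP => w ->; apply: card_hset_act. Qed.

Lemma orbit_transverse B' : transverse_collection B -> B' \in orbit_of ->
  transverse_collection B'.
Proof. by move=> tB /orbit_ofP[w ->]; rewrite transverse_collection_act. Qed.

Section Rules.

Variable P : brauerParams W K.

(** The action rules are stated for a bare family of matrices, since they must be usable before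
    these are known to define a module over Br. *)
Definition BV_rules (E : hyp W -> 'M[K]_N) := forall (H : hyp W) (B' : {set hyp W}),
  [/\ H \in B' -> E H *m gproj B' = delta P *: gproj B',
      transverse_to H B' -> E H *m gproj B' = 0 &
      forall L, L \in B' -> nontransverse H L ->
        E H *m gproj B' = mx_between P rho L H *m gproj B'].

Lemma is_BVE (M : brModule P N) :
  is_BV rV M <-> (forall w, M (br_w P w) = rho w) /\ BV_rules (fun H => M (br_e P H)).
Proof.
split=> -[Mw Me]; split=> //; last first.
  move=> H w u B' v.
  have vE : v = gproj B' *m v.
    by rewrite /v /B' [ind_repr _ _ *m _]mulmxA mulmxA gproj_rho_unit.
  have [M1 M2 M3] := Me H B'; rewrite vE mulmxA; split.
  - by move/M1->; rewrite -scalemxAl.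
  - by move/M2->; rewrite mul0mx.
  move=> L LB' ntHL; rewrite (M3 L) // mulmx_suml mulmx_suml.
  by apply: eq_bigr => s _; rewrite -!scalemxAl -mulmxA.
move=> H B'.
have [/orbit_ofP[w ->]|nB'] := boolP (B' \in orbit_of); last first.
  by rewrite gproj_orbit //; split=> *; rewrite !mulmx0 ?scaler0.
have MeE (X : 'M[K]_N) : (forall u : 'cV[K]_d, M (br_e P H) *m (rho w *m (ind_unit rV *m u)) =
     X *m (rho w *m (ind_unit rV *m u))) ->
    M (br_e P H) *m gproj (hset_act w B) = X *m gproj (hset_act w B).
  move=> MX; rewrite gprojE; apply: eq_on_cV => v.
  by have := MX (row 1%g *m rho w^-1%g *m v); rewrite !mulmxA.
split=> [HB'|tHB'|L LB' ntHL].
- rewrite -mul_scalar_mx; apply: MeE => u; have [->//] := Me H w u.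
  by rewrite mul_scalar_mx.
- rewrite -[RHS](mul0mx _ (gproj (hset_act w B))); apply: MeE => u.
  by have [_ ->] := Me H w u; rewrite ?mul0mx.
apply: MeE => u; have [_ _ /(_ L LB' ntHL) ->] := Me H w u.
by rewrite mulmx_suml; apply: eq_bigr => s _; rewrite -scalemxAl.
Qed.

End Rules.

End Graded.

Section InducedMaps.

Variables (R : realType) (W : complexReflectionGroup R) (K : fieldType).
Hypothesis K0 : [pchar K] =i pred0.
Variables (B : {set hyp W}) (d : nat) (rV : mx_representation K (Stab B) d).
Local Notation N := (ind_dim (Stab B) d).
Local Notation rho := (ind_repr rV).
Local Notation unit := (ind_unit rV).
Local Notation row := (ind_row rV).

Lemma ind_colE u : ind_col rV u = rho u *m unit.
Proof. by rewrite ind_unitE ind_mx_col mulg1. Qed.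

Lemma row_stab s x : s \in Stab B -> row (s * x)%g = rV s *m row x.
Proof.
move=> Ss; rewrite /ind_row mul_mxrow; apply: eq_mxrow => i.
by rewrite -mulgA repr0M.
Qed.

Lemma ind_hom_eq m (X Y : 'M[K]_(m, N)) (rho' : W -> 'M[K]_m) :
  (forall w, X *m rho w = rho' w *m X) -> (forall w, Y *m rho w = rho' w *m Y) ->
  X *m unit = Y *m unit -> X = Y.
Proof.
move=> Xw Yw XY; apply: (eq_on_ind_col K0 (rV := rV)) => u.
by rewrite ind_colE !mulmxA Xw Yw -!mulmxA XY.
Qed.

(* Frobenius reciprocity: a Stab(B)-map from V extends to Ind V. *)
Lemma ind_hom_exists m (rho' : W -> 'M[K]_m) (f : 'M[K]_(m, d)) :
  (forall u v, rho' (u * v)%g = rho' u *m rho' v) ->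
  (forall s, s \in Stab B -> rho' s *m f = f *m rV s) -> rho' 1%g = 1%:M ->
  exists T : 'M[K]_(m, N), (forall w, T *m rho w = rho' w *m T) /\ T *m unit = f.
Proof.
move=> rhoM' fS rho1'; have S0 : #|Stab B|%:R != 0 :> K by rewrite natK_neq0 ?cardG_gt0.
(* The sum is over the whole group instead of a transversal: terms with u in one left coset of
   Stab(B) coincide by the equivariance of f. *)
exists (#|Stab B|%:R^-1 *: \sum_u rho' u *m f *m row u^-1%g); split=> [w|].
  rewrite -scalemxAl -scalemxAr mulmx_suml mulmx_sumr; congr (_ *: _).
  rewrite (reindex_inj (mulgI w)) /=; apply: eq_bigr => u _.
  by rewrite rhoM' -!mulmxA ind_row_mx invMg -mulgA mulVg mulg1.
apply: (scalerI S0); rewrite -scalemxAl scalerA mulfV // scale1r mulmx_suml.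
have E u : rho' u *m f *m row u^-1%g *m unit = (u \in Stab B)%:R *: f.
  rewrite -mulmxA ind_unitE ind_row_col mulg1 /repr0 groupV.
  case: ifP => Su; last by rewrite mulmx0 scale0r.
  by rewrite fS // -mulmxA -repr_mxM ?groupV // mulgV repr_mx1 mulmx1 scale1r.
rewrite (eq_bigr _ (fun u _ => E u)) -scaler_suml -natr_sum; congr (_%:R *: _).
by rewrite -big_mkcond /= sum1_card.
Qed.

Section Rules.

Variables (P : brauerParams W K) (E : hyp W -> 'M[K]_N).
Hypothesis BVE : BV_rules rV P E.

Lemma mx_between_gproj H L B' : mx_between P rho L H *m gproj rV B' =
  \sum_(s in refl_between L H) mu P s *: (gproj rV (hset_act s B') *m rho s).
Proof.
by rewrite mulmx_suml; apply: eq_bigr => s _; rewrite -scalemxAl (rho_gproj K0).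
Qed.

(** The image of e_H lies in the pieces whose index contains H: on V^{B1}, e_H is a scalar with H in
    B1, or 0, or a combination of reflections s carrying an element of B1 to H, and then H is in s
    B1. *)
Lemma gproj_e (H : hyp W) (B' : {set hyp W}) : H \notin B' -> gproj rV B' *m E H = 0.
Proof.
move=> HB'; rewrite -[E H]mulmx1 -(gproj_sum K0 rV) !mulmx_sumr big1 // => B1 _.
have orth (B2 : {set hyp W}) : H \in B2 -> gproj rV B' *m gproj rV B2 = 0.
  move=> HB2; rewrite (gprojM K0); case: eqP => [E2|_]; last by rewrite scale0r.
  by rewrite E2 HB2 in HB'.
have [E1 E2 E3] := BVE H B1; case: (hyp_cases H B1) => [HB1|tHB1|[_ [L LB1 ntHL]]].
- by rewrite E1 // -scalemxAr orth ?scaler0.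
- by rewrite E2 // mulmx0.
rewrite (E3 _ LB1 ntHL) mx_between_gproj mulmx_sumr big1 // => s.
rewrite inE => /andP[_ /eqP sL]; rewrite -scalemxAr mulmxA orth ?mul0mx ?scaler0 //.
by rewrite -sL mem_hset_act.
Qed.

End Rules.

Variables (P : brauerParams W K) (M : brModule P N).
Hypothesis BVM : is_BV rV M.

Let Mw w : M (br_w P w) = rho w. Proof. by have [/(_ w)] := BVM. Qed.
Let Me : BV_rules rV P (fun H => M (br_e P H)).
Proof. by have /(is_BVE K0)[] := BVM. Qed.

Lemma gproj_eB (B' C : {set hyp W}) : transverse_collection C -> ~~ (C \subset B') ->
  gproj rV B' *m M (br_eB P C) = 0.
Proof.
move=> tC /subsetPn[H HC HB']; rewrite (br_eB_rem P tC HC) br_actM mulmxA.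
by rewrite (gproj_e Me) ?mul0mx.
Qed.

Lemma eB_gproj (B' C : {set hyp W}) : transverse_collection C -> C \subset B' ->
  M (br_eB P C) *m gproj rV B' = delta P ^+ #|C| *: gproj rV B'.
Proof.
move=> tC sC; rewrite br_eB_enum // cardE.
have : {subset enum C <= B'} by move=> H; rewrite mem_enum; apply: (subsetP sC).
elim: (enum C) => [|H l IHl] sl /=.
  by rewrite big_nil br_act1 mul1mx scale1r.
rewrite big_cons br_actM -mulmxA IHl; last by move=> L lL; apply: sl; rewrite inE lL orbT.
have [E1 _ _] := Me H B'.
by rewrite -scalemxAr E1 ?scalerA -?exprSr //; apply: sl; rewrite mem_head.
Qed.

Lemma eB_gproj_self : transverse_collection B ->
  gproj rV B *m M (br_eB P B) = M (br_eB P B).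
Proof.
move=> tB; rewrite -[RHS]mul1mx -(gproj_sum K0 rV) mulmx_suml (bigD1 B) //=.
rewrite big1 ?addr0 // => B' neB'.
have [B'O|nB'] := boolP (B' \in orbit_of B); last by rewrite gproj_orbit ?mul0mx.
rewrite gproj_eB //; apply: contra neB' => sB; rewrite eq_sym eqEcard sB.
by rewrite (orbit_card B'O) leqnn.
Qed.

End InducedMaps.

Section Isomorphisms.

Variables (R : realType) (W : complexReflectionGroup R) (K : fieldType).
Variable P : brauerParams W K.
Hypothesis K0 : [pchar K] =i pred0.

Lemma br_isoP m n (M : brModule P m) (M' : brModule P n) :
  br_iso M M' <-> exists (T : 'M[K]_(n, m)) (T' : 'M[K]_(m, n)),
    [/\ T *m T' = 1%:M, T' *m T = 1%:M & forall x, T *m M x = M' x *m T].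
Proof.
split=> [[T [Tfree Tfull TM]]|[T [T' [TT' T'T TM]]]].
  have /row_freeP[T1 E1] := Tfree; have /row_fullP[T2 E2] := Tfull.
  exists T, T2; split=> //; suff <- : T1 = T2 by [].
  by rewrite -[LHS]mul1mx -E2 -mulmxA E1 mulmx1.
exists T; split=> //; first by apply/row_freeP; exists T'.
by apply/row_fullP; exists T'.
Qed.

Lemma br_iso_sym m n (M : brModule P m) (M' : brModule P n) :
  br_iso M M' -> br_iso M' M.
Proof.
case/br_isoP=> T [T' [TT' T'T TM]]; apply/br_isoP; exists T', T; split=> // x.
by rewrite -[T' *m _]mulmx1 -TT' !mulmxA -[T' *m M' x *m T]mulmxA -TM mulmxA T'T mul1mx.
Qed.

Section TwoPairs.

Variables (B : {set hyp W}) (d : nat) (rV : mx_representation K (Stab B) d).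
Variables (B' : {set hyp W}) (d' : nat) (rV' : mx_representation K (Stab B') d').
Variables (M : brModule P (ind_dim (Stab B) d)).
Variables (M' : brModule P (ind_dim (Stab B') d')).
Hypotheses (BVM : is_BV rV M) (BVM' : is_BV rV' M').
Hypotheses (tB : transverse_collection B) (tB' : transverse_collection B').

(** On V^B, e_B is the nonzero scalar delta^|B|, so it is nonzero on M and then on M', where its
    image only meets pieces whose index contains B. *)
Lemma iso_orbit : br_iso M M' -> (0 < d)%N ->
  (0 < d')%N /\ exists2 B2, B2 \in orbit_of B' & B \subset B2.
Proof.
case/br_isoP=> T [T' [TT' T'T TM]] d_gt0.
have eBM : M (br_eB P B) *m ind_unit rV = delta P ^+ #|B| *: ind_unit rV.
  by rewrite -(gproj_unit K0 rV) mulmxA (eB_gproj K0 BVM) // -scalemxAl.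
have eB0 : M' (br_eB P B) != 0.
  apply/eqP => eB0; have := congr1
    (mulmx (ind_row rV 1%g *m T')) (congr2 mulmx (TM (br_eB P B)) (erefl (ind_unit rV))).
  rewrite eB0 mul0mx mul0mx mulmx0 -!mulmxA (mulmxA T') T'T mul1mx eBM -scalemxAr.
  rewrite row_unit => /matrixP/(_ (Ordinal d_gt0) (Ordinal d_gt0)) /eqP.
  rewrite !mxE eqxx mulr1 expf_eq0 andbC -[delta P == 0]negbK -unitfE.
  by rewrite delta_unit.
have sum0 : \sum_B2 gproj rV' B2 *m M' (br_eB P B) != 0.
  by rewrite -mulmx_suml (gproj_sum K0) mul1mx.
split.
  rewrite lt0n; apply: contraNneq sum0 => d0; rewrite big1 // => B2 _.
  have [/orbit_ofP[w ->]|nB2] := boolP (B2 \in orbit_of B'); last first.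
    by rewrite gproj_orbit ?mul0mx.
  rewrite (gprojE K0) (_ : ind_row rV' 1%g = 0) ?mulmx0 ?mul0mx //.
  by apply/matrixP => i; have := ltn_ord i; rewrite {2}d0.
have [B2 B2P] : exists B2, gproj rV' B2 *m M' (br_eB P B) != 0.
  apply/existsP; apply: contraNT sum0; rewrite negb_exists => /forallP n0.
  by rewrite big1 // => B2 _; apply/eqP; have := n0 B2; rewrite negbK.
exists B2.
  by apply: contraNT B2P => nB2; rewrite gproj_orbit ?mul0mx.
by apply: contraNT B2P => nsB; rewrite (gproj_eB K0 BVM').
Qed.

End TwoPairs.

End Isomorphisms.

(** * Isomorphisms between the modules (B | V) *)

Section IsoClassification.

Variables (R : realType) (W : complexReflectionGroup R) (K : fieldType).
Variable P : brauerParams W K.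
Hypothesis K0 : [pchar K] =i pred0.
Variables (B : {set hyp W}) (d : nat) (rV : mx_representation K (Stab B) d).
Variables (B' : {set hyp W}) (d' : nat) (rV' : mx_representation K (Stab B') d').
Variables (M : brModule P (ind_dim (Stab B) d)).
Variables (M' : brModule P (ind_dim (Stab B') d')).
Hypotheses (BVM : is_BV rV M) (BVM' : is_BV rV' M').
Hypotheses (tB : transverse_collection B) (tB' : transverse_collection B').
Local Notation rho := (ind_repr rV).
Local Notation rho' := (ind_repr rV').

Let Mw w : M (br_w P w) = rho w. Proof. by have [/(_ w)] := BVM. Qed.
Let Mw' w : M' (br_w P w) = rho' w. Proof. by have [/(_ w)] := BVM'. Qed.
Let Me : BV_rules rV P (fun H => M (br_e P H)).
Proof. by have /(is_BVE K0)[] := BVM. Qed.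
Let Me' : BV_rules rV' P (fun H => M' (br_e P H)).
Proof. by have /(is_BVE K0)[] := BVM'. Qed.

Lemma stab_conj w : hset_act w B = B' ->
  forall s, s \in Stab B -> (w * s * w^-1)%g \in Stab B'.
Proof.
move=> wB s; rewrite !mem_Stab -wB -hset_actM mulgKV hset_actM => /eqP ->.
by rewrite eqxx.
Qed.

Lemma stab_conjV w : hset_act w B = B' ->
  forall s, s \in Stab B' -> (s ^ w)%g \in Stab B.
Proof.
move=> wB s; rewrite !mem_Stab -wB -hset_actM => /eqP sB.
by rewrite conjgE hset_actM sB -hset_actM mulVg hset_act1.
Qed.

Lemma transport_rsim_iso (w : W) (wB : hset_act w B = B') :
  mx_rsim (transport rV wB) rV' <->
  exists (X : 'M[K]_(d, d')) (Y : 'M[K]_(d', d)), [/\ X *m Y = 1%:M, Y *m X = 1%:M &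
    forall s, s \in Stab B' -> rV (s ^ w)%g *m X = X *m rV' s].
Proof.
split=> [[X dd' Xfree Xs]|[X [Y [XY YX Xs]]]].
  have /row_freeP[Y XY] := Xfree; exists X, Y; split=> //.
  have /row_fullP[Z ZX] : row_full X by rewrite /row_full (eqP Xfree) dd'.
  by suff -> : Y = Z by []; rewrite -[LHS]mul1mx -ZX -mulmxA XY mulmx1.
exists X => //; last by apply/row_freeP; exists Y.
by apply/eqP; rewrite eqn_leq (mulmx1_min XY) (mulmx1_min YX).
Qed.

(** Translation by w^-1 puts V' in the piece of M' indexed by B, and Y identifies V with it.
    Frobenius reciprocity extends this map and its counterpart [f'] to mutually inverse maps, which
    respect the pieces and therefore the rules. *)
Lemma conjugate_iso : conjugate_pairs rV rV' -> br_iso M M'.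
Proof.
case=> w [wB /transport_rsim_iso[X [Y [XY YX Xs]]]].
have Ys s : s \in Stab B' -> rV' s *m Y = Y *m rV (s ^ w)%g.
  move=> Ss; rewrite -[rV' s]mul1mx -YX -(mulmxA Y) -Xs // -!mulmxA.
  by rewrite XY mulmx1.
pose f := rho' w^-1%g *m ind_unit rV' *m Y.
have fS s : s \in Stab B -> rho' s *m f = f *m rV s.
  move=> Ss; rewrite /f !mulmxA -rhoM.
  have -> : (s * w^-1 = w^-1 * (w * s * w^-1))%g by rewrite !mulgA mulVg mul1g.
  rewrite rhoM -[_ *m ind_unit rV']mulmxA (rho_unit rV' (stab_conj wB Ss)).
  rewrite -!mulmxA (Ys _ (stab_conj wB Ss)); congr (_ *m (_ *m (_ *m rV _))).
  by rewrite conjgE !mulgA mulVg mul1g mulgKV.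
have [T [Tw Tu]] := ind_hom_exists K0 (@rhoM _ _ _ _ _ rV') fS (rho1 rV').
pose f' := rho w *m ind_unit rV *m X.
have f'S s : s \in Stab B' -> rho s *m f' = f' *m rV' s.
  move=> Ss; rewrite /f' !mulmxA -rhoM.
  have -> : (s * w = w * (s ^ w))%g by rewrite conjgE !mulgA mulgV mul1g.
  rewrite rhoM -[_ *m ind_unit rV]mulmxA (rho_unit rV (stab_conjV wB Ss)).
  by rewrite -!mulmxA Xs.
have [T' [T'w T'u]] := ind_hom_exists K0 (@rhoM _ _ _ _ _ rV) f'S (rho1 rV).
apply/br_isoP; exists T, T'; split.
- apply: (ind_hom_eq K0 (rV := rV') (rho' := rho')) => [u|u|]; rewrite ?mul1mx ?mulmx1 //.
    by rewrite -mulmxA T'w mulmxA Tw mulmxA.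
  rewrite -mulmxA T'u /f' !mulmxA Tw -[_ *m ind_unit rV]mulmxA Tu /f !mulmxA rhoK mul1mx.
  by rewrite -mulmxA YX mulmx1.
- apply: (ind_hom_eq K0 (rV := rV) (rho' := rho)) => [u|u|]; rewrite ?mul1mx ?mulmx1 //.
    by rewrite -mulmxA Tw mulmxA T'w mulmxA.
  rewrite -mulmxA Tu /f !mulmxA T'w -[_ *m ind_unit rV']mulmxA T'u /f' !mulmxA rhoVK mul1mx.
  by rewrite -mulmxA XY mulmx1.
apply: br_intertwine => [u|H]; first by rewrite Mw Mw'.
apply: (eq_on_ind_col K0 (rV := rV)) => u; rewrite ind_colE -!mulmxA.
have wVB : hset_act w^-1%g B' = B by rewrite -wB hset_actK.
have E1 : gproj rV (hset_act u B) *m (rho u *m ind_unit rV) = rho u *m ind_unit rV.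
  exact: gproj_rho_unit.
have E2 : gproj rV' (hset_act u B) *m (T *m (rho u *m ind_unit rV)) =
    T *m (rho u *m ind_unit rV).
  have uB : hset_act u B = hset_act (u * w^-1)%g B' by rewrite hset_actM wVB.
  have -> : T *m (rho u *m ind_unit rV) = rho' (u * w^-1)%g *m ind_unit rV' *m Y.
    by rewrite mulmxA Tw -mulmxA Tu rhoM /f !mulmxA.
  by rewrite uB mulmxA gproj_rho_unit.
rewrite -[in LHS]E1 -[in RHS]E2 !(mulmxA (M _)) !(mulmxA (M' _)).
have Tmx L :
    T *m (mx_between P rho L H *m (gproj rV (hset_act u B) *m (rho u *m ind_unit rV))) =
  mx_between P rho' L H *m (T *m (rho u *m ind_unit rV)).
  rewrite E1 !mulmx_suml mulmx_sumr; apply: eq_bigr => s _.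
  by rewrite -!scalemxAl -scalemxAr; congr (_ *: _); rewrite !mulmxA Tw.
have [A1 A2 A3] := Me H (hset_act u B); have [C1 C2 C3] := Me' H (hset_act u B).
case: (hyp_cases H (hset_act u B)) => [HB|tH|[_ [L LB ntH]]].
- by rewrite A1 // C1 // -!scalemxAl -scalemxAr E1 E2.
- by rewrite A2 // C2 // !mul0mx mulmx0.
by rewrite (A3 _ LB) // (C3 _ LB) // -!mulmxA Tmx E2.
Qed.

End IsoClassification.

Section IsoConjugate.

Variables (R : realType) (W : complexReflectionGroup R) (K : fieldType).
Variable P : brauerParams W K.
Hypothesis K0 : [pchar K] =i pred0.
Variables (B : {set hyp W}) (d : nat) (rV : mx_representation K (Stab B) d).
Variables (B' : {set hyp W}) (d' : nat) (rV' : mx_representation K (Stab B') d').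
Variables (M : brModule P (ind_dim (Stab B) d)).
Variables (M' : brModule P (ind_dim (Stab B') d')).
Hypotheses (BVM : is_BV rV M) (BVM' : is_BV rV' M').
Hypotheses (tB : transverse_collection B) (tB' : transverse_collection B').
Local Notation rho := (ind_repr rV).
Local Notation rho' := (ind_repr rV').

Let Mw w : M (br_w P w) = rho w. Proof. by have [/(_ w)] := BVM. Qed.
Let Mw' w : M' (br_w P w) = rho' w. Proof. by have [/(_ w)] := BVM'. Qed.

(** Two uses of [iso_orbit] give equal cardinalities, hence B = w B'. As e_B is a nonzero scalar on
    V^B and sends M' into its piece of index B, T maps the one piece into the other and T' maps it
    back; X and Y are these restrictions, read through the translation by w. *)
Lemma iso_conjugate : br_iso M M' -> (0 < d)%N || (0 < d')%N ->
  conjugate_pairs rV rV'.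
Proof.
move=> isoM d_gt0.
have {d_gt0} [d0 d0'] : (0 < d)%N /\ (0 < d')%N.
  case/orP: d_gt0 => d0; first by case: (iso_orbit K0 BVM BVM' tB isoM d0).
  by case: (iso_orbit K0 BVM' BVM tB' (br_iso_sym isoM) d0).
have [_ [B2 B2O sB]] := iso_orbit K0 BVM BVM' tB isoM d0.
have [_ [B1 B1O sB']] := iso_orbit K0 BVM' BVM tB' (br_iso_sym isoM) d0'.
have EB : B = B2.
  apply/eqP; rewrite eqEcard sB (orbit_card B2O) -(orbit_card B1O).
  exact: subset_leq_card.
have [w Ew] := orbit_ofP _ _ B2O; rewrite -EB in Ew.
have wB : hset_act w^-1%g B = B' by rewrite Ew hset_actK.
exists w^-1%g, wB; apply/transport_rsim_iso.
have [T [T' [TT' T'T TM]]] := (br_isoP M M').1 isoM.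
have TM' x : T' *m M' x = M x *m T'.
  by rewrite -[T' *m _]mulmx1 -TT' !mulmxA -[T' *m M' x *m T]mulmxA -TM mulmxA T'T mul1mx.
have sBw : hset_act w B' \subset B by rewrite -Ew.
have B'O : B \in orbit_of B' by apply/orbit_ofP; exists w.
have eB' : gproj rV' B *m M' (br_eB P B) = M' (br_eB P B).
  rewrite -[RHS]mul1mx -(gproj_sum K0 rV') mulmx_suml (bigD1 B) //=.
  rewrite big1 ?addr0 // => B3 neB3.
  have [B3O|nB3] := boolP (B3 \in orbit_of B'); last by rewrite gproj_orbit ?mul0mx.
  rewrite (gproj_eB K0 BVM') //; apply: contra neB3 => sB3; rewrite eq_sym eqEcard sB3.
  by rewrite (orbit_card B3O) (orbit_card B'O) leqnn.
have eB := eB_gproj_self K0 BVM tB.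
have d0m : delta P ^+ #|B| != 0 by rewrite expf_neq0 // -unitfE delta_unit.
have TB : gproj rV' B *m T *m gproj rV B = T *m gproj rV B.
  apply: (scalerI d0m); rewrite !scalemxAr -(eB_gproj K0 BVM) // !mulmxA.
  by rewrite -[_ *m T *m M _]mulmxA TM !mulmxA eB'.
have TB' : gproj rV B *m T' *m gproj rV' B = T' *m gproj rV' B.
  apply: (scalerI d0m); rewrite !scalemxAr -(eB_gproj K0 BVM') // !mulmxA.
  by rewrite -[_ *m T' *m M' _]mulmxA TM' !mulmxA eB.
pose X := ind_row rV 1%g *m T' *m (rho' w *m ind_unit rV').
pose Y := ind_row rV' 1%g *m rho' w^-1%g *m T *m ind_unit rV.
have Pw : gproj rV' B *m (rho' w *m ind_unit rV') = rho' w *m ind_unit rV'.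
  by rewrite {1}Ew gproj_rho_unit.
have Pu := gproj_unit K0 rV.
have T'u : gproj rV B *m (T' *m (rho' w *m ind_unit rV')) = T' *m (rho' w *m ind_unit rV').
  by rewrite -Pw !mulmxA in TB' *; rewrite TB'.
have Tu : gproj rV' B *m (T *m ind_unit rV) = T *m ind_unit rV.
  by rewrite -Pu !mulmxA TB.
exists X, Y; split.
- have -> : X *m Y = ind_row rV 1%g *m T' *m (gproj rV' B *m (T *m ind_unit rV)).
    by rewrite (congr1 (gproj rV') Ew) (gprojE K0) /X /Y !mulmxA.
  by rewrite Tu !mulmxA -(mulmxA _ T') T'T mulmx1 row_unit.
- have -> : Y *m X = ind_row rV' 1%g *m rho' w^-1%g *m T *m
      (gproj rV B *m (T' *m (rho' w *m ind_unit rV'))).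
    by rewrite /X /Y (gproj_base K0) !mulmxA.
  rewrite T'u !mulmxA -(mulmxA _ T) TT' mulmx1 -(mulmxA _ (rho' w^-1%g)) rhoVK mulmx1.
  by rewrite row_unit.
move=> s Ss; have SsB := stab_conjV wB Ss.
rewrite /X !mulmxA -row_stab // mulg1 -[(s ^ _)%g]mul1g -ind_row_mx.
rewrite -Mw -[_ *m M _ *m T']mulmxA -TM' Mw' !mulmxA; rewrite -!mulmxA; congr (_ *m (_ *m _)).
rewrite -rho_unit // !mulmxA -!rhoM; congr (rho' _ *m _).
by rewrite conjgE invgK !mulgA mulgKV.
Qed.

End IsoConjugate.

(** * Absolute irreducibility *)

Section AbsoluteIrreducibility.

Variables (R : realType) (W : complexReflectionGroup R) (K : fieldType).
Variable P : brauerParams W K.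
Hypothesis K0 : [pchar K] =i pred0.
Variables (k : fieldType) (iota : {rmorphism k -> K}).
Hypothesis mu_k : forall s, s \in reflections W -> exists a : k, iota a = mu P s.
Hypothesis delta_transc : ~ algebraicOver iota (delta P).

Lemma mu_coef : exists a : W -> k, forall s, s \in reflections W -> iota (a s) = mu P s.
Proof.
have /choice[a aE] s : exists a : k, s \in reflections W -> iota a = mu P s.
  have [sR|sR] := boolP (s \in reflections W); last by exists 0.
  by have [a Ea] := mu_k sR; exists a.
by exists a.
Qed.

Variables (B : {set hyp W}) (d : nat) (rV : mx_representation K (Stab B) d).
Variable M : brModule P (ind_dim (Stab B) d).
Hypotheses (tB : transverse_collection B) (BVM : is_BV rV M).
Hypothesis irrV : mx_absolutely_irreducible rV.
Local Notation N := (ind_dim (Stab B) d).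
Local Notation rho := (ind_repr rV).

Let Mw w : M (br_w P w) = rho w. Proof. by have [/(_ w)] := BVM. Qed.
Let Me : BV_rules rV P (fun H => M (br_e P H)).
Proof. by have /(is_BVE K0)[] := BVM. Qed.

Variables (L : fieldType) (f : {rmorphism K -> L}).

Lemma transcendental_map : ~ algebraicOver (f \o iota) (f (delta P)).
Proof.
case=> p p0 rp; apply: delta_transc; exists p => //.
by move: rp; rewrite /root map_poly_comp horner_map fmorph_eq0.
Qed.

Let E H := map_mx f (M (br_e P H)).
Let Rho w := map_mx f (rho w).
Let Pi B' := map_mx f (gproj rV B').

(** Contrapositive of independence: if all these products kill x, then [graded_independent], applied
    over L to the components of x, makes them 0. It applies because delta remains transcendental
    over k in L. *)
Lemma base_component_nonzero (x : 'cV[L]_N) : x != 0 ->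
  exists2 B', B' \in orbit_of B & eact E (enum B') x != 0.
Proof.
move=> x0; apply/exists_inP; apply: contraNT x0; rewrite negb_exists_in => /forall_inP e0.
have sumx : x = \sum_(B' in orbit_of B) Pi B' *m x.
  rewrite -mulmx_suml -[LHS]mul1mx -(map_mx1 f) -(gproj_sum K0 rV) map_mx_sum.
  rewrite [in LHS](bigID (mem (orbit_of B))) /= [X in _ + X]big1 ?addr0 // => B' nB'.
  by rewrite gproj_orbit // map_mx0.
have [a aE] := mu_coef.
have x_out (B' : {set hyp W}) H : H \notin B' -> exists c : W -> k,
    E H *m (Pi B' *m x) = \sum_w (f \o iota) (c w) *: (Rho w *m (Pi B' *m x)).
  move=> HB'; have [_ E2 E3] := Me H B'.
  case: (hyp_cases H B') => [HB|tH|[_ [H' HB ntH]]]; first by rewrite HB in HB'.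
    exists (fun _ => 0); rewrite mulmxA -map_mxM E2 // map_mx0 mul0mx.
    by rewrite big1 // => w _; rewrite rmorph0 scale0r.
  exists (fun w => if w \in refl_between H' H then a w else 0).
  rewrite mulmxA -map_mxM (E3 _ HB ntH) map_mxM -mulmxA map_mx_sum mulmx_suml.
  rewrite big_mkcond; apply: eq_bigr => w _; case: ifP => [|_]; last first.
    by rewrite rmorph0 scale0r.
  by rewrite inE => /andP[wR _]; rewrite map_mxZ -scalemxAl /= aE.
have Pi0 : forall B', B' \in orbit_of B -> Pi B' *m x = 0.
  apply: (graded_independent transcendental_map (rho := Rho) (e := E)).
  - by rewrite /Rho rho1 map_mx1.
  - by move=> u v; rewrite /Rho rhoM map_mxM.
  - by move=> w H; rewrite /Rho /E -!Mw -!map_mxM br_act_we.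
  - exact: orbit_card.
  - move=> B' H B'O HB'; have [E1 _ _] := Me H B'.
    by rewrite mulmxA -map_mxM E1 // map_mxZ -scalemxAl.
  - by move=> B' H _; apply: x_out.
  by move=> B' B'O; rewrite -sumx; apply/eqP; have := e0 _ B'O; rewrite negbK.
by rewrite sumx big1 // => B' B'O; rewrite Pi0.
Qed.

Lemma act_prod_map l (y : 'cV[L]_N) :
  map_mx f (M (\prod_(H <- l) br_e P H)) *m y = eact E l y.
Proof.
elim: l => [|H l IHl]; first by rewrite big_nil br_act1 map_mx1 mul1mx.
by rewrite big_cons br_actM map_mxM -mulmxA IHl.
Qed.

(** A product e_{B'} takes a vector of U to a nonzero one in V^{B'}, which W brings to V^B. There
    the matrices of Stab(B) span all matrices over L, so U contains V^B and all its translates. *)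
Lemma BV_simple_over : simple_action (fun x : Br P => map_mx f (M x)).
Proof.
have [d0 [a aE]] : (0 < d)%N /\ exists a_, forall A : 'M[L]_d,
    A = \sum_(x in Stab B) a_ x A *: map_repr f rV x.
  by apply/mx_abs_irrP; rewrite map_mx_abs_irr.
split.
  rewrite lt0n; apply/eqP => N0.
  have := row_unit rV; rewrite (_ : ind_unit rV = 0) ?mulmx0; last first.
    by apply/matrixP => i; have := ltn_ord i; rewrite {2}N0.
  move/matrixP/(_ (Ordinal d0) (Ordinal d0)); rewrite !mxE eqxx => /eqP.
  by rewrite eq_sym oner_eq0.
move=> U Ustab; have [->|U0] := eqVneq U 0%VS; [by left|right].
have Ux : vpick U \in U by apply: memv_pick.
have x0 : vpick U != 0 by rewrite vpick0.
have [B' B'O] := base_component_nonzero x0.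
rewrite -act_prod_map -br_eB_enum; last exact: orbit_transverse B'O.
set z := _ *m _ => z0.
have Uz : z \in U by apply: Ustab.
have /orbit_ofP[w Ew] := B'O.
have zE : z = Pi B' *m z.
  rewrite /z mulmxA -map_mxM; congr (map_mx f _ *m _).
  have tB' : transverse_collection B' by apply: orbit_transverse B'O.
  rewrite -[LHS]mul1mx -(gproj_sum K0 rV) mulmx_suml (bigD1 B') //=.
  rewrite big1 ?addr0 // => B2 neB2.
  have [B2O|nB2] := boolP (B2 \in orbit_of B); last by rewrite gproj_orbit ?mul0mx.
  rewrite (gproj_eB K0 BVM) //; apply: contra neB2 => sB2; rewrite eq_sym eqEcard sB2.
  by rewrite (orbit_card B2O) (orbit_card B'O) leqnn.
have [c zc] : exists c : 'cV[L]_d, z = Rho w *m map_mx f (ind_unit rV) *m c.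
  exists (map_mx f (ind_row rV 1%g *m rho w^-1%g) *m z).
  by rewrite {1}zE /Pi Ew (gprojE K0) !map_mxM !mulmxA.
have c0 : c != 0 by apply: contraNneq z0 => c0; rewrite zc c0 mulmx0.
have UR u y : y \in U -> Rho u *m y \in U by rewrite /Rho -Mw; apply: Ustab.
have Uc : map_mx f (ind_unit rV) *m c \in U.
  have := UR w^-1%g _ Uz; rewrite {1}zc !mulmxA.
  have -> : Rho w^-1%g *m Rho w = 1%:M by rewrite /Rho -map_mxM rhoVK map_mx1.
  by rewrite mul1mx.
have Uall (y : 'cV[L]_d) : map_mx f (ind_unit rV) *m y \in U.
  have [i ci] : exists i, c i 0 != 0.
    apply/existsP; apply: contraNT c0; rewrite negb_exists => /forallP c0.
    by apply/eqP/colP => i; rewrite [RHS]mxE; apply/eqP; have := c0 i; rewrite negbK.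
  (* A rank one matrix taking c to y, to be expanded on the matrices of Stab(B). *)
  pose A : 'M[L]_d := (c i 0)^-1 *: (y *m delta_mx 0 i).
  have -> : y = A *m c.
    rewrite /A -scalemxAl -mulmxA -rowE; apply/colP => j; rewrite !mxE big_ord1 !mxE.
    by rewrite mulrC mulfK.
  rewrite [A]aE mulmx_suml mulmx_sumr memv_suml // => s Ss.
  rewrite -scalemxAl -scalemxAr memvZ // mulmxA -map_mxM -rho_unit //.
  by rewrite map_mxM -mulmxA UR.
apply/eqP; rewrite eqEsubv subvf /=; apply/subvP => x _.
have S0 : f #|Stab B|%:R != 0 by rewrite fmorph_eq0 natK_neq0 ?cardG_gt0.
rewrite -[x]scale1r -(mulVf S0) -scalerA memvZ //.
rewrite -mul_scalar_mx -map_scalar_mx -(ind_resolution rV) map_mx_sum mulmx_suml.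
rewrite memv_suml // => u _; rewrite ind_colE !map_mxM -!mulmxA UR //.
Qed.

End AbsoluteIrreducibility.

(** * Simple modules *)

Lemma row_full_inj (F : fieldType) m n (A : 'M[F]_(m, n)) :
  (forall c : 'cV[F]_n, A *m c = 0 -> c = 0) -> row_full A.
Proof.
move=> Ainj; suff : row_free A^T by rewrite /row_free /row_full mxrank_tr.
rewrite -kermx_eq0; apply/eqP/row_matrixP => i; rewrite row0.
apply: trmx_inj; rewrite trmx0; apply: Ainj.
by rewrite -[A in A *m _]trmxK -trmx_mul -row_mul mulmx_ker row0 trmx0.
Qed.

(** For X the action of e_B on a simple module S, the columns of V form a basis of e_B S and Rb
    gives coordinates in it; Z witnesses that V lies in the image of X. *)
Lemma rank_factor (F : fieldType) m n (X : 'M[F]_(m, n)) :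
  exists d (V : 'M[F]_(m, d)) (Rb : 'M[F]_(d, n)) (Z : 'M[F]_(n, d)) (L : 'M[F]_(d, m)),
    [/\ V *m Rb = X, V = X *m Z & L *m V = 1%:M].
Proof.
have /row_freeP[Z EZ] := row_base_free X.
have /row_fullP[L LV] := col_base_full X.
exists (\rank X), (col_base X), (row_base X), Z, L; split=> //; first exact: mulmx_base.
by have /(congr1 (mulmx^~ Z)) := mulmx_base X; rewrite -mulmxA EZ mulmx1.
Qed.

Section SimpleModules.

Variables (R : realType) (W : complexReflectionGroup R) (K : fieldType).
Variable P : brauerParams W K.
Hypothesis K0 : [pchar K] =i pred0.
Variables (k : fieldType) (iota : {rmorphism k -> K}).
Hypothesis mu_k : forall s, s \in reflections W -> exists a : k, iota a = mu P s.
Hypothesis delta_transc : ~ algebraicOver iota (delta P).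
Variables (m : nat) (S : brModule P m).
Hypothesis simpleS : br_simple S.
Local Notation Sw w := (S (br_w P w)).
Local Notation Se H := (S (br_e P H)).

Lemma maximal_collection : exists B, [/\ transverse_collection B,
  S (br_eB P B) != 0 & forall H, transverse_to H B -> S (br_eB P (H |: B)) = 0].
Proof.
pose good (C : {set hyp W}) := transverse_collection C && (S (br_eB P C) != 0).
have good0 : good set0.
  rewrite /good /br_eB big_set0 br_act1; apply/andP; split.
    by apply/forall_inP => H; rewrite inE.
  have [m0 _] := simpleS; apply/eqP => /matrixP/(_ (Ordinal m0) (Ordinal m0)) /eqP.
  by rewrite !mxE eqxx oner_eq0.
case: (@arg_maxnP _ set0 good (fun C => #|C|) good0) => B /andP[tB eB0] maxB.
exists B; split=> // H tHB; apply/eqP/negPn/negP => eHB.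
have := maxB (H |: B); rewrite /good eHB transverse_collectionU1 // => /(_ isT).
by rewrite cardsU1 transverse_to_notin // add1n /= ltnn.
Qed.

Variable B : {set hyp W}.
Hypotheses (tB : transverse_collection B) (eB0 : S (br_eB P B) != 0).
Hypothesis maxB : forall H, transverse_to H B -> S (br_eB P (H |: B)) = 0.
Local Notation X := (S (br_eB P B)).
Variables (d : nat) (V : 'M[K]_(m, d)) (Rb : 'M[K]_(d, m)) (Z : 'M[K]_(m, d)).
Variable L : 'M[K]_(d, m).
Hypotheses (VB : V *m Rb = X) (EZ : V = X *m Z) (LV : L *m V = 1%:M).

Lemma top_eB_conj u : Sw u *m X = S (br_eB P (hset_act u B)) *m Sw u.
Proof. by rewrite -!br_actM br_w_eB. Qed.

Lemma top_repr_exists : exists rV : mx_representation K (Stab B) d,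
  forall s, s \in Stab B -> Sw s *m V = V *m rV s.
Proof.
pose r s := L *m Sw s *m V.
have rE s : s \in Stab B -> Sw s *m V = V *m r s.
  move=> Ss; suff [Q EQ] : exists Q, Sw s *m V = V *m Q.
    by rewrite /r -mulmxA EQ (mulmxA L) LV mul1mx.
  exists (Rb *m Sw s *m Z); rewrite !mulmxA VB.
  by rewrite {1}EZ mulmxA top_eB_conj; move: Ss; rewrite mem_Stab => /eqP ->.
have rep : mx_repr (Stab B) r.
  split=> [|x y Sx Sy]; first by rewrite /r br_act_w1 mulmx1.
  by rewrite {1}/r br_act_wM -!mulmxA (rE y Sy) !mulmxA.
by exists (MxRepresentation rep).
Qed.

Variable rV : mx_representation K (Stab B) d.
Hypothesis rV_S : forall s, s \in Stab B -> Sw s *m V = V *m rV s.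
Local Notation N := (ind_dim (Stab B) d).
Local Notation rho := (ind_repr rV).

(** (B1) and (B5) give the first and last rules; the vanishing for transverse H is the maximality of
    B, translated by u. *)
Lemma top_rules u H :
  [/\ H \in hset_act u B -> Se H *m (Sw u *m V) = delta P *: (Sw u *m V),
      transverse_to H (hset_act u B) -> Se H *m (Sw u *m V) = 0 &
      forall H', H' \in hset_act u B -> nontransverse H H' ->
        Se H *m (Sw u *m V) = mx_between P (fun w => Sw w) H' H *m (Sw u *m V)].
Proof.
have -> : Sw u *m V = S (br_eB P (hset_act u B)) *m Sw u *m Z.
  by rewrite EZ mulmxA top_eB_conj.
have tuB : transverse_collection (hset_act u B) by rewrite transverse_collection_act.
split=> [HB|tH|H' LB ntH]; rewrite !mulmxA -[Se H *m _]br_actM.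
- by rewrite br_e_eB_in // br_actZ -!scalemxAl.
- rewrite -br_eB_U1 //; suff -> : S (br_eB P (H |: hset_act u B)) = 0 by rewrite !mul0mx.
  have E : H |: hset_act u B = hset_act u (hyp_act u^-1%g H |: B).
    by rewrite /hset_act imsetU1 hyp_actVK.
  have tHB : transverse_to (hyp_act u^-1%g H) B.
    by rewrite -(transverse_to_act u) hyp_actVK.
  have E0 : S (br_eB P (hset_act u (hyp_act u^-1%g H |: B))) *m Sw u = 0.
    rewrite -br_actM -br_w_eB; last exact: transverse_collectionU1.
    by rewrite br_actM maxB // mulmx0.
  by rewrite E -[LHS]mulmx1 -(br_act_w1 S) -(mulgV u) br_act_wM mulmxA E0 mul0mx.
by rewrite (br_e_eB_nontransverse P tuB LB ntH) br_actM br_act_between.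
Qed.

Variable T : 'M[K]_(m, N).
Hypotheses (Tw : forall w, T *m rho w = Sw w *m T) (Tu : T *m ind_unit rV = V).

Lemma T_gproj u : T *m gproj rV (hset_act u B) =
  Sw u *m V *m (ind_row rV 1%g *m rho u^-1%g).
Proof. by rewrite (gprojE K0) !mulmxA Tw -(mulmxA (Sw u)) Tu. Qed.

Lemma T_rules (H : hyp W) (B' : {set hyp W}) :
  [/\ H \in B' -> Se H *m (T *m gproj rV B') = delta P *: (T *m gproj rV B'),
      transverse_to H B' -> Se H *m (T *m gproj rV B') = 0 &
      forall H', H' \in B' -> nontransverse H H' ->
        Se H *m (T *m gproj rV B') = T *m (mx_between P rho H' H *m gproj rV B')].
Proof.
have [/orbit_ofP[u ->]|nB'] := boolP (B' \in orbit_of B); last first.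
  by rewrite gproj_orbit //; split=> *; rewrite !mulmx0 ?scaler0.
have [S1 S2 S3] := top_rules u H; rewrite T_gproj !mulmxA -!(mulmxA _ _ V).
split=> [/S1|/S2|H' LB ntH].
- by rewrite !mulmxA => ->; rewrite -!scalemxAl.
- by rewrite !mulmxA => ->; rewrite !mul0mx.
have := S3 H' LB ntH; rewrite !mulmxA => ->.
have -> : T *m mx_between P rho H' H = mx_between P (fun w => Sw w) H' H *m T.
  rewrite mulmx_sumr mulmx_suml; apply: eq_bigr => s _.
  by rewrite -scalemxAr Tw scalemxAl.
by rewrite -!mulmxA T_gproj !mulmxA.
Qed.

(** The images under T of the components of x satisfy [graded_independent] by [T_rules], with sum T
    x = 0. So each image is 0, and T is injective on a single piece because V has the left inverse
    L. *)
Lemma T_inj (x : 'cV[K]_N) : T *m x = 0 -> x = 0.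
Proof.
move=> Tx; have [a aE] := mu_coef mu_k.
have sumT : \sum_(B' in orbit_of B) T *m gproj rV B' *m x = 0.
  rewrite -mulmx_suml -mulmx_sumr -[RHS]Tx -[T in RHS]mulmx1 -(gproj_sum K0 rV).
  congr (_ *m _ *m _); rewrite [in RHS](bigID (mem (orbit_of B))) /=.
  by rewrite [X in _ + X]big1 ?addr0 // => B' nB'; rewrite gproj_orbit.
have T0 : forall B', B' \in orbit_of B -> T *m gproj rV B' *m x = 0.
  apply: (graded_independent delta_transc (rho := fun w => Sw w) (e := fun H => Se H)).
  - exact: br_act_w1.
  - exact: br_act_wM.
  - exact: br_act_we.
  - exact: orbit_card.
  - move=> B' H _ HB'; have [E1 _ _] := T_rules H B'.
    by rewrite mulmxA E1 // -scalemxAl.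
  - move=> B' H _ HB'; have [_ E2 E3] := T_rules H B'.
    case: (hyp_cases H B') => [HB|tH|[_ [H' LB ntH]]]; first by rewrite HB in HB'.
      exists (fun _ => 0); rewrite mulmxA E2 // mul0mx.
      by rewrite big1 // => w _; rewrite rmorph0 scale0r.
    exists (fun w => if w \in refl_between H' H then a w else 0).
    rewrite mulmxA (E3 _ LB ntH) mulmx_suml mulmx_sumr mulmx_suml.
    rewrite big_mkcond; apply: eq_bigr => w _; case: ifP => [|_]; last first.
      by rewrite rmorph0 scale0r.
    rewrite inE => /andP[wR _]; rewrite aE // -scalemxAl -scalemxAr -scalemxAl.
    by rewrite !mulmxA Tw.
  by move=> B' _; rewrite sumT eact0.
rewrite -[x]mul1mx -(gproj_sum K0 rV) mulmx_suml big1 // => B' _.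
have [B'O|nB'] := boolP (B' \in orbit_of B); last by rewrite gproj_orbit ?mul0mx.
have /orbit_ofP[u Eu] := B'O; have := T0 _ B'O; rewrite Eu T_gproj => E.
have E2 : ind_row rV 1%g *m rho u^-1%g *m x = 0.
  have /(congr1 (mulmx (L *m Sw u^-1%g))) := E.
  rewrite mulmx0 !mulmxA -(mulmxA L) -br_act_wM mulVg br_act_w1 mulmx1 LV mul1mx.
  by [].
by rewrite (gprojE K0) -!mulmxA in E2 *; rewrite E2 !mulmx0.
Qed.

Lemma T_surj : exists Y, T *m Y = 1%:M.
Proof.
pose g : 'Hom('cV[K]_N, 'cV[K]_m) := linfun (mulmx T).
have gE x : g x = T *m x by rewrite lfunE.
have [_ /(_ (limg g)) []] := simpleS.
- apply: br_module_stable => [u v|a u|w u|H u].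
  + exact: memvD.
  + exact: memvZ.
  + case/memv_imgP=> x _ ->; rewrite gE mulmxA -Tw -mulmxA -gE.
    by rewrite memv_img ?memvf.
  case/memv_imgP=> x _ ->; rewrite gE -[T]mulmx1 -(gproj_sum K0 rV).
  rewrite mulmx_sumr mulmx_suml mulmx_sumr memv_suml // => B' _.
  have [E1 E2 E3] := T_rules H B'; rewrite mulmxA.
  case: (hyp_cases H B') => [HB|tH|[_ [H' LB ntH]]].
  + by rewrite E1 // -scalemxAl memvZ // -mulmxA -gE memv_img ?memvf.
  + by rewrite E2 // mul0mx mem0v.
  by rewrite (E3 _ LB ntH) -mulmxA -gE memv_img ?memvf.
- move/eqP; rewrite -subv0 => /subvP g0; case/eqP: eB0.
  rewrite -VB -Tu.
  suff -> : T = 0 by rewrite !mul0mx.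
  apply: eq_on_cV => x; rewrite mul0mx -gE; apply/eqP; rewrite -memv0; apply: g0.
  by rewrite memv_img ?memvf.
move=> gfull; have /choice[y yE] (j : 'I_m) : exists y : 'cV[K]_N, T *m y = delta_mx j 0.
  have : (delta_mx j 0 : 'cV[K]_m) \in limg g by rewrite gfull memvf.
  by case/memv_imgP => x _ ->; exists x; rewrite gE.
exists (\matrix_(i, j) y j i 0); apply/matrixP => i j.
have /colP/(_ i) := yE j; rewrite !mxE eqxx andbT => <-.
by apply: eq_bigr => l _; rewrite mxE.
Qed.

Lemma T_full : exists T', T' *m T = 1%:M /\ T *m T' = 1%:M.
Proof.
have [Y TY] := T_surj; have /row_fullP[Y' Y'T] := row_full_inj T_inj.
by exists Y; split=> //; suff <- : Y' = Y by []; rewrite -[LHS]mulmx1 -TY mulmxA Y'T mul1mx.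
Qed.

(** U is a stable row space, so the columns it annihilates form a submodule of V, and [X1] is the
    submodule of S induced from it. By simplicity [X1] is 0, and then U is full, or it is
    everything, and then U = 0. *)
Lemma top_irreducible : mx_irreducible rV.
Proof.
have [T' [T'T TT']] := T_full.
have V0 c : V *m c = 0 -> c = 0 :> 'cV[K]_d.
  by move=> Vc; rewrite -[c]mul1mx -LV -mulmxA Vc mulmx0.
have d0 : (0 < d)%N.
  rewrite lt0n; apply: contraNneq eB0 => d0; rewrite -VB (_ : Rb = 0) ?mulmx0 //.
  by apply/matrixP => i; have := ltn_ord i; rewrite {2}d0.
apply/mx_irrP; split=> // U modU U0.
pose Q u : 'M[K]_(d, m) := U *m ind_row rV 1%g *m rho u *m T'.
pose X1 := (\bigcap_(u : W) lker (linfun (mulmx (Q u)) : 'Hom('cV[K]_m, 'cV[K]_d)))%VS.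
have X1P y : reflect (forall u, Q u *m y = 0) (y \in X1).
  rewrite memvE; apply: (iffP subv_bigcapP) => Qy u.
    by have := Qy u isT; rewrite -memvE memv_ker lfunE => /eqP.
  by move=> _; rewrite -memvE memv_ker lfunE /= Qy.
have Us s : s \in Stab B -> exists A, U *m rV s = A *m U.
  by move=> Ss; have /submxP := mxmoduleP modU s Ss.
have stabX1 : forall x y, y \in X1 -> S x *m y \in X1.
  have TX1 (x : 'cV[K]_N) : (forall u, U *m ind_row rV 1%g *m rho u *m x = 0) -> T *m x \in X1.
    by move=> Ux; apply/X1P => u; rewrite /Q -mulmxA (mulmxA T') T'T mul1mx Ux.
  have X1T y : y \in X1 -> forall u, U *m ind_row rV 1%g *m rho u *m (T' *m y) = 0.
    by move/X1P=> Qy u; rewrite mulmxA Qy.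
  apply: br_module_stable => [u v|a u|w u|H y X1y].
  - exact: memvD.
  - exact: memvZ.
  - move/X1P=> Qu; apply/X1P => v; have := Qu (v * w)%g.
    rewrite /Q rhoM -[Sw w]mulmx1 -TT' !mulmxA -[_ *m Sw w *m T](mulmxA _ _ T) -Tw.
    by rewrite !mulmxA -[_ *m T' *m T](mulmxA _ T') T'T mulmx1.
  have gproj_stab B' (x : 'cV[K]_N) : (forall u, U *m ind_row rV 1%g *m rho u *m x = 0) ->
      forall u, U *m ind_row rV 1%g *m rho u *m (gproj rV B' *m x) = 0.
    move=> Ux u; have [/orbit_ofP[v ->]|nB'] := boolP (B' \in orbit_of B); last first.
      by rewrite gproj_orbit // mul0mx mulmx0.
    rewrite (gprojE K0) !mulmxA -[_ *m rho u *m rho v](mulmxA _ _ (rho v)) -rhoM.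
    rewrite -[_ *m rho _ *m ind_unit rV]mulmxA -ind_colE -[U *m _ *m ind_col _ _]mulmxA.
    rewrite ind_row_col mul1g /repr0; case: ifP => [Ss|_]; last by rewrite mulmx0 !mul0mx.
    have [A ->] := Us _ Ss; rewrite -!mulmxA; move: (Ux v^-1%g); rewrite -!mulmxA => ->.
    by rewrite mulmx0.
  rewrite -[y]mul1mx -TT' -mulmxA; move: (X1T y X1y); move: (T' *m y) => x Ux.
  rewrite -[T]mulmx1 -(gproj_sum K0 rV) mulmx_sumr mulmx_suml mulmx_sumr memv_suml // => B' _.
  have [E1 E2 E3] := T_rules H B'; rewrite mulmxA.
  case: (hyp_cases H B') => [HB|tH|[_ [H' LB ntH]]].
  - by rewrite E1 // -scalemxAl memvZ // -mulmxA TX1 //; apply: gproj_stab.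
  - by rewrite E2 // mul0mx mem0v.
  rewrite (E3 _ LB ntH) -!mulmxA TX1 // => u; rewrite !mulmx_suml mulmx_sumr big1 // => s _.
  rewrite -!scalemxAl -scalemxAr.
  have -> : U *m ind_row rV 1%g *m rho u *m (rho s *m (gproj rV B' *m x)) =
      U *m ind_row rV 1%g *m rho (u * s)%g *m (gproj rV B' *m x).
    by rewrite rhoM !mulmxA.
  by rewrite gproj_stab // scaler0.
have [_ /(_ X1 stabX1)[X10|X1T]] := simpleS.
  apply: row_full_inj => c Uc; apply: V0; apply/eqP; rewrite -memv0 -X10.
  apply/X1P => u; rewrite /Q -Tu !mulmxA -[_ *m T' *m T](mulmxA _ T') T'T mulmx1.
  rewrite -[_ *m rho _ *m ind_unit rV]mulmxA -ind_colE -[U *m _ *m ind_col _ _]mulmxA.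
  rewrite ind_row_col mul1g /repr0; case: ifP => [Ss|_]; last by rewrite mulmx0 mul0mx.
  by have [A ->] := Us _ Ss; rewrite -mulmxA Uc mulmx0.
case/eqP: U0; apply: eq_on_cV => c; rewrite mul0mx.
have /X1P/(_ 1%g) : V *m c \in X1 by rewrite X1T memvf.
rewrite /Q -Tu !mulmxA -[_ *m T' *m T](mulmxA _ T') T'T mulmx1 rho1 mulmx1.
by rewrite -[U *m _ *m _]mulmxA row_unit mulmx1.
Qed.

(** If x e_B = 0 in Br, then x kills e_B S, which is the image of the base piece under the injective
    T. *)
Lemma top_admissible : admissible P rV.
Proof.
have [T' [T'T _]] := T_full; split=> // x ann u.
rewrite -[LHS]mul1mx -T'T -mulmxA; apply: etrans (congr1 (mulmx T') _) (mulmx0 _ _).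
rewrite mulmxA mulmx_sumr.
have -> : \sum_w T *m (x w *: ind_repr rV w) = S (br_of_KW P x) *m T.
  rewrite br_act_sum mulmx_suml; apply: eq_bigr => w _.
  by rewrite br_actZ -scalemxAr Tw scalemxAl.
by rewrite !mulmxA -(mulmxA _ T) Tu EZ mulmxA -br_actM ann br_act0 !mul0mx.
Qed.

Lemma top_module_exists : exists M : brModule P N, is_BV rV M /\ br_iso S M.
Proof.
have [T' [T'T TT']] := T_full.
pose M (x : Br P) := T' *m S x *m T.
have Mlin : linear M.
  by move=> a x y; rewrite /M br_actD br_actZ mulmxDr mulmxDl -scalemxAr -scalemxAl.
have M1 : M 1 = 1%:M by rewrite /M br_act1 mulmx1.
have MM x y : M (x * y) = M x *m M y.
  by rewrite /M br_actM !mulmxA -[_ *m T *m T'](mulmxA _ T) TT' mulmx1.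
exists (BrModule Mlin M1 MM); split; last first.
  apply/br_isoP; exists T', T; split=> // x.
  by rewrite /= /M -!mulmxA TT' mulmx1.
apply/(is_BVE K0); split=> [w|H B'] /=.
  by rewrite /M -mulmxA -Tw mulmxA T'T mul1mx.
have [E1 E2 E3] := T_rules H B'; rewrite /M -!mulmxA.
split=> [/E1->|/E2->|H' HB ntH].
- by rewrite -scalemxAr mulmxA T'T mul1mx.
- by rewrite mulmx0.
by rewrite (E3 _ HB ntH) mulmxA T'T mul1mx.
Qed.

End SimpleModules.

(** * Existence of the module (B | V) *)

Lemma involution_even (X : finType) (A : {set X}) (f : X -> X) :
  (forall x, x \in A -> [/\ f x \in A, f x != x & f (f x) = x]) -> ~~ odd #|A|.
Proof.
have [n] := ubnP #|A|; elim: n A => // n IHn A ltAn fA.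
have [->|[x xA]] := set_0Vmem A; first by rewrite cards0.
have [fxA fxx ffx] := fA x xA.
have fxA' : f x \in A :\ x by rewrite !inE fxx.
have E : #|A| = (#|A :\ x :\ f x|).+2.
  by rewrite (cardsD1 x A) xA (cardsD1 (f x) (A :\ x)) fxA'.
rewrite E /= negbK; apply: IHn; first by rewrite -ltnS (ltn_trans _ ltAn) // E.
move=> y; rewrite !inE => /and3P[yfx yx yA]; have [fyA fyy ffy] := fA y yA.
rewrite fyA fyy ffy andbT; split=> //; apply/andP; split.
  by apply: contraNneq yx => E2; rewrite -ffy E2 ffx.
by apply: contraNneq yfx => E2; rewrite -ffy E2.
Qed.

(* The level set {g = g p} carries the fixed-point free involution b, and
   would carry the fixed-point free involution t off p if g p <> g (t p). *)
Lemma parity_argument (X : finType) (V : eqType) (g : X -> V) (z : V)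
    (D : {set X}) (t b : X -> X) (p : X) :
  (forall x, x \in D -> [/\ t x \in D, t x != x & t (t x) = x]) ->
  (forall x, x \in D -> g x != z ->
    [/\ b x \in D, b x != x, b (b x) = x & g (b x) = g x]) ->
  (forall x, x \in D -> x != p -> x != t p -> g (t x) = g x) ->
  p \in D -> g p = g (t p).
Proof.
move=> tD bD gt; move: p gt.
(* The involution b is controlled only where g differs from z. If g p = z, the points p and t p are
   exchanged, unless g (t p) = z as well. *)
suff main p : (forall x, x \in D -> x != p -> x != t p -> g (t x) = g x) ->
    p \in D -> g p != z -> g p = g (t p).
  move=> p gt pD; have [tpD _ ttp] := tD p pD.
  have [gpz|gpz] := eqVneq (g p) z; last exact: main.
  have [gtpz|gtpz] := eqVneq (g (t p)) z; first by rewrite gpz gtpz.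
  apply/esym; rewrite -{2}ttp; apply: main => // x xD xtp; rewrite ttp => xp.
  exact: gt.
move=> gt pD gpz; apply/eqP/negPn/negP => neg.
have [tpD tpp ttp] := tD p pD.
pose A := [set x in D | g x == g p].
have evenA : ~~ odd #|A|.
  apply: (@involution_even _ A b) => x; rewrite !inE => /andP[xD /eqP gx].
  have [bxD bxx bbx gbx] := bD x xD (eq_ind_r (fun y => y != z) gpz gx).
  by rewrite bxD bxx bbx gbx gx eqxx.
have evenA' : ~~ odd #|A :\ p|.
  apply: (@involution_even _ (A :\ p) t) => x; rewrite !inE => /and3P[xp xD /eqP gx].
  have [txD txx ttx] := tD x xD.
  have xtp : x != t p by apply: contraNneq neg => E; rewrite -E gx.
  rewrite txD txx ttx gt // gx eqxx !andbT; split=> //.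
  by apply: contraNneq xtp => E; rewrite -E ttx.
by move: evenA; rewrite (cardsD1 p A) !inE pD eqxx /= evenA'.
Qed.

(** * Extension of partial linear maps to finitely many more vectors *)

Section LinearExtension.

Variables (K : fieldType) (A V : lmodType K).

(** The space A will be Br, for which no finite basis is at hand; partial linear maps are therefore
    graphs, enlarged one vector at a time. *)
Let linear_graph (G : A -> V -> Prop) :=
  [/\ G 0 0, forall u v g h, G u g -> G v h -> G (u + v) (g + h) &
      forall c u g, G u g -> G (c *: u) (c *: g)].

Let functional_graph (G : A -> V -> Prop) := forall g, G 0 g -> g = 0.

Let extend_graph (G : A -> V -> Prop) (bs : seq A) :
  linear_graph G -> functional_graph G ->
  exists G' : A -> V -> Prop, [/\ linear_graph G', functional_graph G',
    forall u g, G u g -> G' u g & forall b, b \in bs -> exists g, G' b g].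
Proof.
elim: bs G => [|b bs IHbs] G lG fG; first by exists G; split.
have [[g Gb]|nGb] := pselect (exists g, G b g).
  have [G' [lG' fG' sG' bG']] := IHbs G lG fG; exists G'; split=> // c; rewrite inE.
  by case/orP=> [/eqP->|/bG' //]; exists g; apply: sG'.
have [G0 GD GZ] := lG.
(* A vector b outside the domain is sent to 0. The graph stays functional, as u0 + c b = 0 with c <>
   0 would put b in the old domain. *)
pose G1 u g := exists c u0, u = u0 + c *: b /\ G u0 g.
have sG1 u g : G u g -> G1 u g by move=> Gu; exists 0, u; rewrite scale0r addr0.
have lG1 : linear_graph G1.
  split=> [|u v g h [c [u0 [-> Gu]]] [c' [v0 [-> Gv]]]|c u g [c' [u0 [-> Gu]]]].
  - exact: sG1.
  - by exists (c + c'), (u0 + v0); rewrite scalerDl addrACA; split; last exact: GD.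
  by exists (c * c'), (c *: u0); rewrite scalerDr scalerA; split; last exact: GZ.
have fG1 : functional_graph G1.
  move=> g [c [u0 [/esym/eqP]]]; rewrite addr_eq0 => /eqP Eu Gu.
  have [c0|c0] := eqVneq c 0; first by apply: fG; rewrite Eu c0 scale0r oppr0 in Gu.
  case: nGb; exists (- c^-1 *: g).
  by have := GZ (- c^-1) _ _ Gu; rewrite Eu scalerN scaleNr opprK scalerA mulVf // scale1r.
have [G' [lG' fG' sG' bG']] := IHbs G1 lG1 fG1; exists G'; split=> //.
  by move=> u g Gu; apply/sG'/sG1.
move=> c; rewrite inE => /orP[/eqP->|/bG' //]; exists 0; apply: sG'; exists 1, 0.
by rewrite scale1r add0r.
Qed.

Lemma linear_extension (I : Type) (J : finType) (a : I -> A) (b : J -> A) (G : I -> V) :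
  (forall (T : finType) (x : T -> K) (i : T -> I),
    \sum_t x t *: a (i t) = 0 -> \sum_t x t *: G (i t) = 0) ->
  exists F : J -> V, forall (T : finType) (x : T -> K) (i : T -> I)
      (T' : finType) (z : T' -> K) (j : T' -> J),
    \sum_t x t *: a (i t) + \sum_t z t *: b (j t) = 0 ->
    \sum_t x t *: G (i t) + \sum_t z t *: F (j t) = 0.
Proof.
move=> aG.
pose Gr u g := exists (T : finType) (x : T -> K) (i : T -> I),
  u = \sum_t x t *: a (i t) /\ g = \sum_t x t *: G (i t).
have lGr : linear_graph Gr.
  split=> [|u v g h [T [x [i [-> ->]]]] [T' [x' [i' [-> ->]]]]|c u g [T [x [i [-> ->]]]]].
  - by exists void, (fun=> 0), (@of_void I); split; rewrite big1 // => -[].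
  - exists (T + T')%type, (fun t => match t with inl t => x t | inr t => x' t end).
    exists (fun t => match t with inl t => i t | inr t => i' t end).
    by rewrite !big_sumType.
  exists T, (fun t => c * x t), i; rewrite !scaler_sumr.
  by split; apply: eq_bigr => t _; rewrite scalerA.
have fGr : functional_graph Gr by move=> g [T [x [i [/esym E ->]]]]; apply: aG.
have [G' [[G0 GD GZ] fG' sG' bG']] := extend_graph (map b (enum J)) lGr fGr.
have /choice[F FP] j : exists g, G' (b j) g.
  by apply: bG'; apply: map_f; rewrite mem_enum.
exists F => T x i T' z j E; apply: fG'; rewrite -E; apply: (GD _ _ _ _).
  apply: (big_ind2 G') => [|u g v h|t _]; [exact: G0|exact: GD|apply: (GZ _ _ _); apply: (sG' _ _)].
  by exists unit, (fun=> 1), (fun=> i t); rewrite !big_const card_unit /= !scale1r !addr0.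
by apply: (big_ind2 G') => [|u g v h|t _]; [exact: G0|exact: GD|exact: GZ].
Qed.

End LinearExtension.

Section Existence.

Variables (R : realType) (W : complexReflectionGroup R) (K : fieldType).
Variable P : brauerParams W K.
Hypothesis K0 : [pchar K] =i pred0.
Variables (B : {set hyp W}) (d : nat) (rV : mx_representation K (Stab B) d).
Hypotheses (tB : transverse_collection B) (admV : admissible P rV).
Local Notation N := (ind_dim (Stab B) d).
Local Notation rho := (ind_repr rV).
Local Notation gp := (gproj rV).
Local Notation op := (mx_between P rho).
Local Notation eB := (br_eB P B).
Local Notation be := (br_e P).
Local Notation bw := (br_w P).
Implicit Types (H L : hyp W) (C : {set hyp W}) (u w s : W) (v : 'cV[K]_N).

Lemma ann_gproj (x : W -> K) :
  (\sum_w x w *: bw w) * eB = 0 -> (\sum_w x w *: rho w) *m gp B = 0.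
Proof.
have [_ annV] := admV => Ex; rewrite (gproj_base K0) mulmxA; apply: eq_on_cV => v.
have := annV [ffun w => x w]; rewrite /in_Ann_eB /br_of_KW.
have -> : \sum_w [ffun w => x w] w *: bw w = \sum_w x w *: bw w.
  by apply: eq_bigr => w _; rewrite ffunE.
move=> /(_ Ex (ind_row rV 1%g *m v)).
have -> : \sum_w [ffun w => x w] w *: rho w = \sum_w x w *: rho w.
  by apply: eq_bigr => w _; rewrite ffunE.
by rewrite mul0mx !mulmxA.
Qed.

Lemma ann_gproj_fam (T : finType) (x : T -> K) (i : T -> W) :
  \sum_t x t *: (bw (i t) * eB) = 0 -> \sum_t x t *: (rho (i t) *m gp B) = 0.
Proof.
pose y w := \sum_(t | i t == w) x t.
have E (V : lmodType K) (F : W -> V) : \sum_t x t *: F (i t) = \sum_w y w *: F w.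
  rewrite (partition_big i predT) //=; apply: eq_bigr => w _.
  by rewrite scaler_suml; apply: eq_bigr => t /eqP ->.
rewrite (E _ (fun w => bw w * eB)) (E _ (fun w => rho w *m gp B)) => E0.
have := @ann_gproj y; rewrite mulr_suml mulmx_suml.
rewrite (eq_bigr (fun w => y w *: (bw w * eB))) => [/(_ E0)|w _]; last by rewrite scalerAl.
by move=> E1; rewrite -[RHS]E1; apply: eq_bigr => w _; rewrite scalemxAl.
Qed.

Lemma op_conj u L H : rho u *m op L H = op (hyp_act u L) (hyp_act u H) *m rho u.
Proof.
have conjE s : (s ^ u^-1)%g = (u * s * u^-1)%g by rewrite conjgE invgK mulgA.
have inR s : s \in refl_between L H ->
    (s ^ u^-1)%g \in refl_between (hyp_act u L) (hyp_act u H).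
  rewrite !inE => /andP[sR /eqP sL]; rewrite conjE !hyp_actM hyp_actK sL eqxx andbT.
  by have := @fixed_space_reflJ _ _ u s; rewrite !inE; apply.
have inRV s : (s ^ u^-1)%g \in refl_between (hyp_act u L) (hyp_act u H) ->
    s \in refl_between L H.
  rewrite !inE conjE => /andP[sR /eqP].
  rewrite !hyp_actM hyp_actK => /hyp_act_inj ->; rewrite eqxx andbT.
  have := @fixed_space_reflJ _ _ u^-1%g (u * s * u^-1)%g.
  by rewrite !inE => /(_ sR); rewrite !mulgA mulVg mul1g invgK mulgKV.
have PE s : (s \in refl_between L H) =
    ((s ^ u^-1)%g \in refl_between (hyp_act u L) (hyp_act u H)).
  by apply/idP/idP => [/inR|/inRV].
rewrite mulmx_sumr mulmx_suml [RHS](reindex_inj (@conjg_inj W u^-1%g)) /=.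
rewrite (eq_bigl _ _ PE); apply: eq_bigr => s; rewrite -PE inE => /andP[sR _].
by rewrite mu_conj // -scalemxAr -scalemxAl -!rhoM conjE mulgKV.
Qed.

Lemma gproj_conj u C : gp (hset_act u C) = rho u *m gp C *m rho u^-1%g.
Proof. by rewrite (rho_gproj K0) -mulmxA rhoK mulmx1. Qed.

(** For C = B, both operators times e_B equal e_H e_B by (B5), so their difference annihilates e_B
    and admissibility applies. Translation gives the other C in the orbit. *)
Lemma op_gproj_indep C H L1 L2 : L1 \in C -> L2 \in C ->
  nontransverse H L1 -> nontransverse H L2 -> op L1 H *m gp C = op L2 H *m gp C.
Proof.
have [/orbit_ofP[u ->]|nC] := boolP (C \in orbit_of B); last first.
  by rewrite gproj_orbit // !mulmx0.
have base H' M1 M2 : M1 \in B -> M2 \in B -> nontransverse H' M1 ->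
    nontransverse H' M2 -> op M1 H' *m gp B = op M2 H' *m gp B.
  move=> M1B M2B nt1 nt2; apply/eqP; rewrite -subr_eq0 -mulmxBl; apply/eqP.
  pose x w := (w \in refl_between M1 H')%:R * mu P w - (w \in refl_between M2 H')%:R * mu P w.
  have Ex (V : lmodType K) (F : W -> V) : \sum_w x w *: F w =
      \sum_(w in refl_between M1 H') mu P w *: F w -
      \sum_(w in refl_between M2 H') mu P w *: F w.
    rewrite !(big_mkcond (fun w => w \in refl_between _ _)) -sumrB /=.
    apply: eq_bigr => w _; rewrite scalerBl -!scalerA.
    by do 2!case: (w \in _); rewrite ?scale1r ?scale0r.
  rewrite -(Ex _ (fun w => rho w)); apply: ann_gproj; rewrite (Ex _ bw) mulrBl.
  rewrite -!/(br_between P _ _) -(br_e_eB_nontransverse P tB M1B nt1).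
  by rewrite -(br_e_eB_nontransverse P tB M2B nt2) subrr.
move=> L1C L2C nt1 nt2; rewrite gproj_conj !mulmxA; congr (_ *m _).
have E L : op L H *m rho u = rho u *m op (hyp_act u^-1%g L) (hyp_act u^-1%g H).
  by rewrite op_conj !hyp_actVK.
rewrite !E -!mulmxA; congr (_ *m _).
have LB1 : hyp_act u^-1%g L1 \in B by rewrite -mem_hset_actV; exact: L1C.
have LB2 : hyp_act u^-1%g L2 \in B by rewrite -mem_hset_actV; exact: L2C.
have n1 : nontransverse (hyp_act u^-1%g H) (hyp_act u^-1%g L1).
  by rewrite nontransverse_act; exact: nt1.
have n2 : nontransverse (hyp_act u^-1%g H) (hyp_act u^-1%g L2).
  by rewrite nontransverse_act; exact: nt2.
exact: (base _ _ _ LB1 LB2 n1 n2).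
Qed.

Lemma fixed_gproj C H w : H \in C -> (ssval H <= fixed_space w)%VS ->
  rho w *m gp C = gp C.
Proof.
have [/orbit_ofP[u ->]|nC] := boolP (C \in orbit_of B); last first.
  by rewrite gproj_orbit // !mulmx0.
move=> HC Hw.
have base H' w' : H' \in B -> (ssval H' <= fixed_space w')%VS -> rho w' *m gp B = gp B.
  move=> HB' Hw'.
  have := @ann_gproj_fam bool (fun b => if b then 1 else - 1) (fun b => if b then w' else 1%g).
  rewrite !big_bool /= !scale1r !scaleN1r br_w1 mul1r (br_fixed_eB P tB HB' Hw') subrr.
  by move=> /(_ erefl); rewrite -![ind_mx _ _]/(rho _) rho1 mul1mx => /eqP; rewrite subr_eq0 => /eqP.
rewrite gproj_conj !mulmxA -rhoM; congr (_ *m _).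
have -> : (w * u = u * (w ^ u))%g by rewrite conjgE !mulgA mulgV mul1g.
have HB' : hyp_act u^-1%g H \in B by rewrite -mem_hset_actV HC.
have Hw' : (ssval (hyp_act u^-1%g H) <= fixed_space (w ^ u)%g)%VS.
  apply/subvP => x; rewrite mem_hyp_act invgK => /(subvP Hw).
  by rewrite !mem_fixed conjgE !act_mulE => /eqP ->; rewrite act_invK.
by rewrite rhoM -mulmxA (base _ _ HB' Hw').
Qed.

(** The choice of L is arbitrary; by [op_gproj_indep] any other gives the same operator on V^C. *)
Definition BV_coef H C : 'M[K]_N :=
  if H \in C then (delta P)%:M
  else if [pick L in C | nontransverse H L] is Some L then op L H else 0.

Definition BV_e H : 'M[K]_N := \sum_C BV_coef H C *m gp C.

Lemma BV_e_gproj H C : BV_e H *m gp C = BV_coef H C *m gp C.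
Proof.
rewrite mulmx_suml (bigD1 C) //= -mulmxA (gproj_id K0) big1 ?addr0 // => C' neC.
by rewrite -mulmxA (gprojM K0) (negPf neC) scale0r mulmx0.
Qed.

Lemma BV_e_rules : BV_rules rV P BV_e.
Proof.
move=> H C; rewrite BV_e_gproj /BV_coef.
have [CO|nC] := boolP (C \in orbit_of B); last first.
  by rewrite gproj_orbit //; split=> *; rewrite !mulmx0 ?scaler0.
have tC := orbit_transverse tB CO.
split=> [->|tH|L LC ntH]; first by rewrite mul_scalar_mx.
  rewrite (negPf (transverse_to_notin tH)); case: pickP => [L|]; last by rewrite mul0mx.
  case/andP=> LC /andP[_ /negP[]]; by move/forall_inP: tH; apply.
have HC : H \notin C.
  case/andP: ntH => HL; apply: contra => HC; exact: transverse_collectionP tC HC LC HL.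
rewrite (negPf HC); case: pickP => [L' /andP[LC' ntH']|/(_ L)]; last by rewrite LC ntH.
exact: op_gproj_indep.
Qed.

Lemma eq_on_gproj m (X Y : 'M[K]_(m, N)) :
  (forall C, C \in orbit_of B -> X *m gp C = Y *m gp C) -> X = Y.
Proof.
move=> XY; rewrite -[X]mulmx1 -[Y]mulmx1 -(gproj_sum K0 rV) !mulmx_sumr.
apply: eq_bigr => C _; have [/XY//|nC] := boolP (C \in orbit_of B).
by rewrite gproj_orbit // !mulmx0.
Qed.

Section Rules.

Variable E : hyp W -> 'M[K]_N.
Hypothesis BVE : BV_rules rV P E.

(** The vector e_H v lies in pieces whose index contains H, where e_H is the scalar delta.
    [BV_fixed] and [BV_nontransverse] rest on the same localisation. *)
Lemma BV_e_mul H : E H *m E H = delta P *: E H.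
Proof.
apply: eq_on_gproj => C CO; rewrite -mulmxA -scalemxAl.
have [E1 E2 E3] := BVE H C; case: (hyp_cases H C) => [HC|tH|[_ [L LC ntH]]].
- by rewrite (E1 HC) -scalemxAr (E1 HC).
- by rewrite (E2 tH) mulmx0 scaler0.
rewrite (E3 _ LC ntH) (mx_between_gproj K0) mulmx_sumr scaler_sumr.
apply: eq_bigr => s; rewrite inE => /andP[_ /eqP sL].
have [F1 _ _] := BVE H (hset_act s C).
have HsC : H \in hset_act s C by rewrite -sL mem_hset_act LC.
by rewrite -scalemxAr mulmxA (F1 HsC) -scalemxAl scalerA mulrC -scalerA.
Qed.

Lemma BV_we w H : rho w *m E H = E (hyp_act w H) *m rho w.
Proof.
apply: eq_on_gproj => C CO.
have [E1 E2 E3] := BVE H C.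
have [F1 F2 F3] := BVE (hyp_act w H) (hset_act w C).
transitivity (rho w *m (E H *m gp C)); first by rewrite mulmxA.
transitivity (E (hyp_act w H) *m gp (hset_act w C) *m rho w); last first.
  by rewrite -mulmxA -(rho_gproj K0) mulmxA.
case: (hyp_cases H C) => [HC|tH|[_ [L LC ntH]]].
- have HwC : hyp_act w H \in hset_act w C by rewrite mem_hset_act; exact: HC.
  by rewrite (E1 HC) (F1 HwC) -scalemxAr -scalemxAl (rho_gproj K0).
- have twH : transverse_to (hyp_act w H) (hset_act w C).
    by rewrite transverse_to_act; exact: tH.
  by rewrite (E2 tH) (F2 twH) mulmx0 mul0mx.
have LwC : hyp_act w L \in hset_act w C by rewrite mem_hset_act; exact: LC.
have ntw : nontransverse (hyp_act w H) (hyp_act w L).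
  by rewrite nontransverse_act; exact: ntH.
by rewrite (F3 _ LwC ntw) (E3 _ LC ntH) mulmxA op_conj -!mulmxA (rho_gproj K0).
Qed.

Lemma BV_fixed w H : (ssval H <= fixed_space w)%VS -> rho w *m E H = E H.
Proof.
move=> Hw; apply: eq_on_gproj => C CO; rewrite -mulmxA.
have [E1 E2 E3] := BVE H C; case: (hyp_cases H C) => [HC|tH|[_ [L LC ntH]]].
- by rewrite (E1 HC) -scalemxAr (fixed_gproj HC Hw).
- by rewrite (E2 tH) mulmx0.
rewrite (E3 _ LC ntH) (mx_between_gproj K0) mulmx_sumr; apply: eq_bigr => s.
rewrite inE => /andP[_ /eqP sL]; have HsC : H \in hset_act s C by rewrite -sL mem_hset_act LC.
by rewrite -scalemxAr mulmxA (fixed_gproj HsC Hw).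
Qed.

Lemma BV_nontransverse H1 H2 : nontransverse H1 H2 -> E H1 *m E H2 = op H2 H1 *m E H2.
Proof.
move=> nt12; apply: eq_on_gproj => C CO; rewrite -!mulmxA.
have [E1 E2 E3] := BVE H2 C; case: (hyp_cases H2 C) => [HC|tH|[_ [L LC ntH]]].
- have [_ _ F3] := BVE H1 C.
  by rewrite (E1 HC) -!scalemxAr (F3 _ HC nt12).
- by rewrite (E2 tH) !mulmx0.
rewrite (E3 _ LC ntH) (mx_between_gproj K0) !mulmx_sumr; apply: eq_bigr => s.
rewrite inE => /andP[_ /eqP sL]; rewrite -!scalemxAr !mulmxA.
have [_ _ F3] := BVE H1 (hset_act s C).
have H2C : H2 \in hset_act s C by rewrite -sL mem_hset_act LC.
by rewrite (F3 _ H2C nt12).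
Qed.

End Rules.

End Existence.

(** * Components of e_H v in the pieces V^C *)

Section Pieces.

Variables (R : realType) (W : complexReflectionGroup R) (K : fieldType).
Variable P : brauerParams W K.
Hypothesis K0 : [pchar K] =i pred0.
Variables (B : {set hyp W}) (d : nat) (rV : mx_representation K (Stab B) d).
Hypothesis tB : transverse_collection B.
Local Notation N := (ind_dim (Stab B) d).
Local Notation rho := (ind_repr rV).
Local Notation gp := (gproj rV).
Local Notation op := (mx_between P rho).
Variable E : hyp W -> 'M[K]_N.
Hypothesis BVE : BV_rules rV P E.
Implicit Types (H L : hyp W) (C : {set hyp W}) (u w s : W).

Definition refl_sum : 'M[K]_N := \sum_(s in reflections W) mu P s *: rho s.

Lemma gproj_rho_gproj C (B0 : {set hyp W}) w : hset_act w B0 != C -> gp C *m rho w *m gp B0 = 0.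
Proof.
move=> wB0; rewrite -mulmxA (rho_gproj K0) mulmxA (gprojM K0) eq_sym (negPf wB0).
by rewrite scale0r mul0mx.
Qed.

Lemma piece_between C (B0 : {set hyp W}) H L : L \in B0 -> nontransverse H L ->
  gp C *m E H *m gp B0 =
  \sum_(s in reflections W | hyp_act s L == H) mu P s *: (gp C *m rho s *m gp B0).
Proof.
move=> LB0 ntHL; have [_ _ E3] := BVE H B0.
rewrite -mulmxA (E3 _ LB0 ntHL) mulmxA mulmx_sumr mulmx_suml.
apply: eq_big => [s|s _]; first by rewrite inE.
by rewrite -scalemxAr -scalemxAl.
Qed.

(** Double count: every L in [nonT B0 H] gives an expansion of the same component. A reflection s
    with s B0 = C occurs for exactly one L, namely s^-1 H, and the other reflections have no
    component from the piece of B0 to that of C. *)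
Lemma piece_refl_sum (B0 : {set hyp W}) C H : H \in C -> H \notin B0 ->
  #|nonT B0 H|%:R *: (gp C *m E H *m gp B0) = gp C *m refl_sum *m gp B0.
Proof.
move=> HC HB0; pose f s := mu P s *: (gp C *m rho s *m gp B0).
have -> : gp C *m refl_sum *m gp B0 = \sum_(s in reflections W) f s.
  rewrite mulmx_sumr mulmx_suml; apply: eq_bigr => s _.
  by rewrite -scalemxAr -scalemxAl.
rewrite scaler_nat -sumr_const.
have E1 L : L \in nonT B0 H -> gp C *m E H *m gp B0 =
    \sum_(s in reflections W | hyp_act s L == H) f s.
  rewrite inE => /andP[LB0 ntLH]; apply: piece_between; first exact: LB0.
  by rewrite nontransverse_sym; exact: ntLH.
rewrite (eq_bigr _ E1) (exchange_big_dep (mem (reflections W))) /=; last first.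
  by move=> L s _ /andP[].
apply: eq_bigr => s sR.
have [sB0|sB0] := eqVneq (hset_act s B0) C; last first.
  by rewrite big1 /f ?gproj_rho_gproj ?scaler0.
pose L0 := hyp_act s^-1%g H.
have L0B0 : L0 \in B0 by rewrite -mem_hset_actV sB0; exact: HC.
have sL0 : hyp_act s L0 = H by rewrite hyp_actVK.
have L0N : L0 \in nonT B0 H.
  rewrite inE L0B0 nontransverse_sym -sL0; apply: (reflection_nontransverse sR).
  by rewrite sL0; apply: contraNneq HB0 => ->; exact: L0B0.
rewrite (big_pred1 L0) // => L; apply/idP/eqP => [/and3P[_ _ /eqP sL]|->].
  by rewrite /L0 -sL hyp_actK.
by rewrite sL0 L0N sR eqxx.
Qed.

(** The expansion of e_H v may start from any L in B0 non-transverse to H, so each such L is carried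
    to H by a reflection taking B0 to C. Elements of B0 transverse to H are fixed by such a
    reflection and stay in C, while those in C are transverse to H; so the removed elements are the
    non-transverse ones. *)
Lemma piece_moves (B0 : {set hyp W}) C H : B0 \in orbit_of B -> H \notin B0 ->
  gp C *m E H *m gp B0 != 0 -> moves B0 C H.
Proof.
move=> B0O HB0 nz.
have CO : C \in orbit_of B.
  by apply: contraNT nz => nC; rewrite (gproj_orbit K0) // !mul0mx.
have HC : H \in C.
  by apply: contraNT nz => nC; rewrite (gproj_e K0 BVE) // mul0mx.
have tB0 := orbit_transverse tB B0O; have tC := orbit_transverse tB CO.
have refl L : L \in nonT B0 H ->
    exists s, [/\ s \in reflections W, hyp_act s L = H & hset_act s B0 = C].
  rewrite inE => /andP[LB0 ntLH]; rewrite nontransverse_sym in ntLH.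
  have E1 := piece_between C LB0 ntLH.
  have [s] : exists s, (s \in reflections W) && (hyp_act s L == H)
      && (mu P s *: (gp C *m rho s *m gp B0) != 0).
    apply/existsP; apply: contraNT nz; rewrite negb_exists => /forallP n0.
    rewrite E1 big1 // => s sL; have := n0 s; rewrite sL /= negbK; exact: eqP.
  case/andP=> /andP[sR /eqP sL] nzs; exists s; split=> //.
  by apply: contraNeq nzs => sB0; rewrite gproj_rho_gproj // scaler0.
have N0 : nonT B0 H != set0.
  apply: contraNneq nz => N0; have [_ E2 _] := BVE H B0.
  by rewrite -mulmxA E2 ?mulmx0 // -nonT0 // N0.
have [L0 L0N] := set0Pn _ N0; have [s [sR sL0 sB0]] := refl _ L0N.
have L0B0 : L0 \in B0 by move: L0N; rewrite inE => /andP[].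
have sL0n : hyp_act s L0 != L0 by rewrite sL0; apply: contraNneq HB0 => ->.
have EN : nonT B0 H = B0 :\: C.
  apply/setP => L; apply/idP/idP.
    rewrite !inE => /andP[LB0 /andP[LH ntLH]]; rewrite LB0 andbT.
    apply: contra ntLH => LC; exact: transverse_collectionP tC LC HC LH.
  rewrite inE => /andP[LC LB0]; rewrite inE LB0 /=.
  have LH : L != H by apply: contraNneq HB0 => <-.
  rewrite /nontransverse LH /=; apply/negP => tLH.
  have [EL|LL0] := eqVneq L L0.
    by move: L0N; rewrite inE -EL => /andP[_ /andP[_ /negP[]]].
  have sL : hyp_act s L = L.
    apply: (reflection_fixes sR sL0n); last by rewrite sL0; exact: tLH.
    exact: transverse_collectionP tB0 LB0 L0B0 LL0.
  by move: LC; rewrite -sB0 -sL mem_hset_act LB0.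
by split=> // L; rewrite -EN; apply: refl.
Qed.

(** By [pieceE], the component in V^C of e_H on V^B, the same for all H in C outside B. For C = B
    the inverse of 0 is 0, and so is the piece. *)
Definition piece C : 'M[K]_N := #|B :\: C|%:R^-1 *: (gp C *m refl_sum *m gp B).

Lemma base_orbit : B \in orbit_of B.
Proof. by apply/orbit_ofP; exists 1%g; rewrite hset_act1. Qed.

Lemma pieceE C H : H \in C -> H \notin B -> gp C *m E H *m gp B = piece C.
Proof.
move=> HC HB; rewrite /piece -(piece_refl_sum HC HB) scalerA.
have [->|nz] := eqVneq (gp C *m E H *m gp B) 0; first by rewrite scaler0.
have [_ _ <- _] := piece_moves base_orbit HB nz.
rewrite mulVf ?scale1r // (natK_neq0 K0) // card_gt0.
apply: contraNneq nz => N0; have [_ E2 _] := BVE H B.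
by rewrite -mulmxA E2 ?mulmx0 // -nonT0 // N0.
Qed.

Lemma piece_orbit C : piece C != 0 -> C \in orbit_of B.
Proof. by apply: contraNT => nC; rewrite /piece gproj_orbit // !mul0mx scaler0. Qed.

Lemma gproj_piece C : gp C *m piece C = piece C.
Proof. by rewrite /piece -scalemxAr !mulmxA gproj_id. Qed.

Lemma piece_sum H : H \notin B -> E H *m gp B = \sum_(C : {set hyp W} | H \in C) piece C.
Proof.
move=> HB; rewrite -[E H]mul1mx -(gproj_sum K0 rV) !mulmx_suml [RHS]big_mkcond.
apply: eq_bigr => C _ /=; case: ifPn => HC; first exact: pieceE.
by rewrite (gproj_e K0 BVE HC) mul0mx.
Qed.

Lemma moves_piece C H : piece C != 0 -> H \in C -> H \notin B -> moves B C H.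
Proof.
move=> nz HC HB; apply: (piece_moves base_orbit HB); by rewrite pieceE.
Qed.

Lemma e_piece_in C H : H \in C -> E H *m piece C = delta P *: piece C.
Proof.
move=> HC; have [E1 _ _] := BVE H C.
by rewrite -gproj_piece mulmxA (E1 HC) scalemxAl.
Qed.

Lemma e_piece_transverse C H : transverse_to H C -> E H *m piece C = 0.
Proof.
move=> tH; have [_ E2 _] := BVE H C.
by rewrite -gproj_piece mulmxA (E2 tH) mul0mx.
Qed.

Lemma moves_card C H : C \in orbit_of B -> moves B C H -> (0 < #|B :\: C|)%N.
Proof.
move=> CO [HC HB _ _]; have EC := orbit_card CO.
rewrite card_gt0; apply: contra HB; rewrite setD_eq0 => sBC.
by have /eqP <- : C == B by rewrite eq_sym eqEcard sBC EC leqnn.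
Qed.

(** As H1 is transverse to H2, it is never removed: it lies in every C reached by e_{H2}, and e_{H1}
    is the scalar delta throughout. *)
Lemma e_comm_in H1 H2 : transverse H1 H2 -> H1 \in B -> H2 \notin B ->
  E H1 *m (E H2 *m gp B) = E H2 *m (E H1 *m gp B).
Proof.
move=> t12 H1B H2B; have [E1 _ _] := BVE H1 B.
rewrite (E1 H1B) -scalemxAr piece_sum // mulmx_sumr scaler_sumr.
apply: eq_bigr => C H2C; have [->|nz] := eqVneq (piece C) 0.
  by rewrite mulmx0 scaler0.
apply: e_piece_in; have [_ _ EN _] := moves_piece nz H2C H2B.
apply: contraT => H1C.
have : H1 \in nonT B H2 by rewrite EN inE H1C.
by rewrite inE => /andP[_ /andP[_ /negP[]]].
Qed.

(** A reflection leading from B to C moves some L of B to H2. It fixes H1, which is transverse to L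
    and H2, so H1 is transverse to C. *)
Lemma e_transverse_base H1 H2 : transverse H1 H2 -> H2 \notin B ->
  transverse_to H1 B -> E H1 *m (E H2 *m gp B) = 0.
Proof.
move=> t12 H2B t1; rewrite piece_sum // mulmx_sumr big1 // => C H2C.
have [->|nz] := eqVneq (piece C) 0; first by rewrite mulmx0.
apply: e_piece_transverse; have mC := moves_piece nz H2C H2B.
have /card_gt0P[L LN] := moves_card (piece_orbit nz) mC.
have [_ _ _ /(_ L LN)[s [sR sL sB]]] := mC.
have LB : L \in B by move: LN; rewrite inE => /andP[].
have sLn : hyp_act s L != L by rewrite sL; apply: contraNneq H2B => ->.
have sH1 : hyp_act s H1 = H1.
  apply: (reflection_fixes sR sLn); last by rewrite sL; exact: t12.
  exact: (transverse_toP _ _ t1).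
by rewrite -sB -sH1 transverse_to_act; exact: t1.
Qed.

End Pieces.

(** * Operators f_H that respect the linear relations of Br *)

Section ExtendedE.

Variables (R : realType) (W : complexReflectionGroup R) (K : fieldType).
Variable P : brauerParams W K.
Hypothesis K0 : [pchar K] =i pred0.
Variables (B : {set hyp W}) (d : nat) (rV : mx_representation K (Stab B) d).
Hypotheses (tB : transverse_collection B) (admV : admissible P rV).
Local Notation N := (ind_dim (Stab B) d).
Local Notation rho := (ind_repr rV).
Local Notation gp := (gproj rV).
Local Notation op := (mx_between P rho).
Local Notation eB := (br_eB P B).
Local Notation be := (br_e P).
Local Notation bw := (br_w P).
Implicit Types (H L : hyp W) (C : {set hyp W}) (u w s : W).

Lemma rho_stab_gproj n : n \in Stab B -> rho n *m gp B = gp B *m rho n.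
Proof. by rewrite mem_Stab => /eqP nB; rewrite (rho_gproj K0) nB. Qed.

Lemma eB_stab n : n \in Stab B -> eB * bw n = bw n * eB.
Proof. by rewrite mem_Stab => /eqP nB; rewrite (br_w_eB P n tB) nB. Qed.

(** [Et H] is f_H. Only relations with at most one generator e_H in front of w e_B are transported;
    products of two operators [Et] are left unconstrained. *)
Definition respects_relations (Et : hyp W -> 'M[K]_N) :=
  forall (T : finType) (x : T -> K) (w : T -> W)
    (T' : finType) (z : T' -> K) (H : T' -> hyp W) (u : T' -> W),
  \sum_t x t *: (bw (w t) * eB) + \sum_t z t *: (be (H t) * (bw (u t) * eB)) = 0 ->
  \sum_t x t *: (rho (w t) *m gp B) +
    \sum_t z t *: (Et (H t) *m (rho (u t) *m gp B)) = 0.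

(* A linear extension need not commute with the right action of Stab B, hence
   the average over Stab B. *)
Lemma extended_e_exists : exists Et, respects_relations Et.
Proof.
have [F FP] := @linear_extension K (Br P) 'M[K]_N W (hyp W * W)%type
  (fun w => bw w * eB) (fun p => be p.1 * (bw p.2 * eB))
  (fun w => rho w *m gp B) (ann_gproj_fam K0 admV).
pose S := Stab B; have S0 : #|S|%:R != 0 :> K by rewrite (natK_neq0 K0) ?cardG_gt0.
exists (fun H => #|S|%:R^-1 *: \sum_w F (H, w) *m gp B *m rho w^-1%g).
have EtE H u : #|S|%:R^-1 *: (\sum_w F (H, w) *m gp B *m rho w^-1%g) *m (rho u *m gp B) =
    #|S|%:R^-1 *: \sum_(n in S) F (H, u * n^-1)%g *m gp B *m rho n.
  rewrite -scalemxAl mulmx_suml; congr (_ *: _).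
  rewrite (reindex (fun n => u * n^-1)%g); last first.
    exists (fun w => w^-1 * u)%g => w _; first by rewrite invMg invgK mulgKV.
    by rewrite invMg invgK mulKVg.
  rewrite [RHS]big_mkcond; apply: eq_bigr => n _.
  rewrite invMg invgK rhoM -!mulmxA.
  have -> : rho n *m (rho u^-1%g *m (rho u *m gp B)) = rho n *m gp B.
    by rewrite (mulmxA _ _ (gp B)) rhoVK mul1mx.
  case: ifPn => nS; first by rewrite (rho_stab_gproj nS) [gp B *m (gp B *m _)]mulmxA gproj_id.
  by rewrite mulmxA -(mulmxA (F _)) (mulmxA (gp B)) gproj_rho_gproj ?mulmx0 // -mem_Stab.
move=> T x w T' z H u rel.
have S1 (X : 'M[K]_N) : X *m gp B = #|S|%:R^-1 *: \sum_(n in S) X *m rho n^-1%g *m gp B *m rho n.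
  rewrite (eq_bigr (fun=> X *m gp B)) => [|n nS].
    by rewrite sumr_const -scaler_nat scalerA mulVf // scale1r.
  by rewrite -!mulmxA -(rho_stab_gproj nS) (mulmxA (rho n^-1%g)) rhoVK mul1mx.
under eq_bigr do rewrite S1 scalerA mulrC -scalerA.
under [X in _ + X]eq_bigr do rewrite EtE scalerA mulrC -scalerA.
rewrite -!scaler_sumr -scalerDr -[RHS](scaler0 _ (#|S|%:R^-1)); congr (_ *: _).
under eq_bigr do rewrite scaler_sumr.
under [X in _ + X]eq_bigr do rewrite scaler_sumr.
rewrite exchange_big [X in _ + X]exchange_big -big_split big1 // => n nS.
have nVS : n^-1%g \in S by rewrite groupV.
(* Right multiplication by n^-1 keeps the relation, as e_B commutes with Stab(B); so [FP] controls
   each term of the average. *)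
have E0 : \sum_t x t *: (bw (w t * n^-1)%g * eB) +
    \sum_t z t *: (be (H t) * (bw (u t * n^-1)%g * eB)) = 0.
  rewrite -[RHS](mul0r (bw n^-1%g)) -[X in _ = X * _]rel mulrDl !mulr_suml.
  congr +%R; apply: eq_bigr => t _; rewrite -scalerAl -!mulrA (eB_stab nVS) br_wM.
    by rewrite !mulrA.
  by rewrite !mulrA.
have E1 := FP T x (fun t => w t * n^-1)%g T' z (fun t => (H t, u t * n^-1)%g) E0.
rewrite -[RHS](mul0mx _ (gp B *m rho n)) -[X in _ = X *m _]E1.
rewrite mulmxDl !mulmx_suml; congr +%R; apply: eq_bigr => t _.
  rewrite -scalemxAl -rhoM !mulmxA.
  by rewrite -(mulmxA _ (gp B) (gp B)) gproj_id.
by rewrite -scalemxAl !mulmxA.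
Qed.

End ExtendedE.

Section ExtendedRules.

Variables (R : realType) (W : complexReflectionGroup R) (K : fieldType).
Variable P : brauerParams W K.
Hypothesis K0 : [pchar K] =i pred0.
Variables (B : {set hyp W}) (d : nat) (rV : mx_representation K (Stab B) d).
Hypothesis tB : transverse_collection B.
Local Notation N := (ind_dim (Stab B) d).
Local Notation rho := (ind_repr rV).
Local Notation gp := (gproj rV).
Local Notation op := (mx_between P rho).
Local Notation eB := (br_eB P B).
Local Notation be := (br_e P).
Local Notation bw := (br_w P).
Implicit Types (H L : hyp W) (C : {set hyp W}) (u w s : W).
Variable E : hyp W -> 'M[K]_N.
Hypothesis BVE : BV_rules rV P E.
Variable Et : hyp W -> 'M[K]_N.
Hypothesis EtP : respects_relations P rV Et.

Lemma sum_in_scale (V : lmodType K) (A : {set W}) (x : W -> K) (F : W -> V) :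
  \sum_s ((s \in A)%:R * x s) *: F s = \sum_(s in A) x s *: F s.
Proof.
rewrite [RHS]big_mkcond; apply: eq_bigr => s _.
by case: (s \in A); rewrite ?mul1r // mul0r scale0r.
Qed.

Lemma ext_e_rel H u (A : {set W}) (x : W -> K) (w : W -> W) :
  be H * (bw u * eB) = \sum_(s in A) x s *: (bw (w s) * eB) ->
  Et H *m (rho u *m gp B) = \sum_(s in A) x s *: (rho (w s) *m gp B).
Proof.
rewrite -2!sum_in_scale => rel.
have := EtP (x := fun s => (s \in A)%:R * x s) (w := w) (z := fun _ : unit => - 1)
  (H := fun=> H) (u := fun=> u).
rewrite !big_const card_unit /= !addr0 !scaleN1r -rel subrr => /(_ erefl) /eqP.
by rewrite subr_eq0 => /eqP.
Qed.

(** Unless H is transverse to uB, (B1) or (B5) already writes e_H u e_B inside KW e_B, by the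
    formula of the rule for e_H; the value of f_H is thus forced. *)
Lemma ext_e_gproj H C : C \in orbit_of B -> ~~ transverse_to H C ->
  Et H *m gp C = E H *m gp C.
Proof.
case/orbit_ofP=> u -> ntH.
suff E1 : Et H *m (rho u *m gp B) = E H *m (rho u *m gp B).
  by rewrite (gproj_conj K0) mulmxA E1 -mulmxA.
have E2 : E H *m (rho u *m gp B) = E H *m gp (hset_act u B) *m rho u.
  by rewrite (rho_gproj K0) mulmxA.
rewrite E2 {E2}.
have [E1 _ E3] := BVE H (hset_act u B).
have eBu : bw u * eB = br_eB P (hset_act u B) * bw u by rewrite (br_w_eB P u tB).
have tuB : transverse_collection (hset_act u B) by rewrite transverse_collection_act.
case: (hyp_cases H (hset_act u B)) => [HC|tH|[_ [L LC ntHL]]].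
- rewrite (E1 HC) -scalemxAl -(rho_gproj K0).
  have := @ext_e_rel H u [set 1%g] (fun=> delta P) (fun=> u); rewrite !big_set1; apply.
  by rewrite eBu mulrA (br_e_eB_in P tuB HC) scalerAl.
- by case/negP: ntH; exact: tH.
rewrite (E3 _ LC ntHL) -mulmxA -(rho_gproj K0) mulmx_suml.
rewrite (@ext_e_rel H u (refl_between L H) (mu P) (fun s => s * u)%g).
  by apply: eq_bigr => s _; rewrite -scalemxAl rhoM mulmxA.
rewrite eBu mulrA (br_e_eB_nontransverse P tuB LC ntHL) -mulrA -eBu.
by rewrite /br_between mulr_suml; apply: eq_bigr => s _; rewrite -scalerAl br_wM mulrA.
Qed.

Lemma e_base H L : L \in B -> nontransverse H L ->
  E H *m gp B = \sum_(s in refl_between L H) mu P s *: (rho s *m gp B).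
Proof.
move=> LB ntHL; have [_ _ E3] := BVE H B.
by rewrite (E3 _ LB ntHL) mulmx_suml; apply: eq_bigr => s _; rewrite -scalemxAl.
Qed.

Lemma br_e_base H L : L \in B -> nontransverse H L ->
  be H * eB = \sum_(s in refl_between L H) mu P s *: (bw s * eB).
Proof.
move=> LB ntHL; rewrite (br_e_eB_nontransverse P tB LB ntHL) mulr_suml.
by apply: eq_bigr => s _; rewrite -scalerAl.
Qed.

(** By (B5) each e_{Hi} e_B is a combination of elements s e_B, so (B4) times e_B becomes a linear
    relation between elements e_{H1} s e_B and e_{H2} s e_B, which [Et] respects. *)
Lemma ext_e_comm H1 H2 : transverse H1 H2 -> nonT B H1 != set0 -> nonT B H2 != set0 ->
  Et H1 *m (E H2 *m gp B) = Et H2 *m (E H1 *m gp B).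
Proof.
move=> t12 /set0Pn[L1]; rewrite inE nontransverse_sym => /andP[L1B nt1].
case/set0Pn=> L2; rewrite inE nontransverse_sym => /andP[L2B nt2].
rewrite (e_base L1B nt1) (e_base L2B nt2).
have := br_eC P t12; move=> /(congr1 (fun y => y * eB)).
rewrite -!mulrA (br_e_base L1B nt1) (br_e_base L2B nt2) !mulr_sumr !mulmx_sumr.
set A1 := refl_between L1 H1; set A2 := refl_between L2 H2 => rel.
(* No term w e_B occurs alone, so the first family is empty; the sum type joins the two sides of
   (B4). *)
have := @EtP void (fun=> 0) (@of_void W) (W + W)%type
  (fun p => match p with inl s => (s \in A2)%:R * mu P s | inr s => - ((s \in A1)%:R * mu P s) end)
  (fun p => match p with inl _ => H1 | inr _ => H2 end)
  (fun p => match p with inl s => s | inr s => s end).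
rewrite !big_sumType /= !(big1 _ (I := void)); try by case.
rewrite !add0r.
under [X in _ + X]eq_bigr do rewrite scaleNr.
under [X in _ -> _ + X = _]eq_bigr do rewrite scaleNr.
rewrite !sumrN !sum_in_scale => E0; apply/eqP; rewrite -subr_eq0; apply/eqP.
under eq_bigr do rewrite -scalemxAr.
under [X in _ - X]eq_bigr do rewrite -scalemxAr.
apply: E0.
move/eqP: rel; rewrite -subr_eq0 => /eqP rel; rewrite -[RHS]rel.
by congr (_ - _); apply: eq_bigr => s _; rewrite scalerAr.
Qed.

End ExtendedRules.

(** * Relation (B4) through a parity count of defects *)

Section Commutation.

Variables (R : realType) (W : complexReflectionGroup R) (K : fieldType).
Variable P : brauerParams W K.
Hypothesis K0 : [pchar K] =i pred0.
Variables (B : {set hyp W}) (d : nat) (rV : mx_representation K (Stab B) d).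
Hypothesis tB : transverse_collection B.
Local Notation N := (ind_dim (Stab B) d).
Local Notation gp := (gproj rV).
Variable E : hyp W -> 'M[K]_N.
Hypothesis BVE : BV_rules rV P E.
Variable Et : hyp W -> 'M[K]_N.
Hypothesis EtP : respects_relations P rV Et.
Local Notation piece := (piece P rV).
Implicit Types (a c H L M : hyp W) (C : {set hyp W}).

(* Et a and E a differ only on the pieces V^C with C transverse to a, which E a
   kills. *)
Definition defect a c : 'M[K]_N := (Et a - E a) *m (E c *m gp B).

(** The pieces that e_c reaches from V^B and on which f_a and e_a may differ. *)
Definition troubled a c C := [&& c \in C, transverse_to a C & piece C != 0].

Lemma defect_sum a c : c \notin B ->
  defect a c = \sum_(C : {set hyp W} | troubled a c C) Et a *m piece C.
Proof.
move=> cB; rewrite /defect (piece_sum K0 tB BVE cB) mulmx_sumr.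
rewrite [RHS]big_mkcond [LHS]big_mkcond; apply: eq_bigr => C _ /=.
rewrite /troubled; case: (c \in C) => //=.
have [->|nz] := eqVneq (piece C) 0; first by rewrite mulmx0 andbF.
have CO := piece_orbit K0 nz; rewrite mulmxBl andbT.
case: ifPn => tC; first by rewrite (e_piece_transverse K0 BVE tC) subr0.
apply/eqP; rewrite subr_eq0 -(gproj_piece P K0) !mulmxA.
by rewrite (ext_e_gproj K0 tB BVE EtP CO tC).
Qed.

Lemma defect_neq0 a c : c \notin B -> defect a c != 0 -> exists C, troubled a c C.
Proof.
move=> cB nz; apply/existsP; apply: contraNT nz; rewrite negb_exists => /forallP n0.
by rewrite defect_sum // big1 // => C tC; case/negP: (n0 C).
Qed.

Lemma troubled_moves a c C : c \notin B -> troubled a c C -> moves B C c.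
Proof. by move=> cB /and3P[cC _ nz]; apply: (moves_piece K0 tB BVE nz cC cB). Qed.

Lemma troubled_nonT a c C : transverse a c -> c \notin B -> nonT B a != set0 ->
  troubled a c C -> nonT B a = B :\: C /\ (#|B :\: C| <= 2)%N.
Proof.
move=> tac cB Na tr; have mC := troubled_moves cB tr; case/and3P: tr => cC tC nz.
by split; [apply: trouble_nonT tB mC tac tC Na | apply: trouble_card tB mC tC Na].
Qed.

Lemma troubled_unique a c C C' : transverse a c -> c \notin B ->
  #|nonT B a| = 2%N -> troubled a c C -> troubled a c C' -> C = C'.
Proof.
move=> tac cB N2 tr tr'; have Na : nonT B a != set0 by rewrite -card_gt0 N2.
have [EN _] := troubled_nonT tac cB Na tr; have [EN' _] := troubled_nonT tac cB Na tr'.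
have mC := troubled_moves cB tr; have mC' := troubled_moves cB tr'.
case/and3P: tr => _ tC nz; case/and3P: tr' => _ tC' nz'.
have tCc := orbit_transverse tB (piece_orbit K0 nz).
have tCc' := orbit_transverse tB (piece_orbit K0 nz').
apply: (trouble_unique tB tCc tCc' mC mC' _ _ tac tC tC' Na).
  by rewrite -EN -EN'.
by rewrite -EN.
Qed.

Lemma defect_troubled a c C : transverse a c -> c \notin B ->
  #|nonT B a| = 2%N -> troubled a c C -> defect a c = Et a *m piece C.
Proof.
move=> tac cB N2 tr; rewrite defect_sum // (bigD1 C) //= big1 ?addr0 // => C' /andP[tr'].
by case/eqP; apply: (troubled_unique tac cB N2 tr' tr).
Qed.

Lemma defect_comm a c : transverse a c -> nonT B a != set0 -> nonT B c != set0 ->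
  E a *m (E c *m gp B) + defect a c = E c *m (E a *m gp B) + defect c a.
Proof.
move=> tac Na Nc; rewrite /defect !mulmxBl addrC subrK [RHS]addrC subrK.
exact: (ext_e_comm tB BVE EtP tac Na Nc).
Qed.

Section Block.

Variable S : {set hyp W}.
Hypothesis S0 : S != set0.
Local Notation swapped a c := (B :\: S :|: [set a; c]).

(** The pairs to be counted. An index at which e_a e_c v has a component contains [swapped a c], of
    cardinality |B| + 2 - |S|: it equals it when |S| = 2, and cannot exist when |S| < 2. *)
Definition linked a c := [&& nonT B a == S, nonT B c == S & transverse a c].

Lemma linkedC a c : linked a c -> linked c a.
Proof.
case/and3P=> Na Nc tac; apply/and3P; split; [exact: Nc|exact: Na|].
by rewrite transverse_sym; exact: tac.
Qed.

Lemma linked_notin a c : linked a c -> a \notin B /\ c \notin B.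
Proof.
by case/and3P=> /eqP Na /eqP Nc _; split; apply: (nonT_notin tB); rewrite ?Na ?Nc.
Qed.

Lemma sub_nonT : (exists a, nonT B a = S) -> S \subset B.
Proof. by case=> a <-; apply/subsetP => L; rewrite inE => /andP[]. Qed.

Lemma card_swapped a c : linked a c -> (#|swapped a c| + #|S|)%N = (#|B| + 2)%N.
Proof.
move=> lac; have [aB cB] := linked_notin lac; have /and3P[/eqP Na _ tac] := lac.
have sB : S \subset B by apply: sub_nonT; exists a.
rewrite cardsU cards2 transverse_neq // cardsD (setIidPr sB).
have -> : (B :\: S) :&: [set a; c] = set0.
  apply/setP => L; rewrite !inE; apply/negP => /andP[/andP[_ LB]].
  by case/orP=> /eqP EL; rewrite EL in LB; [case/negP: aB|case/negP: cB].
by rewrite cards0 subn0 addnAC subnK // subset_leq_card.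
Qed.

(** Elements of B outside S survive both e_c and e_a, which remove only elements non-transverse to
    the acting hyperplane; c survives e_a because it is transverse to a. *)
Lemma swapped_sub a c C C' : linked a c -> c \in C ->
  gp C' *m (E a *m piece C) != 0 -> swapped a c \subset C'.
Proof.
move=> lac cC nz; have [aB cB] := linked_notin lac.
have /and3P[/eqP Na /eqP Nc tac] := lac.
have nzC : piece C != 0 by apply: contraNneq nz => ->; rewrite !mulmx0.
have CO := piece_orbit K0 nzC.
have [_ _ EN _] := moves_piece K0 tB BVE nzC cC cB.
have inC L : L \in B -> L \notin S -> L \in C.
  by move=> LB; rewrite -Nc EN inE LB andbT negbK.
have trans L : L \in B -> L \notin S -> ~~ nontransverse L a.
  by move=> LB; apply: contra => nt; rewrite -Na inE LB; exact: nt.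
have nz' : gp C' *m E a *m gp C != 0.
  by apply: contraNneq nz => z0; rewrite -(gproj_piece P K0 rV) !mulmxA z0 mul0mx.
have aC' : a \in C'.
  by apply: contraNT nz => aC'; rewrite mulmxA (gproj_e K0 BVE aC') mul0mx.
have keep L : L \in C -> ~~ nontransverse L a -> L \in C'.
  move=> LC ntL; have [aC|aC] := boolP (a \in C).
    suff -> : C' = C by [].
    have [E1 _ _] := BVE a C; apply/eqP; apply: contraNT nz' => neC.
    by rewrite -mulmxA (E1 aC) -scalemxAr (gprojM K0) (negPf neC) scale0r scaler0.
  have [_ _ EC _] := piece_moves K0 tB BVE CO aC nz'.
  apply: contraT => LC'; have : L \in nonT C a by rewrite EC inE LC'.
  by rewrite inE (negPf ntL) andbF.
apply/subsetP => L; rewrite !inE => /orP[/andP[LS LB]|/orP[/eqP->//|/eqP->]].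
  exact: keep (inC L LB LS) (trans L LB LS).
apply: (keep c cC); apply/negP => /andP[_ /negP[]].
by rewrite transverse_sym; exact: tac.
Qed.

Lemma block_sub a c C : linked a c -> gp C *m (E a *m (E c *m gp B)) != 0 ->
  swapped a c \subset C /\ #|C| = #|B|.
Proof.
move=> lac nz; have [aB cB] := linked_notin lac.
have CO : C \in orbit_of B.
  by apply: contraNT nz => nC; rewrite (gproj_orbit K0) // mul0mx.
have [C' /andP[cC' nzC']] : exists C', (c \in C') && (gp C *m (E a *m piece C') != 0).
  apply/existsP; apply: contraNT nz; rewrite negb_exists => /forallP n0.
  rewrite (piece_sum K0 tB BVE cB) !mulmx_sumr big1 // => C' cC'.
  by have := n0 C'; rewrite cC' negbK => /eqP.
by split; [apply: swapped_sub lac cC' nzC' | apply: orbit_card CO].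
Qed.

Lemma block_gproj a c C : linked a c -> C != swapped a c -> (#|S| <= 2)%N ->
  gp C *m (E a *m (E c *m gp B)) = 0.
Proof.
move=> lac neC S2; apply/eqP; apply: contraNT neC => /(block_sub lac)[sub CB].
by rewrite eq_sym eqEcard sub CB -(leq_add2r 2) -(card_swapped lac) leq_add2l.
Qed.

Lemma block_gproj_small a c C : linked a c -> (#|S| < 2)%N ->
  gp C *m (E a *m (E c *m gp B)) = 0.
Proof.
move=> lac S2; apply/eqP; apply: contraTT S2 => /(block_sub lac)[sub CB].
have := subset_leq_card sub; rewrite CB -leqNgt.
by rewrite -(leq_add2r #|S|) (card_swapped lac) leq_add2l.
Qed.

Section Parity.

Hypothesis S2 : #|S| = 2%N.

(** The involution of the count. C has as many elements outside B as B has outside C, that is |S| =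
    2: besides c there is just M. *)
Definition partner a c M := [exists C, [&& troubled a c C, M \in C :\: B & M != c]].

Lemma linked_card a c : linked a c -> #|nonT B a| = 2%N.
Proof. by case/and3P=> /eqP->. Qed.

Lemma linked_transverse a c : linked a c -> transverse a c.
Proof. by case/and3P. Qed.

Lemma partner_piece a c M : linked a c -> partner a c M ->
  exists C, [/\ troubled a c C, troubled a M C, linked a M & C :\: B = [set c; M]].
Proof.
move=> lac /existsP[C /and3P[tr MC Mc]]; have [aB cB] := linked_notin lac.
have tac := linked_transverse lac; have Na : nonT B a != set0 by case/and3P: lac => /eqP->.
have [EN _] := troubled_nonT tac cB Na tr.
have [MinC MB] : M \in C /\ M \notin B by move: MC; rewrite inE => /andP[].
have /and3P[cC taC nz] := tr.
have trM : troubled a M C by apply/and3P.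
have [_ _ EM _] := troubled_moves MB trM.
have ES : S = B :\: C by rewrite -EN; case/and3P: lac => /eqP->.
exists C; split; [exact: tr|exact: trM| |].
  apply/and3P; split; first by case/and3P: lac.
    by rewrite EM -ES.
  exact: (transverse_toP _ _ taC _ MinC).
apply/esym/eqP; rewrite eqEcard cards2 eq_sym Mc subUset !sub1set MC inE cC cB /=.
have CO := piece_orbit K0 nz.
by rewrite -S2 ES -(leq_add2l #|B :&: C|) cardsID setIC cardsID (orbit_card CO).
Qed.

Lemma partner_sym a c M : linked a c -> partner a c M -> partner a M c.
Proof.
move=> lac pM; have [C [tr trM lM EC]] := partner_piece lac pM.
apply/existsP; exists C; rewrite trM EC !inE eqxx /=.
by case/existsP: pM => C' /and3P[_ _]; rewrite eq_sym.
Qed.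

Lemma partner_unique a c M M' : linked a c -> partner a c M -> partner a c M' -> M' = M.
Proof.
move=> lac pM pM'; have [C [tr trM lM EC]] := partner_piece lac pM.
have [C' [tr' trM' lM' EC']] := partner_piece lac pM'.
have [aB cB] := linked_notin lac.
have E1 := troubled_unique (linked_transverse lac) cB (linked_card lac) tr tr'.
have : M' \in C' :\: B by rewrite EC' !inE eqxx orbT.
rewrite -E1 EC !inE => /orP[/eqP E2|/eqP//].
by case/existsP: pM' => C2 /and3P[_ _]; rewrite E2 eqxx.
Qed.

Lemma partner_exists a c : linked a c -> defect a c != 0 -> exists M, partner a c M.
Proof.
move=> lac nz; have [aB cB] := linked_notin lac.
have [C tr] := defect_neq0 cB nz; have tac := linked_transverse lac.
have Na : nonT B a != set0 by case/and3P: lac => /eqP->.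
have [EN _] := troubled_nonT tac cB Na tr.
have cCB : c \in C :\: B by case/and3P: tr => cC _ _; rewrite inE cC cB.
have C2 : #|C :\: B| = 2%N.
  have /and3P[_ _ nzC] := tr; have CO := piece_orbit K0 nzC.
  have ES : S = B :\: C by rewrite -EN; case/and3P: lac => /eqP->.
  apply/eqP; rewrite -S2 ES -(eqn_add2l #|B :&: C|) cardsID setIC cardsID.
  by rewrite (orbit_card CO).
have : (0 < #|(C :\: B) :\ c|)%N by move: C2; rewrite (cardsD1 c) cCB add1n => -[->].
case/card_gt0P=> M; rewrite in_setD1 => /andP[Mc MC].
by exists M; apply/existsP; exists C; rewrite tr MC Mc.
Qed.

(** Both defects are f_a applied to the same piece, which depends on C only. *)
Lemma partner_defect a c M : linked a c -> partner a c M -> defect a M = defect a c.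
Proof.
move=> lac pM; have [C [tr trM lM EC]] := partner_piece lac pM.
have [aB cB] := linked_notin lac; have [_ MB] := linked_notin lM.
rewrite (defect_troubled (linked_transverse lac) cB (linked_card lac) tr).
by rewrite (defect_troubled (linked_transverse lM) MB (linked_card lM) trM).
Qed.

Lemma swapped_inj a c a1 c1 : linked a c -> linked a1 c1 ->
  swapped a c = swapped a1 c1 -> (a, c) = (a1, c1) \/ (a, c) = (c1, a1).
Proof.
move=> lac l1 E1; have [aB cB] := linked_notin lac.
have inP L : L \notin B -> L \in swapped a c -> L = a1 \/ L = c1.
  move=> LB; rewrite E1 !inE (negPf LB) andbF /=.
  by case/orP=> /eqP; [left|right].
have ac := transverse_neq (linked_transverse lac).
have [Ea|Ea] : a = a1 \/ a = c1 by apply: inP; rewrite // !inE eqxx orbT.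
  have [Ec|Ec] : c = a1 \/ c = c1 by apply: inP; rewrite // !inE eqxx !orbT.
    by rewrite Ea Ec eqxx in ac.
  by left; rewrite Ea Ec.
have [Ec|Ec] : c = a1 \/ c = c1 by apply: inP; rewrite // !inE eqxx !orbT.
  by right; rewrite Ea Ec.
by rewrite Ea Ec eqxx in ac.
Qed.

(** In [parity_argument], t exchanges the entries of a pair, b replaces the second by its partner,
    and g is the component of the defect at [C0], the only index where e_a e_c v and e_c e_a v can
    have one. *)
Lemma linked_comm2 a c : linked a c ->
  E a *m (E c *m gp B) = E c *m (E a *m gp B).
Proof.
move=> lac; pose C0 := swapped a c.
pose g (p : hyp W * hyp W) := gp C0 *m defect p.1 p.2.
pose b (p : hyp W * hyp W) :=
  (* On linked pairs with nonzero defect a partner exists, so the default p is not taken. *)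
  if [pick M | partner p.1 p.2 M] is Some M then (p.1, M) else p.
have bE p M : linked p.1 p.2 -> partner p.1 p.2 M -> b p = (p.1, M).
  move=> lp pM; rewrite /b; case: pickP => [M' pM'|/(_ M)]; last by rewrite pM.
  by rewrite (partner_unique lp pM pM').
have defect_gp x y : linked x y ->
    gp C0 *m (E x *m (E y *m gp B)) + g (x, y) =
    gp C0 *m (E y *m (E x *m gp B)) + g (y, x).
  move=> lxy; rewrite /g -!mulmxDr defect_comm ?linked_transverse //.
    by case/and3P: lxy => /eqP->.
  by case/and3P: lxy => _ /eqP->.
have leS : (#|S| <= 2)%N by rewrite S2.
have swappedC x y : swapped x y = swapped y x by rewrite [[set x; y]]setUC.
have gt : g (a, c) = g (c, a).
  apply: (@parity_argument _ _ g 0 [set p | linked p.1 p.2]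
    (fun p => (p.2, p.1)) b (a, c)) => /=; last by rewrite inE.
  - move=> [x y]; rewrite !inE /= => lxy; rewrite (linkedC lxy); split=> //.
    by rewrite xpair_eqE negb_and eq_sym (transverse_neq (linked_transverse lxy)).
  - move=> [x y]; rewrite inE /= => lxy nz.
    have [|M pM] := @partner_exists x y lxy.
      by apply: contraNneq nz => E0; rewrite /g /= E0 mulmx0.
    have [C [tr trM lM EC]] := partner_piece lxy pM.
    have pc := partner_sym lxy pM.
    rewrite !(bE (x, y) M lxy pM) (bE (x, M) y lM pc) inE /= lM; split=> //.
      rewrite xpair_eqE eqxx /=; by case/existsP: pM => C' /and3P[].
    by rewrite /g /= (partner_defect lxy pM).
  (* Off (a, c) and (c, a), neither product of two generators has a component at [C0], since
     [swapped] determines a pair up to order; [defect_comm] then makes g symmetric. *)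
  move=> [x y]; rewrite inE /= => lxy n1 n2.
  have neC : C0 != swapped x y.
    apply/eqP => E1; have [E2|E2] := swapped_inj lxy lac (esym E1).
      by rewrite E2 eqxx in n1.
    by rewrite E2 eqxx in n2.
  have := defect_gp x y lxy.
  rewrite (block_gproj lxy neC leS) (block_gproj (linkedC lxy) _ leS); last first.
    by rewrite swappedC; exact: neC.
  by rewrite !add0r => <-.
have proj x y : linked x y -> swapped x y = C0 ->
    gp C0 *m (E x *m (E y *m gp B)) = E x *m (E y *m gp B).
  move=> lxy E0; rewrite -[RHS]mul1mx -(gproj_sum K0 rV) mulmx_suml.
  rewrite (bigD1 C0) //= big1 ?addr0 // => C' neC.
  by rewrite (block_gproj lxy) // E0.
have := defect_gp a c lac; rewrite gt => /addIr.
by rewrite (proj _ _ lac erefl) (proj _ _ (linkedC lac) (swappedC c a)); exact: id.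
Qed.

End Parity.

End Block.

Lemma e_comm_base a c : transverse a c ->
  E a *m (E c *m gp B) = E c *m (E a *m gp B).
Proof.
move=> tac; have tca : transverse c a by rewrite transverse_sym; exact: tac.
have [aB|aB] := boolP (a \in B); have [cB|cB] := boolP (c \in B).
- have [Ea _ _] := BVE a B; have [Ec _ _] := BVE c B.
  by rewrite (Ea aB) (Ec cB) -!scalemxAr (Ea aB) (Ec cB).
- exact: (e_comm_in K0 tB BVE tac aB cB).
- exact/esym/(e_comm_in K0 tB BVE tca cB aB).
have [_ Ea0 _] := BVE a B; have [_ Ec0 _] := BVE c B.
have [ta|ta] := boolP (transverse_to a B).
  by rewrite (Ea0 ta) mulmx0; apply: (e_transverse_base K0 tB BVE tac cB ta).
have [tc|tc] := boolP (transverse_to c B).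
  by rewrite (Ec0 tc) mulmx0; apply/esym/(e_transverse_base K0 tB BVE tca aB tc).
have Na : nonT B a != set0 by rewrite (nonT0 aB).
have Nc : nonT B c != set0 by rewrite (nonT0 cB).
(* If both defects vanish, [defect_comm] is the claim; otherwise the symmetry of the claim allows
   choosing the nonzero one. *)
wlog nz : a c tac tca aB cB ta tc Na Nc Ea0 Ec0 / defect a c != 0.
  move=> IH; have [Eac|] := eqVneq (defect a c) 0; last exact: IH.
  have [Eca|] := eqVneq (defect c a) 0; last by move=> nz; apply/esym/IH.
  by have := defect_comm tac Na Nc; rewrite Eac Eca !addr0.
have [C tr] := defect_neq0 cB nz.
have [EN N2] := troubled_nonT tac cB Na tr.
have [_ _ EM _] := troubled_moves cB tr.
have lac : linked (nonT B a) a c by apply/and3P; split; [exact: eqxx|rewrite EM EN|exact: tac].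
(* With two elements of B non-transverse to a the parity count applies; with fewer, both products
   are 0. *)
have := N2; rewrite -EN leq_eqVlt => /orP[/eqP S2|S1].
  exact: (linked_comm2 Na S2 lac).
have zero x y : linked (nonT B a) x y -> E x *m (E y *m gp B) = 0.
  move=> lxy; rewrite -[LHS]mul1mx -(gproj_sum K0 rV) mulmx_suml big1 // => C' _.
  exact: (block_gproj_small Na C' lxy S1).
by rewrite (zero _ _ lac) (zero _ _ (linkedC lac)).
Qed.

End Commutation.

Lemma BV_module_exists (R : realType) (W : complexReflectionGroup R) (K : fieldType)
    (P : brauerParams W K) (K0 : [pchar K] =i pred0) (B : {set hyp W}) (d : nat)
    (rV : mx_representation K (Stab B) d) :
  admissible P rV -> exists M : brModule P (ind_dim (Stab B) d), is_BV rV M.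
Proof.
move=> admV; have [tB _] := admV.
have [E BVE] : exists E, BV_rules rV P E.
  by exists (BV_e P rV); apply: (BV_e_rules K0 tB admV).
have [Et EtP] := extended_e_exists K0 tB admV.
have eC a c : transverse a c -> E a *m E c = E c *m E a.
  move=> tac; apply: (eq_on_gproj K0 (rV := rV)) => C /orbit_ofP[u ->].
  have conj x y : E x *m E y *m gproj rV (hset_act u B) = ind_repr rV u *m
      (E (hyp_act u^-1%g x) *m (E (hyp_act u^-1%g y) *m gproj rV B)) *m ind_repr rV u^-1%g.
    rewrite (gproj_conj K0) !mulmxA (BV_we K0 BVE) hyp_actVK.
    by rewrite -(mulmxA (E x) (ind_repr rV u)) (BV_we K0 BVE) hyp_actVK !mulmxA.
  have tu : transverse (hyp_act u^-1%g a) (hyp_act u^-1%g c).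
    by rewrite transverse_act; exact: tac.
  by rewrite !conj (e_comm_base K0 tB BVE EtP tu).
have [M [Mw Me]] := br_module_exists (rho1 rV) (rhoM rV) (BV_e_mul K0 BVE)
  (BV_we K0 BVE) (fun w H => @BV_fixed _ _ _ _ K0 _ _ _ tB admV _ BVE w H) eC
  (fun H1 H2 => @BV_nontransverse _ _ _ _ K0 _ _ _ _ BVE H1 H2).
exists M; apply/(is_BVE K0); split=> [|H C]; first exact: Mw.
by have := BVE H C; rewrite Me.
Qed.

Lemma simple_is_BV (R : realType) (W : complexReflectionGroup R) (K : fieldType)
    (P : brauerParams W K) (hK : proper_field P) (m : nat) (S : brModule P m) :
  br_simple S -> exists (B : {set hyp W}) (d : nat)
      (rV : mx_representation K (Stab B) d) (M : brModule P (ind_dim (Stab B) d)),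
    [/\ admissible P rV, mx_irreducible rV, is_BV rV M & br_iso S M].
Proof.
have [K0 [k [iota [mu_k _ delta_transc _]]]] := hK; move=> simpleS.
have [B [tB eB0 maxB]] := maximal_collection simpleS.
have [d [V [Rb [Z [L [VB EZ LV]]]]]] := rank_factor (S (br_eB P B)).
have [rV rV_S] := top_repr_exists tB VB EZ LV.
have [T [Tw Tu]] := ind_hom_exists K0 (rV := rV) (rho' := fun w => S (br_w P w))
  (br_act_wM S) rV_S (br_act_w1 S).
have [M [BVM isoM]] :=
  top_module_exists K0 mu_k delta_transc simpleS tB eB0 maxB VB EZ LV Tw Tu.
exists B, d, rV, M; split=> //.
  exact: (top_admissible K0 mu_k delta_transc simpleS tB eB0 maxB VB EZ LV Tw Tu).
exact: (top_irreducible K0 mu_k delta_transc simpleS tB eB0 maxB VB EZ LV Tw Tu).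
Qed.

Theorem theorem4p28 (R : realType) (W : complexReflectionGroup R)
    (K : fieldType) (P : brauerParams W K) (hK : proper_field P) :
  [/\ forall (B : {set hyp W}) (d : nat)
             (rV : mx_representation K (Stab B) d),
        admissible P rV ->
        exists M : brModule P (ind_dim (Stab B) d), is_BV rV M,
      forall (B : {set hyp W}) (d : nat)
             (rV : mx_representation K (Stab B) d)
             (M : brModule P (ind_dim (Stab B) d)),
        admissible P rV -> mx_irreducible rV -> is_BV rV M ->
        br_simple M /\ br_absolutely_irreducible M,
      forall (m : nat) (S : brModule P m), br_simple S ->
        exists (B : {set hyp W}) (d : nat)
               (rV : mx_representation K (Stab B) d)
               (M : brModule P (ind_dim (Stab B) d)),
          [/\ admissible P rV, mx_irreducible rV, is_BV rV M & br_iso S M] &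
      (* V and V' are not both zero: the zero modules (B | 0) are all isomorphic *)
      forall (B : {set hyp W}) (d : nat)
             (rV : mx_representation K (Stab B) d)
             (M : brModule P (ind_dim (Stab B) d))
             (B' : {set hyp W}) (d' : nat)
             (rV' : mx_representation K (Stab B') d')
             (M' : brModule P (ind_dim (Stab B') d')),
        admissible P rV -> admissible P rV' ->
        is_BV rV M -> is_BV rV' M' ->
        (0 < d)%N || (0 < d')%N ->
        (br_iso M M' <-> conjugate_pairs rV rV')].
Proof.
have [K0 [k [iota [mu_k split_k delta_transc _]]]] := hK.
split=> [B d rV|B d rV M [tB _] irrV BVM|m S|
         B d rV M B' d' rV' M' [tB _] [tB' _] BVM BVM' d0].
- exact: (BV_module_exists K0).
(* Stab(B) splits over k, hence over K, so the simple module V is absolutely irreducible. *)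
- have absV := extend_group_splitting_field iota (split_k (Stab B)) irrV.
  have simpleM := BV_simple_over K0 mu_k delta_transc tB BVM absV.
  (* Simplicity over K itself is the case of the identity embedding. *)
  split=> //; have := simpleM K idfun; rewrite /br_simple.
  have -> // : (fun x => map_mx idfun (M x)) = M :> (Br P -> 'M[K]_(ind_dim (Stab B) d)).
  by apply/funext => x; rewrite map_mx_id.
- exact: simple_is_BV.
split=> [isoM|]; last exact: (conjugate_iso K0 BVM BVM').
exact: (iso_conjugate K0 BVM BVM' tB tB' isoM d0).
Qed.
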